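(* Suppose that $0<\alpha<n$, $0<\beta<1$, $\alpha+\beta<n$, and $1<q\le p<\infty$. Assume that $b\in C_{\rm c}^\infty(\mathbb{R}^n)$. (i) If $\frac np=\alpha+\beta$, then $[b,I_\alpha]$ maps $\mathcal{M}^p_q$ compactly to $\mathrm{CMO}$. (ii) If $\gamma=\alpha+\beta-\frac np\in(0,1)$, then $[b,I_\alpha]$ maps $\mathcal{M}^p_q$ compactly to $\mathrm{CMO}_\gamma$. (iii) If $\alpha,\beta,s,t$ satisfy $\alpha+\beta<\frac np$, $\frac1s=\frac1p-\frac\alpha n$, $1<t\le s<\infty$, and $\frac ts=\frac qp$, then $[b,I_\alpha]$ maps $\mathcal{M}^p_q$ compactly to $\mathcal{M}^s_t$.
   Context: Everything is on $\mathbb{R}^n$. For $0<q\le p<\infty$ the Morrey space $\mathcal{M}^p_q$ is the set of measurable $f$ with $$\|f\|_{\mathcal{M}^p_q}:=\sup_{x\in\mathbb{R}^n,\,R>0}|B(x,R)|^{\frac1p-\frac1q}\left[\int_{B(x,R)}|f(y)|^q\,dy\right]^{1/q}<\infty.$$ For $\alpha\in(0,n)$, $I_\alpha f(x):=\int_{\mathbb{R}^n}\frac{f(y)}{|x-y|^{n-\alpha}}\,dy$ and $$[b,I_\alpha]f(x):=b(x)I_\alpha f(x)-I_\alpha(bf)(x)=\int_{\mathbb{R}^n}\frac{b(x)-b(y)}{|x-y|^{n-\alpha}}f(y)\,dy.$$ The standing convention is that these operators are well defined on $\mathcal{M}^p_q$ (the defining integrals are taken to converge for $f\in\mathcal{M}^p_q$).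 For $\gamma\in[0,1)$ put $\mathcal{O}_\gamma(f;Q):=|Q|^{-1-\frac\gamma n}\int_Q|f-\langle f\rangle_Q|\,dx$ with $\langle f\rangle_Q:=\frac1{|Q|}\int_Qf$. $\mathrm{BMO}_\gamma$ is the set of $f\in L^1_{\rm loc}$ with $\|f\|_{\mathrm{BMO}_\gamma}:=\sup_Q\mathcal{O}_\gamma(f;Q)<\infty$ (supremum over all cubes). $\mathrm{CMO}_\gamma$ is the subspace, with the same norm, of those $f\in\mathrm{BMO}_\gamma$ such that $\lim_{a\to0^+}\sup_{\ell(Q)\le a}\mathcal{O}_\gamma(f;Q)=0$, $\lim_{|z|\to\infty}\mathcal{O}_\gamma(f;Q+z)=0$ for every fixed cube $Q$, and $\lim_{a\to\infty}\sup_{\ell(Q)\ge a}\mathcal{O}_\gamma(f;Q)=0$, where $\ell(Q)$ is the edge length of $Q$ and $Q+z$ its translate. $\mathrm{CMO}:=\mathrm{CMO}_0$. ''Maps compactly'' means that the operator takes values in the target space and sends the unit ball to a relatively compact set. *)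

(* Defs.v *)
From HB Require Import structures.
From mathcomp Require Import all_boot all_order all_algebra.
From mathcomp Require Import all_classical all_reals all_analysis.

Set Implicit Arguments.
Unset Strict Implicit.
Unset Printing Implicit Defensive.
Import Order.TTheory GRing.Theory Num.Def Num.Theory.
Import numFieldNormedType.Exports.

Local Open Scope classical_set_scope.
Local Open Scope ring_scope.

(* R^n is 'rV[R]_n, and all functions are real-valued. *)

(* [None] stands for the empty box: in dimension 0 the empty set is not of the
   form [a, b[, and the outer measure below must vanish on it. *)
Definition box (R : realType) (n : nat) (ab : option ('rV[R]_n * 'rV[R]_n)) :
    set 'rV[R]_n :=
  if ab is Some (a, b) then
    [set x | forall i, a ord0 i <= x ord0 i < b ord0 i]
  else set0.

Definition box_volume (R : realType) (n : nat)
    (ab : option ('rV[R]_n * 'rV[R]_n)) : \bar R :=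
  if ab is Some (a, b) then (\prod_i maxr 0 (b ord0 i - a ord0 i))%:E else 0%E.

Definition lebesgue_outer (R : realType) (n : nat) (X : set 'rV[R]_n) : \bar R :=
  ereal_inf [set (\sum_(k <oo) box_volume (F k))%E |
    F in [set F : nat -> option ('rV[R]_n * 'rV[R]_n) |
      X `<=` \bigcup_k box (F k)]].

Section lebesgue_outer_is_outer_measure.
Context (R : realType) (n : nat).
Local Open Scope ereal_scope.
Local Notation lam := (@lebesgue_outer R n).

Lemma box_volume_ge0 (ab : option ('rV[R]_n * 'rV[R]_n)) : 0 <= box_volume ab.
Proof.
case: ab => [[a b]|] //=; rewrite lee_fin; apply: prodr_ge0 => i _.
by rewrite le_max lexx.
Qed.

Lemma lebesgue_outer_ge0 A : 0 <= lam A.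
Proof.
apply: le_ereal_inf_tmp => x [F AF <-].
by apply: nneseries_ge0 => k _ _; exact: box_volume_ge0.
Qed.

Lemma lebesgue_outer0 : lam set0 = 0.
Proof.
apply/eqP; rewrite eq_le lebesgue_outer_ge0 andbT.
apply: ereal_inf_lbound; exists (fun=> None) => //=.
by rewrite eseries0.
Qed.

Lemma le_lebesgue_outer : {homo lam : A B / A `<=` B >-> A <= B}.
Proof.
move=> A B AB; apply/ereal_inf_le_tmp => x [F BF <-].
by exists F => //; exact: subset_trans BF.
Qed.

Lemma lebesgue_outer_sigma_subadditive : sigma_subadditive lam.
Proof.
move=> A; have [[i ioo]|] := pselect (exists i, lam (A i) = +oo).
  rewrite (eseries_pinfty _ _ ioo) ?leey// => k _.
  by rewrite -ltNye (lt_le_trans _ (lebesgue_outer_ge0 _)).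
rewrite -forallNE => Aoo.
suff add2e (e : {posnum R}) :
    lam (\bigcup_n A n) <= \sum_(i <oo) lam (A i) + e%:num%:E.
  by apply/lee_addgt0Pr => _/posnumP[].
rewrite (le_trans _ (epsilon_trick _ _ _))//; last first.
  by move=> k; exact: lebesgue_outer_ge0.
pose P k (F : nat -> option ('rV[R]_n * 'rV[R]_n)) :=
  A k `<=` \bigcup_j box (F j) /\
  \sum_(j <oo) box_volume (F j) <= lam (A k) + (e%:num / (2 ^ k.+1)%:R)%:E.
have [G PG] :
    {G : nat -> nat -> option ('rV[R]_n * 'rV[R]_n) & forall k, P k (G k)}.
  apply: (@choice _ _ P) => k; rewrite /P.
  have en1 : (0 < e%:num / (2 ^ k.+1)%:R :> R)%R by [].
  have fA : lam (A k) \is a fin_num.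
    rewrite ge0_fin_numE ?lebesgue_outer_ge0// ltey; exact/eqP/Aoo.
  have [_ [F AF <-] xS] := lb_ereal_inf_adherent en1 fA.
  by exists F; split => //; exact/ltW.
pose v (x : nat * nat) := box_volume (G x.1 x.2).
have v0 x : 0 <= v x by exact: box_volume_ge0.
apply: (@le_trans _ _ (\esum_(i in setT) v i)).
  apply: ereal_inf_lbound => /=.
  have /card_esym/ppcard_eqP[f] := card_nat2.
  exists (fun k => G (f k).1 (f k).2).
    move=> t [i _] /(PG i).1 [j _ Bt].
    by exists (f^-1%FUN (i, j)) => //=; rewrite invK ?inE.
  rewrite -(esum_pred_image v f xpredT) ?[fun=> _]set_true//.
  by rewrite image_eq.
rewrite (_ : esum _ _ = \sum_(i <oo) \sum_(j <oo) v (i, j)); last first.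
  pose J : nat -> set (nat * nat) := fun i => [set (i, j) | j in setT].
  rewrite (_ : setT = \bigcup_k J k); last first.
    by rewrite predeqE => -[a b]; split => // _; exists a => //; exists b.
  rewrite esum_bigcupT /=; last 2 first.
    - apply/trivIsetP => i j _ _ ij.
      rewrite predeqE => -[k m] /=; split => //= -[] [_] _ [<-{k} _].
      by move=> [m' _] [] /esym/eqP; rewrite (negbTE ij).
    - by move=> k; exact: v0.
  rewrite -(image_id [set: nat]) -fun_true esum_pred_image//; last first.
    by move=> k _; exact: esum_ge0.
  apply: eq_eseriesr => /= j _.
  rewrite -(esum_pred_image v (pair j) predT)//=; last first.
    by move=> ? ? _ _; exact: (@can_inj _ _ _ snd).
  by congr esum; rewrite predeqE => -[a b]; split; move=> [i _ <-]; exists i.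
apply: lee_nneseries => [k _|k _ /=]; last exact: (PG k).2.
  by move=> _; apply: nneseries_ge0 => m *; exact: v0.
Qed.

HB.instance Definition _ := isOuterMeasure.Build R 'rV[R]_n lam
  lebesgue_outer0 lebesgue_outer_ge0 le_lebesgue_outer
  lebesgue_outer_sigma_subadditive.

End lebesgue_outer_is_outer_measure.

(* 'rV[R]_n equipped with the (complete) sigma-algebra of Lebesgue measurable
   sets, i.e. those that split [lebesgue_outer] in the sense of Caratheodory. *)
Definition Rn (R : realType) (n : nat) := caratheodory_type (@lebesgue_outer R n).

HB.instance Definition _ (R : realType) (n : nat) :=
  Measurable.copy (Rn R n) (caratheodory_type (@lebesgue_outer R n)).

Definition lebesgue_Rn (R : realType) (n : nat) : set (Rn R n) -> \bar R :=
  @lebesgue_outer R n.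

HB.instance Definition _ (R : realType) (n : nat) :=
  isMeasure.Build _ (Rn R n) R (@lebesgue_Rn R n)
    (@caratheodory_measure0 R _ (@lebesgue_outer R n))
    (@caratheodory_measure_ge0 R _ (@lebesgue_outer R n))
    (@caratheodory_measure_sigma_additive R _ (@lebesgue_outer R n)).

Arguments lebesgue_Rn R n : clear implicits.

Definition enorm (R : realType) (n : nat) (x : 'rV[R]_n) : R :=
  Num.sqrt (\sum_i x ord0 i ^+ 2).

Definition eball (R : realType) (n : nat) (x : 'rV[R]_n) (r : R) : set (Rn R n) :=
  [set y : 'rV[R]_n | enorm (y - x) < r].

Definition partial (R : realType) (n : nat) (i : 'I_n) (f : 'rV[R]_n -> R) :
    'rV[R]_n -> R :=
  fun x => 'D_(delta_mx ord0 i) f x.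

Definition smooth (R : realType) (n : nat) (f : 'rV[R]_n -> R) : Prop :=
  forall s : seq 'I_n, let g := foldr (@partial R n) f s in
    continuous g /\ forall i x, derivable g x (delta_mx ord0 i).

Definition smooth_compact_support (R : realType) (n : nat) (f : 'rV[R]_n -> R) :
    Prop :=
  smooth f /\ compact (closure [set x | f x != 0]).

Definition morrey_norm (R : realType) (n : nat) (p q : R) (f : 'rV[R]_n -> R) :
    \bar R :=
  ereal_sup [set (lebesgue_Rn R n (eball x r) `^ (p^-1 - q^-1) *
      (\int[lebesgue_Rn R n]_(y in eball x r) (`|f y| `^ q)%:E) `^ q^-1)%E |
    x in [set: 'rV[R]_n] & r in [set r : R | 0 < r]].

Definition morrey (R : realType) (n : nat) (p q : R) : set ('rV[R]_n -> R) :=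
  [set f | measurable_fun [set: Rn R n] (f : Rn R n -> R) /\
           (morrey_norm p q f < +oo)%E].

(* At y = x the kernel takes the junk value 0, which no integral sees. *)
Definition riesz_integrand (R : realType) (n : nat) (alpha : R)
    (f : 'rV[R]_n -> R) (x y : 'rV[R]_n) : R :=
  f y / enorm (x - y) `^ (n%:R - alpha).

Definition riesz (R : realType) (n : nat) (alpha : R) (f : 'rV[R]_n -> R) :
    'rV[R]_n -> R :=
  fun x => \int[lebesgue_Rn R n]_y riesz_integrand alpha f x y.

Definition commutator (R : realType) (n : nat) (alpha : R)
    (b f : 'rV[R]_n -> R) : 'rV[R]_n -> R :=
  fun x => b x * riesz alpha f x - riesz alpha (b \* f) x.

(* [riesz] takes junk values where its integral diverges. For a general f in the
   Morrey space convergence can only be asked for almost every x. For bounded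
   measurable b, it also gives the convergence of both integrals in
   [commutator alpha b f x], since b f is again in the Morrey space. *)
Definition riesz_well_defined (R : realType) (n : nat) (alpha p q : R) : Prop :=
  forall f : 'rV[R]_n -> R, morrey p q f ->
    {ae lebesgue_Rn R n, forall x : Rn R n,
      (lebesgue_Rn R n).-integrable [set: Rn R n]
        (fun y => (riesz_integrand alpha f x y)%:E)}.

(* c is the lowest corner and l the edge length, so that the translate of
   cube c l by z is cube (c + z) l. *)
Definition cube (R : realType) (n : nat) (c : 'rV[R]_n) (l : R) : set (Rn R n) :=
  [set x : 'rV[R]_n | forall i, c ord0 i <= x ord0 i <= c ord0 i + l].

Definition average (R : realType) (n : nat) (f : 'rV[R]_n -> R)
    (Q : set (Rn R n)) : R :=
  (fine (lebesgue_Rn R n Q))^-1 * \int[lebesgue_Rn R n]_(x in Q) f x.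

Definition oscillation (R : realType) (n : nat) (gamma : R) (f : 'rV[R]_n -> R)
    (Q : set (Rn R n)) : \bar R :=
  (lebesgue_Rn R n Q `^ (- 1 - gamma / n%:R)%R *
   \int[lebesgue_Rn R n]_(x in Q) `|f x - average f Q|%:E)%E.

Definition BMO_norm (R : realType) (n : nat) (gamma : R) (f : 'rV[R]_n -> R) :
    \bar R :=
  ereal_sup [set oscillation gamma f (cube c l) |
    c in [set: 'rV[R]_n] & l in [set l : R | 0 < l]].

Definition locally_integrable_Rn (R : realType) (n : nat) (f : 'rV[R]_n -> R) :
    Prop :=
  measurable_fun [set: Rn R n] (f : Rn R n -> R) /\
  forall K : set 'rV[R]_n, compact K ->
    (\int[lebesgue_Rn R n]_(x in K) `|f x|%:E < +oo)%E.

Definition BMO (R : realType) (n : nat) (gamma : R) : set ('rV[R]_n -> R) :=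
  [set f | locally_integrable_Rn f /\ (BMO_norm gamma f < +oo)%E].

Definition infinity_nbhs (R : realType) (n : nat) : set_system 'rV[R]_n :=
  filter_from [set: R] (fun M => [set z | M < enorm z]).

Definition CMO (R : realType) (n : nat) (gamma : R) : set ('rV[R]_n -> R) :=
  [set f | [/\ BMO gamma f,
    ereal_sup [set oscillation gamma f (cube c l) |
      c in [set: 'rV[R]_n] & l in [set l : R | 0 < l <= a]]
      @[a --> 0^'+] --> 0%E,
    forall (c : 'rV[R]_n) (l : R), 0 < l ->
      oscillation gamma f (cube (c + z) l)
      @[z --> @infinity_nbhs R n] --> 0%E &
    ereal_sup [set oscillation gamma f (cube c l) |
      c in [set: 'rV[R]_n] & l in [set l : R | a <= l]]
      @[a --> +oo] --> 0%E]].

(* X with the topology induced by N. The norms of interest are seminorms on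
   functions (vanishing on constants, or on null functions); the topology is that
   of the seminorm, so no quotient is taken. *)
Definition seminormed (T : Type) (R : realType) (X : set (T -> R))
    (N : (T -> R) -> \bar R) : Type := {f : T -> R | X f}.

Section seminormed_topology.
Context (T : Type) (R : realType) (X : set (T -> R)) (N : (T -> R) -> \bar R).
Local Notation E := (seminormed X N).

HB.instance Definition _ := gen_eqMixin E.
HB.instance Definition _ := gen_choiceMixin E.

Definition seminormed_open : set_system E :=
  [set U : set E | forall f : E, U f -> exists2 e : R, 0 < e &
    forall g : E, (N (fun x => (sval g x - sval f x)%R) < e%:E)%E -> U g].

Lemma seminormed_openT : seminormed_open setT.
Proof. by move=> f _; exists 1. Qed.

Lemma seminormed_openI (A B : set E) :
  seminormed_open A -> seminormed_open B -> seminormed_open (A `&` B).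
Proof.
move=> oA oB f [/oA[d d0 dA] /oB[e e0 eB]].
exists (minr d e); first by rewrite lt_min d0.
move=> g; rewrite EFin_min lt_min => /andP[gd ge].
by split; [exact: dA|exact: eB].
Qed.

Lemma seminormed_open_bigcup (I : Type) (F : I -> set E) :
  (forall i, seminormed_open (F i)) -> seminormed_open (\bigcup_i F i).
Proof.
move=> oF f [i _ /oF[e e0 eF]]; exists e => // g /eF gF.
by exists i.
Qed.

HB.instance Definition _ := isOpenTopological.Build E
  seminormed_openT seminormed_openI seminormed_open_bigcup.

End seminormed_topology.

Definition maps_compactly (T : Type) (R : realType)
    (X : set (T -> R)) (NX : (T -> R) -> \bar R)
    (Y : set (T -> R)) (NY : (T -> R) -> \bar R)
    (op : (T -> R) -> (T -> R)) : Prop :=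
  (forall f, X f -> Y (op f)) /\
  precompact [set g : seminormed Y NY |
    exists f, [/\ X f, (NX f <= 1)%E & sval g = op f]].

(* Main.v *)
(** Cut the kernel [|x-y|^(alpha-n)] into shells [|x-y| ~ 2^(-j)] and [|x-y| ~ 2^j].
    Each shell piece of the commutator of f is Lipschitz and supported in a fixed
    ball; its norm decays geometrically in j, by smoothness of b on small shells and
    compactness of its support on large ones. The image of the unit ball thus consists
    of the sums of a family of equi-Lipschitz sequences, which is pointwise
    precompact, and summation is continuous on its closure. *)

From HB Require Import structures.
From mathcomp Require Import all_boot all_order all_algebra.
From mathcomp Require Import all_classical all_reals all_analysis.
From mathcomp Require Import measurable_realfun ring lra.
Require Import Defs.

Set Implicit Arguments.
Unset Strict Implicit.
Unset Printing Implicit Defensive.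
Import Order.TTheory GRing.Theory Num.Def Num.Theory.
Import numFieldNormedType.Exports.

Local Open Scope classical_set_scope.

(** Write [sigma = n/p - alpha]. A piece at scale [rho] has size about [min(1, rho) rho^(-sigma)]:
    kernel and Morrey growth of [f] give [rho^(-sigma)], the difference [b x - b y] gives the
    minimum. Large shells thus need [sigma > 0]. This is extracted from the convergence of Riesz
    potentials: if [alpha >= n/p], some function of the Morrey space has a potential that diverges
    everywhere. For a CMO target [sigma = beta - gamma], and small shells decay like
    [rho^(1 - beta)] even in the gamma-Hölder seminorm. For a Morrey target [sigma] may exceed 1,
    and sup bounds on small shells blow up; there the pieces are measured in [L^t], by combining sup
    bounds with averages of [|f|^q] over small balls. Since no sup bound on the sums is then
    available, compactness is obtained for the sequences of pieces, in the topology of pointwise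
    convergence. The sums are determined only almost everywhere and the target norms do not separate
    functions, so summation is a relation and the compact set is built up to distance 0. *)

Local Notation measRn f := (measurable_fun [set: Rn _ _] (f : Rn _ _ -> _)).
Local Open Scope ring_scope.

Ltac ring_powR := repeat (move: (_ `^ _) => ?); ring.

Lemma ler_eq (R : realType) (x y : R) : x = y -> x <= y.
Proof. by move=> ->. Qed.

(** * Comparison of integrals of nonnegative functions *)

Section nonnegative_integrals.
Context d (T : measurableType d) (R : realType) (m : {measure set T -> \bar R}).
Context (E : set T) (g h : T -> R).
Hypothesis mE : measurable E.
Hypothesis mg : measurable_fun [set: T] (fun x => (g x)%:E).
Hypothesis mh : measurable_fun [set: T] (fun x => (h x)%:E).
Hypothesis g0 : forall x, 0 <= g x.
Hypothesis h0 : forall x, 0 <= h x.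

(** The common form in which pointwise bounds are integrated below. Almost every point is enough, as
    sums of pieces are controlled only almost everywhere. *)
Lemma ae_integral_le_linear (k : T -> R) (a c : R) :
  measurable_fun [set: T] (fun x => (k x)%:E) -> (forall x, 0 <= k x) ->
  0 <= a -> 0 <= c ->
  {ae m, forall x, E x -> g x <= a * h x + c * k x} ->
  (\int[m]_(x in E) (g x)%:E <=
   a%:E * \int[m]_(x in E) (h x)%:E + c%:E * \int[m]_(x in E) (k x)%:E)%E.
Proof.
move=> mk k0 a0 c0 ghk.
have scale (b : R) (u : T -> R) : measurable_fun [set: T] (fun x => (u x)%:E) ->
    measurable_fun E (fun x => b%:E * (u x)%:E)%E.
  by move=> mu_; apply: measurable_funTS; apply: measurable_funeM.
have pos (b : R) (u : T -> R) x : 0 <= b -> (forall x, 0 <= u x) -> (0 <= b%:E * (u x)%:E)%E.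
  by move=> b0 u0; rewrite mule_ge0 ?lee_fin.
apply: (@le_trans _ _ (\int[m]_(x in E) (a%:E * (h x)%:E + c%:E * (k x)%:E))%E).
  apply: ae_ge0_le_integral; first exact: mE.
  - by move=> x _; rewrite lee_fin.
  - exact: measurable_funTS.
  - by move=> x _; rewrite adde_ge0 ?pos.
  - by apply: emeasurable_funD; exact: scale.
  - by apply: filterS ghk => x /[apply]; rewrite -lee_fin.
rewrite ge0_integralD; [|exact: mE|by move=> x _; exact: pos|exact: scale
  |by move=> x _; exact: pos|exact: scale].
have zl (b : R) (u : T -> R) : 0 <= b -> (forall x, 0 <= u x) ->
    measurable_fun [set: T] (fun x => (u x)%:E) ->
    (\int[m]_(x in E) (b%:E * (u x)%:E) = b%:E * \int[m]_(x in E) (u x)%:E)%E.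
  move=> b0 u0 mu_; rewrite ge0_integralZl//; first exact: measurable_funTS.
  by move=> x _; rewrite lee_fin.
by rewrite !zl.
Qed.

Lemma ae_integral_le_scale (a : R) : 0 <= a ->
  {ae m, forall x, E x -> g x <= a * h x} ->
  (\int[m]_(x in E) (g x)%:E <= a%:E * \int[m]_(x in E) (h x)%:E)%E.
Proof.
move=> a0 gh; apply: (le_trans (ae_integral_le_linear mh h0 a0 (lexx 0) _)).
  by apply: filterS gh => x /[apply]; rewrite mul0r addr0.
by rewrite mul0e adde0.
Qed.

Lemma ae_integral_le_affine (a c v : R) : (m E <= v%:E)%E -> 0 <= a -> 0 <= c ->
  {ae m, forall x, E x -> g x <= a * h x + c} ->
  (\int[m]_(x in E) (g x)%:E <= a%:E * \int[m]_(x in E) (h x)%:E + (c * v)%:E)%E.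
Proof.
move=> Ev a0 c0 ghc.
have m1 : measurable_fun [set: T] (fun=> (1 : R)%:E) by exact: measurable_cst.
apply: (le_trans (@ae_integral_le_linear (fun=> 1) a c m1 (fun=> ler01) a0 c0 _)).
  by apply: filterS ghc => x /[apply]; rewrite mulr1.
rewrite leeD2l// integral_cst// mul1e EFinM; exact: lee_wpmul2l.
Qed.

End nonnegative_integrals.


(** * The Euclidean norm *)

Section euclidean_norm.
Context (R : realType) (n : nat).
Implicit Types x y z : 'rV[R]_n.

Lemma enorm_ge0 x : 0 <= enorm x.
Proof. exact: sqrtr_ge0. Qed.

Lemma sqr_enorm x : enorm x ^+ 2 = \sum_i x ord0 i ^+ 2.
Proof. by rewrite sqr_sqrtr// sumr_ge0// => i _; exact: sqr_ge0. Qed.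

Lemma enorm0 : enorm (0 : 'rV[R]_n) = 0.
Proof.
rewrite /enorm big1 ?sqrtr0// => i _; by rewrite mxE expr0n.
Qed.

Lemma enormN x : enorm (- x) = enorm x.
Proof. by congr Num.sqrt; apply: eq_bigr => i _; rewrite mxE sqrrN. Qed.

Lemma enormBC x y : enorm (x - y) = enorm (y - x).
Proof. by rewrite -enormN opprB. Qed.

Lemma enorm_coord x i : `|x ord0 i| <= enorm x.
Proof.
rewrite -sqrtr_sqr ler_sqrt ?sumr_ge0//; last by move=> j _; exact: sqr_ge0.
by rewrite (bigD1 i)//= lerDl sumr_ge0// => j _; exact: sqr_ge0.
Qed.

Lemma enorm_eq0 x : enorm x = 0 -> x = 0.
Proof.
move=> x0; apply/rowP => i; rewrite mxE; apply/eqP.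
by rewrite -normr_le0 -x0 enorm_coord.
Qed.

Lemma enorm_gt0 x : x != 0 -> 0 < enorm x.
Proof. by move=> x0; rewrite lt_def enorm_ge0 andbT; apply: contra_neq x0; exact: enorm_eq0. Qed.

(** Cauchy-Schwarz: the sum of the squares [(x_i |y| - y_i |x|)^2] is nonnegative and equals
    [2 |x| |y| (|x| |y| - x.y)]. *)
Lemma dot_le_enorm x y : \sum_i x ord0 i * y ord0 i <= enorm x * enorm y.
Proof.
have [->|x0] := eqVneq x 0.
  by rewrite enorm0 mul0r big1// => i _; rewrite mxE mul0r.
have [->|y0] := eqVneq y 0.
  by rewrite enorm0 mulr0 big1// => i _; rewrite mxE mulr0.
have a0 := enorm_gt0 x0; have b0 := enorm_gt0 y0.
have : 0 <= \sum_i (x ord0 i * enorm y - y ord0 i * enorm x) ^+ 2.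
  by apply: sumr_ge0 => i _; exact: sqr_ge0.
under eq_bigr do rewrite sqrrB !exprMn.
rewrite big_split/= sumrB -!mulr_suml -!sqr_enorm.
have -> : \sum_i x ord0 i * enorm y * (y ord0 i * enorm x) *+ 2 =
    (\sum_i x ord0 i * y ord0 i) * (enorm x * enorm y * 2).
  by rewrite mulr_suml; apply: eq_bigr => i _; rewrite -mulr_natr; ring.
move=> h; rewrite -(ler_pM2r (_ : 0 < enorm x * enorm y)) ?mulr_gt0//.
nra.
Qed.

Lemma enormD x y : enorm (x + y) <= enorm x + enorm y.
Proof.
rewrite -(@ler_pXn2r _ 2) ?nnegrE ?addr_ge0 ?enorm_ge0//.
rewrite sqr_enorm sqrrD !sqr_enorm.
under eq_bigr do rewrite mxE sqrrD.
rewrite !big_split/= lerD2r lerD2l mulr2n.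
by rewrite lerD// dot_le_enorm.
Qed.

Lemma enormB_triangle z x y : enorm (x - y) <= enorm (x - z) + enorm (z - y).
Proof. by rewrite (_ : x - y = (x - z) + (z - y)) ?enormD// addrA subrK. Qed.

Lemma enorm_lipschitz x y : `|enorm x - enorm y| <= enorm (x - y).
Proof.
rewrite ler_norml lerBrDr lerBlDr; apply/andP; split.
  by rewrite addrC lerBlDr -{1}(subrK x y) addrC (enormBC x); exact: enormD.
by rewrite -{1}(subrK y x); exact: enormD.
Qed.

Lemma enorm_le_sum x : enorm x <= \sum_i `|x ord0 i|.
Proof.
rewrite -(@ler_pXn2r _ 2) ?nnegrE ?enorm_ge0 ?sumr_ge0//.
rewrite sqr_enorm expr2 mulr_suml; apply: ler_sum => i _.
rewrite -real_normK ?num_real// expr2 ler_wpM2l// (bigD1 i)//= lerDl.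
exact: sumr_ge0.
Qed.

End euclidean_norm.

(** * Lebesgue measurability of half-spaces and boxes *)

Section boxes.
Context (R : realType).

(** Cut along the hyperplane [x_i = t]. If [t] misses the i-th edge, one of the halves is a
    degenerate box, which [box_volume] counts as 0. *)
Definition box_below n (i : 'I_n) (t : R) :=
  omap (fun ab : 'rV[R]_n * 'rV[R]_n =>
    (ab.1, \row_j if j == i then minr (ab.2 ord0 j) t else ab.2 ord0 j)).

Definition box_above n (i : 'I_n) (t : R) :=
  omap (fun ab : 'rV[R]_n * 'rV[R]_n =>
    (\row_j if j == i then maxr (ab.1 ord0 j) t else ab.1 ord0 j, ab.2)).

Lemma box_belowE n (i : 'I_n) t ab :
  box (box_below i t ab) = box ab `&` [set x | x ord0 i < t].
Proof.
case: ab => [[a b]|]/=; last by rewrite set0I.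
apply/seteqP; split => [x /= h|x /= [h xt] j].
  split => [j|].
    move: (h j); rewrite mxE; case: ifP => // _ /andP[-> ]/=.
    by rewrite lt_min => /andP[].
  by move: (h i); rewrite mxE eqxx lt_min => /and3P[].
by rewrite mxE; case: ifPn => [/eqP ->|_] //; rewrite lt_min xt andbT.
Qed.

Lemma box_aboveE n (i : 'I_n) t ab :
  box (box_above i t ab) = box ab `&` ~` [set x | x ord0 i < t].
Proof.
case: ab => [[a b]|]/=; last by rewrite set0I.
apply/seteqP; split => [x /= h|x /= [h /negP xt] j].
  split => [j|].
    move: (h j); rewrite mxE; case: ifP => // _ /andP[+ ->].
    by rewrite ge_max andbT => /andP[].
  by move: (h i); rewrite mxE eqxx ge_max => /andP[/andP[_ tx] _]; apply/negP; rewrite -leNgt.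
move: xt; rewrite -leNgt mxE; case: ifPn => [/eqP ->|_] //.
by rewrite ge_max => ->; rewrite andbT.
Qed.

Lemma box_volume_cut n (i : 'I_n) t ab :
  (box_volume (box_below i t ab) + box_volume (box_above i t ab) =
   box_volume ab)%E.
Proof.
case: ab => [[a b]|]/=; last by rewrite adde0.
rewrite -EFinD; congr EFin.
rewrite (bigD1 i)//= [X in _ + X](bigD1 i)//= [RHS](bigD1 i)//=.
rewrite !mxE eqxx.
rewrite (eq_bigr (fun j => maxr 0 (b ord0 j - a ord0 j))); last first.
  by move=> j /negPf ji; rewrite mxE ji.
rewrite [in X in _ + X](eq_bigr (fun j => maxr 0 (b ord0 j - a ord0 j)));
    last first.
  by move=> j /negPf ji; rewrite mxE ji.
rewrite -mulrDl; congr (_ * _).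
rewrite /Order.min /Order.max.
by repeat case: ifPn => //; rewrite -?leNgt => *; lra.
Qed.

(** Caratheodory's criterion holds because cutting every box of a cover along the hyperplane gives
    covers of both parts of [X] whose volumes add up to that of the original cover. *)
Lemma measurable_halfspace n (i : 'I_n) (t : R) :
  measurable ([set x : 'rV[R]_n | x ord0 i < t] : set (Rn R n)).
Proof.
apply: (@le_caratheodory_measurable R _ (@lebesgue_outer R n)) => X.
apply: le_ereal_inf_tmp => _ [F XF <-].
under eq_eseriesr do rewrite -(box_volume_cut i t).
rewrite nneseriesD; try by move=> *; exact: box_volume_ge0.
apply: leeD; apply: ereal_inf_lbound => /=.
  exists (fun k => box_below i t (F k)) => // x [/XF[k _ Fk] xt].
  by exists k => //; rewrite box_belowE.
exists (fun k => box_above i t (F k)) => // x [/XF[k _ Fk] xt].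
by exists k => //; rewrite box_aboveE.
Qed.

Lemma measurable_coord n (i : 'I_n) :
  measRn (fun x => (x : 'rV[R]_n) ord0 i).
Proof.
apply: (measurability (RGenInftyO.G (R := R))).
  exact: RGenInftyO.measurableE.
move=> _ [_ [t ->] <-]; rewrite setTI.
rewrite (_ : _ @^-1` _ = [set x : 'rV[R]_n | x ord0 i < t]).
  exact: measurable_halfspace.
by apply/seteqP; split => x; rewrite /= in_itv.
Qed.

Lemma measurable_box n ab : measurable (@box R n ab : set (Rn R n)).
Proof.
case: ab => [[a b]|]/=; last exact: measurable0.
rewrite (_ : (fun _ => _) = \bigcap_(i in [set: 'I_n])
    ((fun x : Rn R n => (x : 'rV[R]_n) ord0 i) @^-1` `[a ord0 i, b ord0 i[)).
  apply: fin_bigcap_measurable => // i _.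
  rewrite -[X in measurable X]setTI; exact: measurable_coord.
apply/seteqP; split => [x h i _|x h i].
  by rewrite /= in_itv/=; exact: h.
by have := h i I; rewrite /= in_itv.
Qed.

End boxes.

(** * Volumes of boxes, cubes and balls *)

Section volume_of_cubes.
Context (R : realType).
Local Open Scope ereal_scope.

Definition box_slice n (t : R) (ab : option ('rV[R]_n.+1 * 'rV[R]_n.+1)) :
    option ('rV[R]_n * 'rV[R]_n) :=
  if ab is Some (a, b) then
    if (a ord0 ord0 <= t < b ord0 ord0)%R then
      Some (\row_i a ord0 (lift ord0 i), \row_i b ord0 (lift ord0 i))
    else None
  else None.

Lemma integral_box_volume_slice n (ab : option ('rV[R]_n.+1 * 'rV[R]_n.+1)) :
  \int[lebesgue_measure]_(t in [set: R]) box_volume (box_slice t ab) =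
  box_volume ab.
Proof.
case: ab => [[a b]|]/=; last by rewrite integral0.
set V := (\prod_(i < n) maxr 0%R (b ord0 (lift ord0 i) - a ord0 (lift ord0 i)))%R.
transitivity (\int[lebesgue_measure]_(t in [set: R])
    (V%:E * (\1_(`[a ord0 ord0, b ord0 ord0[) t)%:E)).
  apply: eq_integral => t _; rewrite indicE mem_setE in_itv/=; case: ifPn => _ /=.
    by rewrite mule1; congr EFin; apply: eq_bigr => i _; rewrite !mxE.
  by rewrite mule0.
have V0 : (0 <= V)%R by apply: prodr_ge0 => i _; rewrite le_max lexx.
have mI : measurable_fun [set: R] (fun t => (\1_(`[a ord0 ord0, b ord0 ord0[) t)%:E : \bar R).
  by apply/measurable_EFinP; exact: measurable_indic.
rewrite ge0_integralZl//.
rewrite integral_indic// setIT.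
rewrite [X in _ * X](_ : _ = lebesgue_measure `[a ord0 ord0, b ord0 ord0[%classic)//.
rewrite lebesgue_measure_itv/= lte_fin big_ord_recl.
rewrite -/V EFinM muleC; congr (_ * _); case: ltP => h.
  by rewrite -EFinB max_r// subr_ge0 ltW.
by rewrite max_l// subr_le0.
Qed.

Lemma measurable_box_volume_slice n (ab : option ('rV[R]_n.+1 * 'rV[R]_n.+1)) :
  measurable_fun [set: R] (fun t => box_volume (box_slice t ab)).
Proof.
case: ab => [[a b]|]/=; last exact: measurable_cst.
set V := (\prod_(i < n) maxr 0%R (b ord0 (lift ord0 i) - a ord0 (lift ord0 i)))%R.
rewrite (_ : (fun _ => _) = EFin \o (fun t => V * \1_(`[a ord0 ord0, b ord0 ord0[) t)%R).
  apply/measurable_EFinP; apply: measurable_funM => //.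
apply/funext => t; rewrite /= indicE mem_setE in_itv/=; case: ifPn => _ /=.
  by rewrite mulr1; congr EFin; apply: eq_bigr => i _; rewrite !mxE.
by rewrite mulr0.
Qed.

(* Induction on the dimension: the slices at height t cover the slice of the box,
   and integrating the inequality between slices over t gives the claim. *)
Lemma box_volume_le_cover n (a b : 'rV[R]_n)
    (F : nat -> option ('rV[R]_n * 'rV[R]_n)) :
  (forall i, a ord0 i < b ord0 i)%R ->
  box (Some (a, b)) `<=` \bigcup_k box (F k) ->
  (\prod_i (b ord0 i - a ord0 i))%:E <= \sum_(k <oo) box_volume (F k).
Proof.
elim: n a b F => [|n IHn] a b F ab cov.
  (* In dimension 0 the only point lies in some [F k], which is then not [None] and has volume 1, an
     empty product. *)
  have [k _ Fk] : (\bigcup_k box (F k)) a by apply: cov => -[].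
  rewrite big_ord0; apply: (@le_trans _ _ (box_volume (F k))).
    by case: (F k) Fk => // -[c d] _ /=; rewrite big_ord0.
  rewrite (@nneseriesD1 _ _ k)//; last by move=> *; exact: box_volume_ge0.
  by rewrite leeDl// nneseries_ge0// => *; exact: box_volume_ge0.
pose V := (\prod_(i < n) (b ord0 (lift ord0 i) - a ord0 (lift ord0 i)))%R.
have V0 : (0 <= V)%R by apply: prodr_ge0 => i _; rewrite subr_ge0 ltW.
have slice t : (a ord0 ord0 <= t < b ord0 ord0)%R ->
    V%:E <= \sum_(k <oo) box_volume (box_slice t (F k)).
  move=> tab.
  pose a' : 'rV[R]_n := (\row_i a ord0 (lift ord0 i))%R.
  pose b' : 'rV[R]_n := (\row_i b ord0 (lift ord0 i))%R.
  have := IHn a' b' (fun k => box_slice t (F k)).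
  rewrite (eq_bigr (fun i => b ord0 (lift ord0 i) - a ord0 (lift ord0 i))%R);
    last by move=> i _; rewrite !mxE.
  apply; first by move=> i; rewrite !mxE.
  move=> y /= yab.
  pose x : 'rV[R]_n.+1 := (\row_i oapp (y ord0) t (unlift ord0 i))%R.
  have x0 : x ord0 ord0 = t by rewrite mxE unlift_none.
  have xS i : x ord0 (lift ord0 i) = y ord0 i by rewrite mxE liftK.
  have [k _ Fkx] : (\bigcup_k box (F k)) x.
    apply: cov => i /=; case: (unliftP ord0 i) => [j|] ->; last by rewrite x0.
    by have := yab j; rewrite xS !mxE.
  exists k => //; case: (F k) Fkx => // -[c d] /= cd.
  have := cd ord0; rewrite x0 => -> j; have := cd (lift ord0 j).
  by rewrite xS !mxE.
have mF k := measurable_box_volume_slice (F k).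
have F0 k t : 0 <= box_volume (box_slice t (F k)) by exact: box_volume_ge0.
have mS : measurable_fun [set: R]
    (fun t => \sum_(k <oo) box_volume (box_slice t (F k))).
  by apply: ge0_emeasurable_sum => // k _; exact: mF.
under eq_eseriesr do rewrite -integral_box_volume_slice.
rewrite -integral_nneseries//.
apply: (@le_trans _ _ (\int[lebesgue_measure]_(t in `[a ord0 ord0, b ord0 ord0[)
    V%:E)).
  rewrite integral_cst//= lebesgue_measure_itv/= lte_fin ab -EFinB -EFinM.
  by rewrite big_ord_recl mulrC.
apply: (@le_trans _ _ (\int[lebesgue_measure]_(t in `[a ord0 ord0, b ord0 ord0[)
    \sum_(k <oo) box_volume (box_slice t (F k)))).
  apply: ge0_le_integral => //.
  by apply: measurable_funTS; exact: mS.
apply: ge0_subset_integral => //.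
by move=> t _; exact: nneseries_ge0.
Qed.

Lemma box_volume_le_lebesgue n (a b : 'rV[R]_n) (X : set 'rV[R]_n) :
  (forall i, a ord0 i < b ord0 i)%R -> box (Some (a, b)) `<=` X ->
  (\prod_i (b ord0 i - a ord0 i))%:E <= lebesgue_Rn R n X.
Proof.
move=> ab sX; apply: le_ereal_inf_tmp => _ [F XF <-].
by apply: box_volume_le_cover => //; exact: subset_trans XF.
Qed.

Lemma lebesgue_le_box_volume n (ab : option ('rV[R]_n * 'rV[R]_n))
    (X : set 'rV[R]_n) :
  X `<=` box ab -> lebesgue_Rn R n X <= box_volume ab.
Proof.
move=> Xab; apply: ereal_inf_lbound => /=.
exists (fun k : nat => if k == 0%N then ab else None).
  by move=> x /Xab ?; exists 0%N.
rewrite (@nneseriesD1 _ _ 0%N)//; last by move=> *; exact: box_volume_ge0.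
by rewrite eseries0 ?adde0// => -[|k].
Qed.

(** Boxes are half-open and cubes are closed, so the edge has to grow. Doubling it is crude, but
    only orders of magnitude of volumes matter below. *)
Lemma cube_sub_box n (c : 'rV[R]_n) l : (0 < l)%R ->
  cube c l `<=` box (Some (c, (c + const_mx (2 * l))%R)).
Proof.
by move=> l0 x xc i /=; rewrite !mxE; have /andP[-> /=] := xc i; lra.
Qed.

Lemma lebesgue_cube_ge n (c : 'rV[R]_n) l : (0 < l)%R ->
  (l ^+ n)%:E <= lebesgue_Rn R n (cube c l).
Proof.
move=> l0.
have := @box_volume_le_lebesgue n c (c + const_mx l)%R (cube c l).
rewrite (eq_bigr (fun=> l)); last by move=> i _; rewrite !mxE addrAC subrr add0r.
rewrite prodr_const card_ord; apply.
  by move=> i; rewrite !mxE ltrDl.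
by move=> x xc i; have := xc i; rewrite !mxE => /andP[-> /ltW].
Qed.

Lemma lebesgue_cube_le n (c : 'rV[R]_n) l : (0 < l)%R ->
  lebesgue_Rn R n (cube c l) <= ((2 * l) ^+ n)%:E.
Proof.
move=> l0; apply: (le_trans (lebesgue_le_box_volume (cube_sub_box l0))) => /=.
rewrite lee_fin (eq_bigr (fun=> 2 * l)%R) ?prodr_const ?card_ord// => i _.
by rewrite !mxE addrAC subrr add0r max_r// mulr_ge0// ltW.
Qed.

Lemma eball_sub_box n (c : 'rV[R]_n) r :
  eball c r `<=` box (Some ((c - const_mx r)%R, (c + const_mx r)%R)).
Proof.
move=> x /= xc i; have := le_lt_trans (enorm_coord (x - c)%R i) xc.
by rewrite !mxE ltr_norml => /andP[]; lra.
Qed.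

Lemma lebesgue_eball_le n (c : 'rV[R]_n) r : (0 < r)%R ->
  lebesgue_Rn R n (eball c r) <= ((2 * r) ^+ n)%:E.
Proof.
move=> r0; apply: (le_trans (lebesgue_le_box_volume (@eball_sub_box n c r))) => /=.
rewrite lee_fin (eq_bigr (fun=> 2 * r)%R) ?prodr_const ?card_ord// => i _.
by rewrite !mxE max_r//; lra.
Qed.

(** The ball contains the half-open box with corner [c] and edge [r / n], because the Euclidean norm
    is at most the sum of the [n] coordinates. *)
Lemma lebesgue_eball_ge n (c : 'rV[R]_n) r : (0 < r)%R -> (0 < n)%N ->
  ((r / n%:R) ^+ n)%:E <= lebesgue_Rn R n (eball c r).
Proof.
move=> r0 n0; have rn : (0 < r / n%:R)%R by rewrite divr_gt0// ltr0n.
have := @box_volume_le_lebesgue n c (c + const_mx (r / n%:R))%R (eball c r).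
rewrite (eq_bigr (fun=> r / n%:R)%R); last by move=> i _; rewrite !mxE addrAC subrr add0r.
rewrite prodr_const card_ord; apply; first by move=> i; rewrite !mxE ltrDl.
move=> x /= xc; apply: (le_lt_trans (enorm_le_sum _)).
have -> : r = (\sum_(i < n) r / n%:R)%R.
  by rewrite sumr_const card_ord -[RHS]mulr_natr divfK// pnatr_eq0 -lt0n.
apply: ltr_sum => [|i _]; first by apply/hasP; exists (Ordinal n0); rewrite ?mem_index_enum.
have := xc i; rewrite !mxE => /andP[h1 h2].
by rewrite ger0_norm; lra.
Qed.

Lemma measurable_cube n (c : 'rV[R]_n) l : measurable (cube c l).
Proof.
rewrite (_ : cube c l = \bigcap_(i in [set: 'I_n])
    ((fun x : Rn R n => (x : 'rV[R]_n) ord0 i) @^-1` `[c ord0 i, (c ord0 i + l)%R])).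
  apply: fin_bigcap_measurable => // i _.
  by rewrite -[X in measurable X]setTI; exact: measurable_coord.
apply/seteqP; split => [x h i _|x h i].
  by rewrite /= in_itv/=; exact: h.
by have := h i I; rewrite /= in_itv.
Qed.

Lemma measurable_enorm d (T : measurableType d) n (f : T -> 'rV[R]_n) :
  (forall i, measurable_fun [set: T] (fun x => f x ord0 i)) ->
  measurable_fun [set: T] (fun x => enorm (f x)).
Proof.
move=> mf; apply: measurableT_comp.
  exact: (continuous_measurable_fun (@sqrt_continuous R)).
by apply: measurable_sum => i; apply: measurable_funX; exact: mf.
Qed.

Lemma measurable_enormB n (c : 'rV[R]_n) :
  measRn (fun x => enorm ((x : 'rV[R]_n) - c)%R).
Proof.
apply: measurable_enorm => i.
apply: (eq_measurable_fun (fun x : Rn R n => (x : 'rV[R]_n) ord0 i - c ord0 i)%R).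
  by move=> x _; rewrite !mxE.
by apply: measurable_funB; [exact: measurable_coord|exact: measurable_cst].
Qed.

Lemma measurable_eball n (c : 'rV[R]_n) r : measurable (eball c r).
Proof.
have /= := @measurable_enormB n c measurableT `]-oo, r[%classic (measurable_itv _).
rewrite setTI.
by rewrite (_ : _ @^-1` _ = eball c r).
Qed.

End volume_of_cubes.

Section lebesgue_sigma_finite.
Context (R : realType) (n : nat).

(** Gives access to Tonelli's theorem, on which the measurability of Riesz potentials and the double
    integrals over balls rest. *)
Lemma lebesgue_Rn_sigma_finite : sigma_finite [set: Rn R n] (lebesgue_Rn R n).
Proof.
exists (fun k => eball (0 : 'rV[R]_n) k.+1%:R) => [|k].
  apply/esym/seteqP; split => // x _.
  exists (Num.truncn (enorm (x : 'rV[R]_n))) => //=.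
  by rewrite /eball/= subr0 truncnS_gt.
split; first exact: measurable_eball.
exact: (le_lt_trans (lebesgue_eball_le _ _)) (ltry _).
Qed.

HB.instance Definition _ := Measure_isSigmaFinite.Build _ _ _ (lebesgue_Rn R n)
  lebesgue_Rn_sigma_finite.

End lebesgue_sigma_finite.


(** * Topology of the Euclidean norm, and measurability of open sets *)

Section euclidean_topology.
Context (R : realType) (n : nat).
Implicit Types x y z : 'rV[R]_n.

(** The library topology is that of the sup norm; the Euclidean norm lies between it and the sum of
    coordinates. Dividing by [n.+1] rather than [n] makes the inequality strict and covers dimension
    0. *)
Lemma nbhs_enormP x (P : set 'rV[R]_n) :
  nbhs x P <-> exists2 e : R, 0 < e & forall y, enorm (y - x) < e -> P y.
Proof.
split => [/nbhs_ballP[e /= e0 eP]|[e e0 eP]].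
  exists e => // y yx; apply: eP; split => // i j.
  rewrite /ball/= (ord1 i) distrC.
  by apply: le_lt_trans yx; have := enorm_coord (y - x) j; rewrite !mxE.
apply/nbhs_ballP; exists (e / n.+1%:R); first by rewrite /= divr_gt0.
move=> y [_ xy]; apply: eP; apply: (le_lt_trans (enorm_le_sum _)).
apply: (@le_lt_trans _ _ (\sum_(i < n) e / n.+1%:R)).
  apply: ler_sum => i _; have := xy ord0 i.
  by rewrite /ball/= distrC !mxE => /ltW.
rewrite sumr_const card_ord -[ltLHS]mulr_natr -[ltRHS](@divfK _ n.+1%:R)//.
by rewrite ltr_pM2l ?divr_gt0// ltr_nat.
Qed.

Lemma continuous_enormP (f : 'rV[R]_n -> R) :
  (forall x e, 0 < e -> exists2 d, 0 < d &
    forall y, enorm (y - x) < d -> `|f y - f x| <= e) -> continuous f.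
Proof.
move=> fP x; apply/(@cvgrPdist_le _ _ _ (nbhs x) (nbhs_filter x)) => e e0; have [d d0 xd] := fP x e e0.
by apply/nbhs_enormP; exists d => // y /xd; rewrite distrC.
Qed.

Lemma lipschitz_continuous_Rn (f : 'rV[R]_n -> R) (L : R) :
  (forall x y, `|f x - f y| <= L * enorm (x - y)) -> continuous f.
Proof.
move=> fL; apply: continuous_enormP => x e e0.
have L0 : 0 < `|L| + 1 by rewrite ltr_wpDl.
exists (e / (`|L| + 1)); first by rewrite divr_gt0.
move=> y yx; apply: (le_trans (fL _ _)).
apply: (@le_trans _ _ ((`|L| + 1) * enorm (y - x))).
  by rewrite ler_wpM2r ?enorm_ge0//; have := ler_norm L; lra.
by rewrite mulrC -ler_pdivlMr// ltW.
Qed.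

Lemma compact_enorm_bounded (A : set 'rV[R]_n) : compact A ->
  exists2 M : R, 0 < M & forall x, A x -> enorm x < M.
Proof.
move=> /compact_bounded[M [_ MA]].
pose M1 := `|M| + 1.
have M10 : 0 <= M1 by rewrite addr_ge0.
exists (n%:R * M1 + 1); first by rewrite ltr_wpDl// mulr_ge0.
move=> x Ax; rewrite (le_lt_trans (enorm_le_sum _))//.
apply: (@le_lt_trans _ _ (\sum_(i < n) M1)).
  apply: ler_sum => i _.
  have : `|x| <= M1.
    by apply: MA => //; rewrite /M1; have := ler_norm M; lra.
  apply: le_trans; rewrite /Num.norm/= mx_normrE.
  exact: (@le_bigmax _ _ _ 0 (fun ij => `|x ij.1 ij.2|) (ord0, i)).
by rewrite sumr_const card_ord mulr_natl ltrDl.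
Qed.

Lemma compact_closed_ball (r : R) : compact [set x : 'rV[R]_n | enorm x <= r].
Proof.
apply: bounded_closed_compact.
  exists r; split; first exact: num_real.
  move=> M rM x /= xr; rewrite /Num.norm/= mx_normrE.
  apply/bigmax_leP; split => [|[i j] _ /=].
    by rewrite (le_trans (enorm_ge0 x))// (le_trans xr)// ltW.
  by rewrite (ord1 i) (le_trans (enorm_coord _ _))// (le_trans xr)// ltW.
have ce : continuous (@enorm R n).
  apply: (@lipschitz_continuous_Rn _ 1) => x y; rewrite mul1r.
  exact: enorm_lipschitz.
rewrite (_ : mkset _ = @enorm R n @^-1` [set u | u <= r])//.
by apply: closed_comp => //; exact: closed_le.
Qed.

(** The measurable sets are those of Caratheodory, so openness must be related to boxes: [U] is the
    countable union of the half-open boxes inside [U] with rational corner and edge [1/(m+1)]. *)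
Lemma open_measurable_Rn (U : set 'rV[R]_n) : open U -> measurable (U : set (Rn R n)).
Proof.
move=> oU.
pose B (am : 'rV[rat]_n * nat) : set 'rV[R]_n :=
  box (Some (map_mx ratr am.1, map_mx ratr am.1 + const_mx (am.2.+1%:R^-1))).
pose C am := if `[< B am `<=` U >] then B am else set0.
rewrite (_ : U = \bigcup_am C am).
  apply: countable_bigcupT_measurable => [|am].
    exact: countableP.
  rewrite /C; case: ifP => _; last exact: measurable0.
  exact: measurable_box.
apply/seteqP; split => [x Ux|x [am _]]; last first.
  by rewrite /C; case: asboolP => // sU /sU.
have /nbhs_ballP[e /= e0 xe] : nbhs x U by exact: open_nbhs_nbhs.
pose m := Num.truncn e^-1.
have me : m.+1%:R^-1 < e.
  by rewrite invf_plt ?posrE// truncnS_gt.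
have m0 : 0 < m.+1%:R^-1 :> R by rewrite invr_gt0.
have /choice[a aP] : forall i, exists q : rat,
    ratr q \in `]x ord0 i - m.+1%:R^-1, x ord0 i[.
  by move=> i; apply: rat_in_itvoo; rewrite ltrBlDr ltrDl.
exists (\row_i a i, m) => //; rewrite /C.
case: asboolP => [_ i|]; last first.
  case => y By; apply: xe; split => // i j; have -> : i = ord0 := ord1 i.
  rewrite /ball/=; have := By j; rewrite !mxE/=; have := aP j; rewrite in_itv/= => /andP[h1 h2].
  move=> /andP[h3 h4]; rewrite ltr_norml.
  by move: m.+1%:R^-1 me h1 h4 => r me h1 h4; apply/andP; split; lra.
rewrite !mxE/=; have := aP i; rewrite in_itv/= => /andP[h1 h2].
by move: m.+1%:R^-1 h1 => r h1; apply/andP; split; lra.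
Qed.

Lemma continuous_measurable_Rn (f : 'rV[R]_n -> R) :
  continuous f -> measRn f.
Proof.
move=> cf; apply: (measurability (RGenInftyO.G (R := R))).
  exact: RGenInftyO.measurableE.
move=> _ [_ [t ->] <-]; rewrite setTI; apply: open_measurable_Rn.
by apply: open_comp => //; exact: interval_open.
Qed.

Lemma continuous_support_bounded (f : 'rV[R]_n -> R) (K : set 'rV[R]_n) :
  compact K -> continuous f -> (forall x, ~ K x -> f x = 0) ->
  exists2 M : R, 0 < M & forall x, `|f x| <= M.
Proof.
move=> cK cf f0.
have /compact_bounded[M [_ MA]] : compact [set f x | x in K].
  by apply: continuous_compact => //; exact: continuous_subspaceT.
exists (`|M| + 1) => [|x]; first by rewrite ltr_wpDl.
have [Kx|/f0 ->] := pselect (K x); last by rewrite normr0 addr_ge0.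
by apply: MA; [have := ler_norm M; lra|exists x].
Qed.

End euclidean_topology.

(** * Bounds for smooth functions of compact support *)

Section test_functions.
Context (R : realType) (n : nat) (b : 'rV[R]_n -> R).
Hypothesis hb : smooth_compact_support b.

Let K := closure [set x | b x != 0].

Lemma smooth_continuous : continuous b.
Proof. by have [] := hb.1 [::]. Qed.

Let b_out x : ~ K x -> b x = 0.
Proof.
by move=> Kx; apply/eqP; apply: contra_notT Kx => bx; exact: subset_closure.
Qed.

Lemma test_function_bounded : exists2 M : R, 0 < M & forall x, `|b x| <= M.
Proof. exact: continuous_support_bounded hb.2 smooth_continuous b_out. Qed.

Lemma test_function_support :
  exists2 r : R, 0 < r & forall x, r <= enorm x -> b x = 0.
Proof.
have [M M0 KM] := compact_enorm_bounded hb.2.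
exists M => // x Mx; apply: b_out => /KM; by rewrite ltNge Mx.
Qed.

(** Off the support [b] vanishes on a neighbourhood, so its partial derivatives vanish there too and
    are continuous functions supported in a compact set. *)
Lemma test_function_partial_bounded i :
  exists2 M : R, 0 < M & forall x, `|partial i b x| <= M.
Proof.
apply: (continuous_support_bounded hb.2); first by have [] := hb.1 [:: i].
move=> x Kx; rewrite /partial.
rewrite (@near_eq_derive _ _ _ _ (fun=> 0 : R)); first by rewrite derive_cst.
have /nbhs_interior : nbhs x (~` K).
  by apply: open_nbhs_nbhs; split => //; apply: closed_openC; exact: closed_closure.
by apply: filterS => y; move=> /nbhs_singleton; exact: b_out.
Qed.

Lemma test_function_coord_lipschitz i (M : R) :
  (forall x, `|partial i b x| <= M) ->
  forall x t, `|b (x + t *: delta_mx ord0 i) - b x| <= M * `|t|.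
Proof.
move=> bM.
have pos x t : 0 < t -> `|b (x + t *: delta_mx ord0 i) - b x| <= M * t.
  move=> t0; pose f (s : R) := b (x + s *: delta_mx ord0 i).
  pose df (s : R) := partial i b (x + s *: delta_mx ord0 i).
  have fdf (s : R) : is_derive s (1 : R) f (df s).
    have := (hb.1 [::]).2 i (x + s *: delta_mx ord0 i).
    have E : (fun h : R => h^-1 *: ((f \o shift s) (h *: 1) - f s)) =
        (fun h => h^-1 *: ((b \o shift (x + s *: delta_mx ord0 i)) (h *: delta_mx ord0 i)
            - b (x + s *: delta_mx ord0 i))).
      apply/funext => h; rewrite /f /= -[h *: 1]/(h * 1) mulr1.
      by rewrite scalerDl addrCA.
    move=> dd; apply: DeriveDef; first by rewrite /derivable E.
    by rewrite /derive E.
  have cf : {within `[0, t], continuous f}.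
    by apply: derivable_within_continuous => s _; have [] := fdf s.
  have [c _] := MVT t0 (fun s _ => fdf s) cf.
  rewrite /f scale0r addr0 subr0 => ->; rewrite normrM (gtr0_norm t0).
  by rewrite ler_wpM2r ?bM// ltW.
move=> x t; have [t0|t0|->] := ltgtP t 0.
- have := pos (x + t *: delta_mx ord0 i) (- t).
  by rewrite oppr_gt0 scaleNr addrK distrC (ltr0_norm t0) => ->.
- by rewrite (gtr0_norm t0) pos.
- by rewrite scale0r addr0 subrr normr0 mulr0.
Qed.

(** Smoothness is stated through partial derivatives, so the way from [y] to [x] changes one
    coordinate at a time: [z k] has the first [k] coordinates of [x] and the others of [y], and each
    step is a mean value estimate along an axis. *)
Lemma test_function_lipschitz :
  exists2 L : R, 0 < L & forall x y, `|b x - b y| <= L * enorm (x - y).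
Proof.
have /choice[M MP] : forall i, exists M, 0 < M /\ forall x, `|partial i b x| <= M.
  by move=> i; have [M] := test_function_partial_bounded i; exists M.
pose L := \sum_i M i; have L0 : 0 <= L.
  by apply: sumr_ge0 => i _; rewrite ltW// (MP i).1.
exists (L + 1) => [|x y]; first by rewrite ltr_wpDl.
apply: (@le_trans _ _ (L * enorm (x - y))); last first.
  by rewrite ler_wpM2r ?enorm_ge0// lerDl.
pose z k : 'rV[R]_n := \row_i if (i < k)%N then x ord0 i else y ord0 i.
have zP k : (k <= n)%N ->
    `|b (z k) - b y| <= (\sum_(i < n | (i < k)%N) M i) * enorm (x - y).
  elim: k => [_|k IH kn].
    rewrite big_pred0// mul0r (_ : z 0%N = y) ?subrr ?normr0//.
    by apply/rowP => i; rewrite mxE.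
  pose i0 := Ordinal kn.
  have neq_k i : i != i0 -> (nat_of_ord i == k) = false.
    by move=> ii0; apply: contraNF ii0 => /eqP ik; apply/eqP/val_inj.
  have -> : z k.+1 = z k + (x ord0 i0 - y ord0 i0) *: delta_mx ord0 i0.
    apply/rowP => i; rewrite !mxE eqxx/= ltnS leq_eqVlt.
    have [->|ii0] := eqVneq i i0; first by rewrite /= eqxx ltnn/= mulr1 addrC subrK.
    by rewrite mulr0 addr0 neq_k.
  rewrite (bigD1 i0)//= ?ltnSn// mulrDl.
  rewrite -(subrK (b (z k)) (b (z k + _))) -addrA.
  apply: (le_trans (ler_normD _ _)); apply: lerD.
    apply: (le_trans (test_function_coord_lipschitz (MP i0).2 _ _)).
    rewrite ler_wpM2l ?(ltW (MP i0).1)//.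
    by have := enorm_coord (x - y) i0; rewrite !mxE.
  rewrite (eq_bigl (fun i : 'I_n => (i < k)%N)); first exact: (IH (ltnW kn)).
  move=> i; rewrite ltnS leq_eqVlt.
  have [->|ii0] := eqVneq i i0; first by rewrite /= ltnn andbF.
  by rewrite andbT neq_k.
have := zP n (leqnn n); rewrite (_ : z n = x); last first.
  by apply/rowP => i; rewrite mxE ltn_ord.
by rewrite (eq_bigl xpredT)// => i; rewrite ltn_ord.
Qed.

End test_functions.


(** * Real powers *)

Section powers.
Context (R : realType).
Implicit Types a s t : R.

Lemma powRpD a s t : 0 < a -> a `^ (s + t) = a `^ s * a `^ t.
Proof. by move=> a0; rewrite powRD// (gt_eqF a0) implybT. Qed.

Lemma powRpV a s : 0 < a -> (a^-1) `^ s = a `^ (- s).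
Proof. by move=> a0; rewrite -(powR_inv1 (ltW a0)) -powRrM mulN1r. Qed.

Lemma powR_le_pos a s t : 0 <= t -> 0 <= a -> a <= s -> a `^ t <= s `^ t.
Proof.
by move=> t0 a0 as_; apply: ge0_ler_powR; rewrite ?nnegrE// (le_trans a0).
Qed.

Lemma powR_invK t c : 0 < t -> 0 <= c -> (c `^ t^-1) `^ t = c.
Proof. by move=> t0 c0; rewrite -powRrM mulVf ?lt0r_neq0// powRr1. Qed.

Lemma le_powR_inv t a c : 0 < t -> 0 <= a -> a `^ t <= c -> a <= c `^ t^-1.
Proof.
move=> t0 a0 ac; rewrite -[leLHS]powRr1// -(mulfV (lt0r_neq0 t0)) powRrM.
by apply: powR_le_pos ac; [rewrite invr_ge0 ltW|exact: powR_ge0].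
Qed.

Lemma powR_le_neg a s t : 0 < a -> t <= 0 -> a <= s -> s `^ t <= a `^ t.
Proof.
move=> a0 t0 as_; have s0 := lt_le_trans a0 as_.
rewrite -(opprK t) (powRN s) (powRN a) lef_pV2 ?posrE ?powR_gt0//.
by apply: powR_le_pos; rewrite ?oppr_ge0// ltW.
Qed.

(** A mean value bound without derivatives: for [x = s/t <= 1] one has
    [1 - x^lam <= 1 - x^n <= n (1 - x)], the last step being Bernoulli's inequality. This is why
    [lam] is compared with an integer. *)
Lemma powR_negB_le a s t lam n : 0 < lam <= n%:R -> 0 < a -> a <= s -> s <= t ->
  s `^ (- lam) - t `^ (- lam) <= n%:R * a `^ (- lam - 1) * (t - s).
Proof.
move=> /andP[lam0 lamn] a0 as_ st.
have s0 := lt_le_trans a0 as_; have t0 := lt_le_trans s0 st.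
have x1 : s / t <= 1 by rewrite ler_pdivrMr// mul1r.
have x0 : 0 < s / t by rewrite divr_gt0.
have bern k x : 0 <= x <= 1 -> 1 - k%:R * (1 - x) <= x ^+ k :> R.
  move=> /andP[y0 y1]; elim: k => [|k IH]; first by rewrite expr0 mul0r subr0.
  rewrite exprS; have : x * (1 - k%:R * (1 - x)) <= x * x ^+ k by rewrite ler_wpM2l.
  apply: le_trans; rewrite -natr1.
  have : 0 <= k%:R :> R by [].
  by move: (k%:R) => u u0; have := mulr_ge0 u0 (sqr_ge0 (1 - x)); rewrite expr2; nra.
have h1 : 1 - n%:R * (1 - s / t) <= (s / t) `^ lam.
  apply: (le_trans (bern _ _ _)); first by rewrite x1 ltW.
  by rewrite -powR_mulrn ?(ltW x0)//; apply: ger_powR; rewrite ?x0.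
have -> : t `^ (- lam) = s `^ (- lam) * (s / t) `^ lam.
  rewrite powRM ?invr_ge0 ?(ltW s0) ?(ltW t0)// mulrA -powRpD// addNr powRr0 mul1r.
  by rewrite powRpV.
rewrite -[X in X - _]mulr1 -mulrBr.
have h2 : 1 - (s / t) `^ lam <= n%:R * (1 - s / t) by lra.
have h3 : s `^ (- lam) <= a `^ (- lam).
  by apply: powR_le_neg => //; rewrite oppr_le0 ltW.
apply: (@le_trans _ _ (a `^ (- lam) * (n%:R * (1 - s / t)))).
  apply: (@le_trans _ _ (s `^ (- lam) * (n%:R * (1 - s / t)))).
    by rewrite ler_wpM2l ?powR_ge0.
  by rewrite ler_wpM2r// mulr_ge0// subr_ge0.
rewrite powRpD// powR_inv1 ?(ltW a0)// mulrCA -[leRHS]mulrA ler_wpM2l//.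
rewrite -mulrA ler_wpM2l ?powR_ge0//.
have -> : 1 - s / t = t^-1 * (t - s) by field; rewrite gt_eqF.
rewrite ler_wpM2r ?subr_ge0// lef_pV2 ?posrE//; exact: le_trans st.
Qed.

Lemma sum_geometric_le (x : R) m : 0 <= x < 1 -> \sum_(j < m) x ^+ j <= (1 - x)^-1.
Proof.
move=> /andP[x0 x1].
have h : (1 - x) * \sum_(j < m) x ^+ j = 1 - x ^+ m.
  by rewrite -opprB mulNr -subrX1 opprB.
rewrite -(ler_pM2l (_ : 0 < 1 - x)) ?subr_gt0// h mulfV; last by rewrite subr_eq0 gt_eqF.
by rewrite lerBlDr lerDl exprn_ge0.
Qed.

End powers.

(** * The dyadic decomposition of the kernel *)

Section truncated_power.
Context (R : realType) (lam : R) (n : nat).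
Hypothesis hlam : 0 < lam <= n%:R.
Implicit Types rho s t : R.

Definition trunc_pow rho s : R := (Num.max s rho) `^ (- lam).

(** A difference of two consecutive truncations, constant for [s <= rho] and zero beyond [2 rho]: it
    lives on a ball rather than on a shell. In exchange it is Lipschitz and the scales telescope. *)
Definition shell_kernel rho s : R := trunc_pow rho s - trunc_pow (2 * rho) s.

Lemma trunc_pow_ge0 rho s : 0 <= trunc_pow rho s.
Proof. exact: powR_ge0. Qed.

Lemma trunc_pow_le rho s : 0 < rho -> trunc_pow rho s <= rho `^ (- lam).
Proof.
move=> rho0; apply: powR_le_neg => //; last by rewrite le_max lexx orbT.
by have := hlam; lra.
Qed.

Lemma trunc_pow_le_pow rho s : 0 < s -> trunc_pow rho s <= s `^ (- lam).
Proof.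
move=> s0; apply: powR_le_neg => //; last by rewrite le_max lexx.
by have := hlam; lra.
Qed.

Lemma trunc_pow_mono rho rho' s : 0 < rho -> rho <= rho' ->
  trunc_pow rho' s <= trunc_pow rho s.
Proof.
move=> r0 rr; apply: powR_le_neg.
- by rewrite lt_max r0 orbT.
- by have := hlam; lra.
- by rewrite ge_max !le_max lexx rr orbT.
Qed.

Lemma trunc_pow_lipschitz rho s t : 0 < rho ->
  `|trunc_pow rho s - trunc_pow rho t| <= n%:R * rho `^ (- lam - 1) * `|s - t|.
Proof.
move=> rho0; wlog st : s t / s <= t.
  move=> H; have [/H//|/ltW/H] := leP s t.
  by rewrite distrC (distrC s).
have mst : Num.max s rho <= Num.max t rho by rewrite ge_max !le_max st lexx orbT.
rewrite ger0_norm; last first.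
  rewrite subr_ge0; apply: powR_le_neg => //; first by rewrite lt_max rho0 orbT.
  by have := hlam; lra.
apply: (le_trans (powR_negB_le hlam rho0 _ mst)); first by rewrite le_max lexx orbT.
rewrite ler_wpM2l ?mulr_ge0 ?powR_ge0// (distrC s) ger0_norm ?subr_ge0//.
by rewrite /Num.max; case: ltP => h1; case: ltP => h2; lra.
Qed.

Lemma shell_kernel_ge0 rho s : 0 < rho -> 0 <= shell_kernel rho s.
Proof. by move=> rho0; rewrite subr_ge0; apply: trunc_pow_mono => //; lra. Qed.

Lemma shell_kernel_le rho s : 0 < rho -> shell_kernel rho s <= rho `^ (- lam).
Proof.
by move=> rho0; rewrite lerBlDr (le_trans (trunc_pow_le _ rho0))// lerDl trunc_pow_ge0.
Qed.

Lemma shell_kernel_out rho s : 0 < rho -> 2 * rho <= s -> shell_kernel rho s = 0.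
Proof.
by move=> rho0 h; rewrite /shell_kernel /trunc_pow !max_l ?subrr//; lra.
Qed.

Lemma shell_kernel_lipschitz rho s t : 0 < rho ->
  `|shell_kernel rho s - shell_kernel rho t| <=
  2 * n%:R * rho `^ (- lam - 1) * `|s - t|.
Proof.
move=> rho0; have rho20 : 0 < 2 * rho by lra.
have -> : shell_kernel rho s - shell_kernel rho t = (trunc_pow rho s - trunc_pow rho t) -
    (trunc_pow (2 * rho) s - trunc_pow (2 * rho) t) by rewrite /shell_kernel; ring.
apply: (le_trans (ler_normB _ _)).
set k := n%:R * rho `^ (- lam - 1) * `|s - t|.
rewrite (_ : 2 * n%:R * _ * _ = k + k); last by rewrite /k; ring.
apply: lerD; first exact: trunc_pow_lipschitz.
rewrite /k; apply: (le_trans (trunc_pow_lipschitz _ _ rho20)).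
rewrite ler_wpM2r// ler_wpM2l//; apply: powR_le_neg => //.
  by have := hlam; lra.
by lra.
Qed.

(** One small and one large scale per index, so that a two-sided sum is indexed by [nat]. The shift
    [j.+1] avoids counting scale 1 twice, and partial sums telescope at both ends. *)
Definition shell_pair (j : nat) s : R :=
  shell_kernel (2^-1 ^+ j.+1) s + shell_kernel (2 ^+ j) s.

Lemma sum_shell_pair m s :
  \sum_(j < m) shell_pair j s = trunc_pow (2^-1 ^+ m) s - trunc_pow (2 ^+ m) s.
Proof.
elim: m => [|m IHm]; first by rewrite big_ord0 !expr0 subrr.
rewrite big_ord_recr/= IHm /shell_pair /shell_kernel.
rewrite [2^-1 ^+ m.+1]exprS mulrA mulfV// mul1r -exprS [2^-1 ^+ m.+1]exprS (exprS 2).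
by ring.
Qed.

Lemma sum_shell_pair_ge0 m s : 0 <= \sum_(j < m) shell_pair j s.
Proof.
apply: sumr_ge0 => j _; apply: addr_ge0; apply: shell_kernel_ge0;
  by rewrite exprn_gt0.
Qed.

Lemma sum_shell_pair_le m s : 0 < s -> \sum_(j < m) shell_pair j s <= s `^ (- lam).
Proof.
move=> s0; rewrite sum_shell_pair lerBlDr.
by rewrite (le_trans (trunc_pow_le_pow _ s0))// lerDl trunc_pow_ge0.
Qed.

(** In the telescoped sum the inner truncation is inactive once [2^(-m) <= s], and the outer one is
    at most [(2^m)^(-lam)]. *)
Lemma sum_shell_pair_cvg s : 0 < s ->
  \sum_(j < m) shell_pair j s @[m --> \oo] --> s `^ (- lam).
Proof.
move=> s0; rewrite -[X in _ --> X]subr0.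
under eq_fun do rewrite sum_shell_pair.
have h2 : (2^-1 : R) ^+ m @[m --> \oo] --> (0 : R).
  by apply: cvg_expr; rewrite ger0_norm ?invr_ge0//; lra.
apply: cvgB.
  apply: cvg_near_cst; near=> m.
  rewrite /trunc_pow max_l//.
  rewrite -[leLHS]ger0_norm ?exprn_ge0 ?invr_ge0// -[X in `|X|]subr0 distrC.
  near: m; move/cvgrPdist_le : h2; exact.
have h3 : ((2^-1 : R) ^+ m) `^ lam @[m --> \oo] --> (0 : R).
  apply/cvgrPdist_le => e e0; near=> m.
  rewrite sub0r normrN ger0_norm ?powR_ge0//.
  have lam0 : 0 < lam by case/andP : hlam.
  have -> : e = (e `^ lam^-1) `^ lam.
    by rewrite -powRrM mulVf ?gt_eqF// powRr1// ltW.
  apply: powR_le_pos; rewrite ?exprn_ge0 ?invr_ge0// ?(ltW lam0)//.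
  rewrite -[leLHS]ger0_norm ?exprn_ge0 ?invr_ge0// -[X in `|X|]subr0 distrC.
  near: m; move/cvgrPdist_le : h2; apply; exact: powR_gt0.
apply: (@squeeze_cvgr _ _ _ _ (fun=> 0) (fun m => ((2^-1 : R) ^+ m) `^ lam)).
- near=> m; rewrite trunc_pow_ge0/= /trunc_pow.
  rewrite exprVn powRpV ?exprn_gt0//.
  apply: powR_le_neg; rewrite ?exprn_gt0//; last by rewrite le_max lexx orbT.
  by have := hlam; lra.
- exact: cvg_cst.
- exact: h3.
Unshelve. all: by end_near.
Qed.

End truncated_power.


(** * Compactness of equi-Lipschitz sequences of functions *)

Section equilipschitz_sequences.
Context (R : realType) (n : nat) (M L r : nat -> R).
Implicit Types G H : nat * 'rV[R]_n -> R.

(** A sequence of functions is uncurried into one function on pairs, so that Tychonoff's theorem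
    applies to pointwise convergence. The bounds may depend on [j] in any way. *)
Definition equilipschitz : set (nat * 'rV[R]_n -> R) :=
  [set G | [/\ forall j x, `|G (j, x)| <= M j,
      forall j x y, `|G (j, x) - G (j, y)| <= L j * enorm (x - y) &
      forall j x, r j <= enorm x -> G (j, x) = 0]].

Definition unif_close (m : nat) (e : R) G H : Prop :=
  forall j x, (j < m)%N -> `|G (j, x) - H (j, x)| <= e.

(** The form in which pointwise limits of [K] are used: estimates on finitely many pieces pass from
    [K] to these limits. *)
Definition unif_closure (K : set (nat * 'rV[R]_n -> R)) :
    set (nat * 'rV[R]_n -> R) :=
  [set G | equilipschitz G /\
    forall m e, 0 < e -> exists2 H, K H & unif_close m e G H].

Local Notation P := {ptws (nat * 'rV[R]_n) -> R}.

Lemma eval_continuous i : continuous ((fun G => G i) : P -> R).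
Proof. by move=> G; exact: (@proj_continuous _ (fun=> R : topologicalType) i G). Qed.

Lemma ptws_eval_near (G : P) i (e : R) : 0 < e ->
  \forall H \near nbhs G, `|G i - H i| < e.
Proof.
by move=> e0; have /cvgrPdist_lt/(_ e e0) := @eval_continuous i G.
Qed.

Lemma closed_eval_le (f : P -> R) (c : R) :
  continuous f -> closed [set G : P | f G <= c].
Proof.
move=> cf; rewrite (_ : mkset _ = f @^-1` [set u | u <= c])//.
by apply: closed_comp => //; exact: closed_le.
Qed.

Lemma equilipschitz_closed : closed (equilipschitz : set P).
Proof.
rewrite (_ : equilipschitz =
  (\bigcap_(i in [set: nat * 'rV[R]_n]) [set G : P | `|G i| <= M i.1]) `&`
  (\bigcap_(i in [set: nat * ('rV[R]_n * 'rV[R]_n)])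
     [set G : P | `|G (i.1, i.2.1) - G (i.1, i.2.2)| <= L i.1 * enorm (i.2.1 - i.2.2)]) `&`
  (\bigcap_(i in [set i : nat * 'rV[R]_n | r i.1 <= enorm i.2])
     [set G : P | `|G i| <= 0])).
  apply: closedI; first apply: closedI.
  - apply: closed_bigI => i _; apply: closed_eval_le => G.
    exact: (continuous_comp (@eval_continuous i G) (@norm_continuous _ R _)).
  - apply: closed_bigI => i _; apply: closed_eval_le => G.
    apply: (@continuous_comp P R R (fun F : P => F (i.1, i.2.1) - F (i.1, i.2.2)) normr _ _
      (@norm_continuous _ R _)).
    exact: (continuousB (@eval_continuous (i.1, i.2.1) G)
                        (@eval_continuous (i.1, i.2.2) G)).
  - apply: closed_bigI => i _; apply: closed_eval_le => G.
    exact: (continuous_comp (@eval_continuous i G) (@norm_continuous _ R _)).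
apply/seteqP; split => [G [GM GL Gr]|G [[GM GL] Gr]].
  split; first split.
  - by move=> [j x] _; exact: GM.
  - by move=> [j [x y]] _; exact: GL.
  - by move=> [j x] /= rx; rewrite Gr// normr0.
split.
- by move=> j x; exact: (GM (j, x)).
- by move=> j x y; exact: (GL (j, (x, y))).
- by move=> j x rx; apply/eqP; rewrite -normr_le0; exact: (Gr (j, x)).
Qed.

Lemma equilipschitz_compact : compact (equilipschitz : set P).
Proof.
apply: (subclosed_compact equilipschitz_closed).
  apply: (@tychonoff _ (fun=> R : topologicalType)
    (fun i => `[- M i.1, M i.1]%classic)) => i.
  exact: segment_compact.
move=> G [GM _ _] [j x] /=; rewrite in_itv/=; rewrite -ler_norml; exact: GM.
Qed.

(* On an equi-Lipschitz family of functions supported in a fixed ball, pointwise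
   convergence is uniform. *)
Lemma equilipschitz_near (G : P) m (e : R) : equilipschitz G -> 0 < e ->
  \forall H \near within equilipschitz (nbhs G), unif_close m e G H.
Proof.
move=> EG e0.
have FF : Filter (within equilipschitz (nbhs G)) by apply: within_filter; exact: (nbhs_filter (G : P)).
have near1 j : \forall H \near within equilipschitz (nbhs G),
    forall x, `|G (j, x) - H (j, x)| <= e.
  have cB := @compact_closed_ball R n (r j).
  move/compact_near_coveringP in cB.
  have L0 : 0 < `|L j| + 1 by rewrite ltr_wpDl.
  have h1 : forall x, [set x | enorm x <= r j] x ->
     \forall x' \near x & H \near within equilipschitz (nbhs G),
      equilipschitz H -> `|G (j, x') - H (j, x')| <= e.
    move=> x _.
    have e3 : 0 < e / 3 by rewrite divr_gt0.
    exists ([set x' | enorm (x' - x) < e / 3 / (`|L j| + 1)],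
            [set H : P | `|G (j, x) - H (j, x)| < e / 3]).
      split => /=.
        by apply/nbhs_enormP; exists (e / 3 / (`|L j| + 1)); rewrite ?divr_gt0.
      by apply: (@cvg_within _ (nbhs (G : P))); exact: (ptws_eval_near G (j, x) e3).
    move=> [x' H] /= [xx' HG] EH.
    have close F : equilipschitz F -> `|F (j, x') - F (j, x)| <= e / 3.
      move=> [_ FL _]; apply: (le_trans (FL _ _ _)).
      move: xx'; rewrite ltr_pdivlMr// => /ltW; apply: le_trans.
      rewrite mulrC ler_wpM2l ?enorm_ge0//; have := ler_norm (L j); lra.
    have := close _ EG; have := close _ EH.
    rewrite !ler_norml; move: HG; rewrite ltr_norml.
    by move=> /andP[? ?] /andP[? ?] /andP[? ?]; apply/andP; split; lra.
  have {}cB := cB P (within equilipschitz (nbhs G))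
    (fun H x => equilipschitz H -> `|G (j, x) - H (j, x)| <= e) FF h1.
  have EE : \forall H \near within equilipschitz (nbhs G), equilipschitz H.
    by rewrite near_withinE; apply: (@filterE _ _ (nbhs_filter (G : P))).
  apply: filterS2 cB EE => H HB EH x.
  have [xr|rx] := leP (enorm x) (r j); first exact: HB.
  by case: EG EH => _ _ G0 [_ _ H0]; rewrite G0 ?H0 ?subrr ?normr0 ?ltW.
elim: m => [|m IHm]; first by apply: nearW => H j x.
apply: filterS2 IHm (near1 m) => H Hm H1 j x.
rewrite ltnS leq_eqVlt => /predU1P[->|]; [exact: H1|exact: Hm].
Qed.

Lemma closure_sub_unif_closure (K : set P) :
  K `<=` equilipschitz -> closure K `<=` unif_closure K.
Proof.
move=> KE G KG.
have EG : equilipschitz G.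
  have -> : equilipschitz = closure (equilipschitz : set P) :> set P.
    by apply/closure_id; exact: equilipschitz_closed.
  exact: closureS KG.
split => // m e e0; have := equilipschitz_near m EG e0.
rewrite near_withinE => /KG[H [KH]] /(_ (KE _ KH)) GH.
by exists H.
Qed.

End equilipschitz_sequences.

(** * Precompactness of a set of sums, for an abstract target seminorm *)

Section precompactness.
Context (R : realType) (n : nat).
Local Notation V := 'rV[R]_n.
Context (Y : set (V -> R)) (N : (V -> R) -> \bar R).
Context (M L r : nat -> R) (K : set (nat * V -> R)).
Context (A : set (V -> R)) (sums_to : (nat * V -> R) -> (V -> R) -> Prop).

Hypothesis N0 : N (fun=> 0) = 0%E.
Hypothesis N_sym : forall f g, Y f -> Y g ->
  N (fun x => g x - f x) = N (fun x => f x - g x).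
Hypothesis N_quasi_triangle : forall e : R, 0 < e -> exists2 d : R, 0 < d &
  forall f g h, Y f -> Y g -> Y h -> (N (fun x => (g x - f x)%R) < d%:E)%E ->
    (N (fun x => (h x - g x)%R) < d%:E)%E -> (N (fun x => (h x - f x)%R) < e%:E)%E.
Hypothesis K_lip : K `<=` equilipschitz M L r.
Hypothesis A_sums : forall h, A h -> exists2 G, K G & sums_to G h.
Hypothesis sums_ex : forall G, unif_closure M L r K G ->
  exists2 h, Y h & sums_to G h.
Hypothesis sums_cont : forall G, unif_closure M L r K G ->
  forall e : R, 0 < e -> exists m, exists2 d : R, 0 < d &
  forall G' h h', unif_closure M L r K G' -> unif_close m d G G' ->
    Y h -> Y h' -> sums_to G h -> sums_to G' h' ->
    (N (fun x => (h' x - h x)%R) < e%:E)%E.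

Local Notation E := (seminormed Y N).
Local Notation P := {ptws (nat * V) -> R}.
Let dist (f g : E) := N (fun x => sval g x - sval f x).

Let distC f g : dist f g = dist g f.
Proof. by rewrite /dist N_sym//; exact: svalP. Qed.

Let dist_tri (e : R) : 0 < e -> exists2 d : R, 0 < d & forall f g h : E,
  (dist f g < d%:E)%E -> (dist g h < d%:E)%E -> (dist f h < e%:E)%E.
Proof.
move=> /N_quasi_triangle[d d0 dP]; exists d => // -[f Yf] [g Yg] [h Yh].
exact: dP.
Qed.

Let dist0 f : dist f f = 0%E.
Proof. by rewrite /dist -[RHS]N0; congr N; apply/funext => x; rewrite subrr. Qed.

(** Under a mere quasi-triangle inequality balls need not be open. The set [U] of points having some
    ball inside the given one is open, contains [f], and lies in the given ball. *)
Let dist_nbhs (f : E) (e : R) : 0 < e -> nbhs f [set g : E | (dist f g < e%:E)%E].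
Proof.
move=> e0.
pose U : set E := [set g | exists2 d : R, 0 < d &
  forall h, (dist g h < d%:E)%E -> (dist f h < e%:E)%E].
have oU : open U.
  move=> g [d d0 gd]; have [d' d'0 d'P] := dist_tri d0.
  exists d' => // h gh; exists d' => // k hk; apply: gd.
  exact: d'P gh hk.
apply: (@filterS _ _ _ U); last first.
  by apply: open_nbhs_nbhs; split => //; exists e.
by move=> g [d d0]; apply; rewrite dist0 lte_fin.
Qed.

Let Kc : set P := closure (K : set P).

Let Kc_sub : Kc `<=` unif_closure M L r K.
Proof. exact: closure_sub_unif_closure. Qed.

Let Kc_compact : compact Kc.
Proof.
apply: (subclosed_compact _ (@equilipschitz_compact _ _ M L r)).
  exact: closed_closure.
by move=> G /Kc_sub[].
Qed.

(** The candidate for a compact closed superset. The seminorm topology does not separate functions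
    at distance 0, so [B] must contain everything at distance 0 from a sum. *)
Let B : set E := [set h | exists G, Kc G /\ (exists g : E, sums_to G (sval g) /\
  (forall e : R, 0 < e -> (dist g h < e%:E)%E))].

Let sums_near G (g : E) (e : R) : Kc G -> sums_to G (sval g) -> 0 < e ->
  \forall H \near nbhs (G : P), Kc H ->
    forall h : E, sums_to H (sval h) -> (dist g h < e%:E)%E.
Proof.
move=> KG Gg e0; have [m [d d0 md]] := sums_cont (Kc_sub KG) e0.
have := equilipschitz_near m (Kc_sub KG).1 d0.
rewrite near_withinE; apply: (@filterS _ _ (nbhs_filter (G : P))) => H GH KH h Hh.
apply: (md H _ _ (Kc_sub KH)) => //; first by apply: GH; exact: (Kc_sub KH).1.
exact: (svalP g).
exact: (svalP h).
Qed.

Let limit G : Kc G -> exists g : E, sums_to G (sval g).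
Proof. by move=> /Kc_sub/sums_ex[h Yh Gh]; exists (exist _ h Yh). Qed.

(** Summation is a relation, so [B] is not literally a continuous image of [Kc]. An ultrafilter on
    [B] is pushed to [Kc] along a choice of representatives; its cluster point there is a limit, and
    by continuity of summation a sum of that limit is a limit of the ultrafilter. *)
Let B_compact : compact B.
Proof.
rewrite compact_ultra => F FU FB.
have /choice[s sP] : forall h : E, exists Gg : P * E, B h ->
    [/\ Kc Gg.1, sums_to Gg.1 (sval Gg.2) &
        forall e : R, 0 < e -> (dist Gg.2 h < e%:E)%E].
  move=> h; have [[G [KG [g [Gg gh]]]]|nB] := pselect (B h); first by exists (G, g).
  by exists (fun=> 0, h).
have [G [KG clG]] : Kc `&` cluster ((fst \o s) @ F) !=set0.
  apply: Kc_compact; apply: (@filterS _ F _ B) => //.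
  by move=> h /sP[].
have FG (W : set P) : nbhs G W -> F ((fst \o s) @^-1` W).
  move=> GW; have [//|FnW] := in_ultra_setVsetC ((fst \o s) @^-1` W) FU.
  by have [H []] := clG (~` W) W FnW GW.
have [g Gg] := limit KG.
exists g; split.
  exists G; split => //; exists g; split => // e e0.
  by rewrite dist0 lte_fin.
move=> U; rewrite nbhsE => -[W [oW Wg] WU].
have [e e0 eW] := oW g Wg.
have [d d0 dP] := dist_tri e0.
have := FG _ (sums_near KG Gg d0).
rewrite /= => FN; apply: filterS2 FB FN => h Bh; rewrite /= => Gh.
have [Kh sh dh] := sP h Bh.
by apply/WU/eW/(dP _ _ _ _ (dh d d0))/Gh.
Qed.

(** [T e] collects the sequences of [Kc] having a sum within [e] of [h]. These sets have a cluster
    point in [Kc] as [e] shrinks, and continuity of summation puts its sum at distance 0 from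
    [h]. *)
Let B_closed : closed B.
Proof.
move=> h Bh.
pose T (e : R) : set P := [set G | Kc G /\
    (exists g : E, sums_to G (sval g) /\ (dist g h < e%:E)%E)].
have near_h (e : R) : 0 < e -> T e !=set0.
  move=> e0; have [d d0 dP] := dist_tri e0.
  have [k [[G [KG [g [Gg gk]]]] hk]] := Bh _ (dist_nbhs h d0).
  exists G; split => //; exists g; split => //.
  by apply: dP (gk d d0) _; rewrite distC.
pose F := filter_from [set e : R | 0 < e] T.
have FF : ProperFilter F.
  apply: filter_from_proper; last by move=> e /near_h[G [? ?]]; exists G.
  apply: filter_from_filter; first by exists 1; exact: ltr01.
  move=> d e /= d0 e0; exists (Num.min d e); first by rewrite /= lt_min d0.
  move=> G [KG [g [Gg]]]; rewrite EFin_min lt_min => /andP[gd ge].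
  by split; split => //; exists g.
have [G [KG clG]] : Kc `&` cluster F !=set0.
  by apply: Kc_compact; exists 1; [exact: ltr01|move=> G []].
have [g Gg] := limit KG.
exists G; split => //; exists g; split => // e e0.
have [d d0 dP] := dist_tri e0.
have [H [[KH [k [Hk kh]]] gk]] : T d `&` [set H | Kc H ->
    forall h : E, sums_to H (sval h) -> (dist g h < d%:E)%E] !=set0.
  apply: clG; first by exists d.
  exact: sums_near.
by apply: dP kh; exact: gk.
Qed.

Lemma precompact_of_sums : precompact [set g : seminormed Y N | A (sval g)].
Proof.
exists B; last by split; [exact: B_compact|exact: B_closed].
move=> g /A_sums[G KG Gg]; exists G; split; first exact: subset_closure.
by exists g; split => // e e0; rewrite dist0 lte_fin.
Qed.

End precompactness.


(** * Morrey norms as growth conditions on balls *)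

Lemma morrey_exponent_bounds (R : realType) n (p q : R) : 0 < q -> q <= p ->
  0 <= n%:R - n%:R * q / p <= n%:R.
Proof.
move=> q0 qp; have p0 : 0 < p := lt_le_trans q0 qp.
have ? : 0 <= n%:R * q / p by rewrite divr_ge0 ?(ltW p0)// mulr_ge0// ltW.
have ? : n%:R * q / p <= n%:R by rewrite ler_pdivrMr// ler_wpM2l.
by apply/andP; split; lra.
Qed.

Section morrey_growth.
Context (R : realType) (n : nat).
Hypothesis n_gt0 : (0 < n)%N.
Local Notation V := 'rV[R]_n.
Local Notation mu := (lebesgue_Rn R n).
Implicit Types (f g : V -> R).

Let nR_gt0 : 0 < n%:R :> R. Proof. by rewrite ltr0n. Qed.

(** The Morrey condition without roots: for [d = n - n t / s] it characterises, up to constants,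
    bounded norm in the space with exponents [s] and [t]. In this form estimates add up without
    Minkowski's inequality. *)
Definition ball_growth (t d K : R) f : Prop := forall x r, 0 < r ->
  (\int[mu]_(y in eball x r) (`|f y| `^ t)%:E <= (K * r `^ d)%:E)%E.

Lemma lebesgue_eball_fin (x : V) r : 0 < r -> mu (eball x r) \is a fin_num.
Proof.
move=> r0; rewrite ge0_fin_numE//.
exact: (le_lt_trans (lebesgue_eball_le _ r0) (ltry _)).
Qed.

Lemma measurable_norm_EFin f : measRn f ->
  measRn (fun x => `|f x|%:E).
Proof. by move=> mf; apply/measurable_EFinP; exact: measurableT_comp. Qed.

Lemma measurable_powR_norm f t : measRn f ->
  measRn (fun y => (`|f y| `^ t)%:E).
Proof.
move=> mf; apply/measurable_EFinP.
apply: (measurableT_comp (measurable_powR t)).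
by apply: measurableT_comp.
Qed.

Lemma ball_growth_ge0 t d K f : ball_growth t d K f -> 0 <= K.
Proof.
move=> /(_ 0 1 ltr01); rewrite powR1 mulr1 => h; rewrite -lee_fin.
apply: le_trans h; apply: integral_ge0 => y _; rewrite lee_fin; exact: powR_ge0.
Qed.

(** Moved to the right, the volume of the ball has a nonnegative exponent, so the upper bound
    [(2 r)^n] applies; it produces the factor [2^d]. *)
Lemma morrey_norm_growth (p q A : R) f : 0 < q -> q <= p -> 0 <= A ->
  (morrey_norm p q f <= A%:E)%E ->
  ball_growth q (n%:R - n%:R * q / p) (A `^ q * 2 `^ (n%:R - n%:R * q / p)) f.
Proof.
move=> q0 qp A0 fA x r r0.
have p0 : 0 < p := lt_le_trans q0 qp.
set B := eball x r; pose v := fine (mu B).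
have vE : mu B = v%:E by rewrite fineK// lebesgue_eball_fin.
have v0 : 0 < v.
  rewrite -lte_fin -vE; apply: lt_le_trans (lebesgue_eball_ge x r0 n_gt0).
  by rewrite lte_fin exprn_gt0// divr_gt0.
have v1 : v <= (2 * r) ^+ n by rewrite -lee_fin -vE; exact: lebesgue_eball_le.
set I := (\int[mu]_(y in B) _)%E.
have I0 : (0 <= I)%E by apply: integral_ge0 => y _; rewrite lee_fin; exact: powR_ge0.
have : (mu B `^ (p^-1 - q^-1) * I `^ q^-1 <= A%:E)%E.
  by apply: le_trans fA; apply: ereal_sup_ubound; exists x => //; exists r.
rewrite vE poweR_EFin.
have vp : 0 < v `^ (p^-1 - q^-1) by exact: powR_gt0.
have qV0 : 0 < q^-1 by rewrite invr_gt0.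
case: I I0 => [i| |] // i0; last first.
  by rewrite /poweR (gt_eqF qV0) gt0_muley ?lte_fin// leye_eq.
rewrite poweR_EFin -EFinM !lee_fin => h; rewrite lee_fin in i0.
have h2 : i `^ q^-1 <= A * v `^ (q^-1 - p^-1).
  rewrite -(opprB p^-1) powRN -ler_pdivrMr ?invr_gt0// invrK mulrC.
  exact: h.
have -> : i = (i `^ q^-1) `^ q by rewrite powR_invK.
apply: (le_trans (powR_le_pos (ltW q0) (powR_ge0 _ _) h2)).
rewrite powRM ?powR_ge0// -powRrM -mulrA ler_wpM2l ?powR_ge0//.
have e0 : 0 <= (q^-1 - p^-1) * q.
  by rewrite mulr_ge0 ?(ltW q0)// subr_ge0 lef_pV2.
apply: (le_trans (powR_le_pos e0 (ltW v0) v1)).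
have r20 : 0 <= 2 * r by rewrite mulr_ge0// ltW.
rewrite -powR_mulrn// -powRrM -powRM ?(ltW r0)//.
apply: ler_eq; congr (_ `^ _).
by field; rewrite !gt_eqF.
Qed.

(** The exponent of the volume is nonpositive, so here the lower bound [(r / n)^n] is the relevant
    one, whence the power of [n]. *)
Lemma growth_morrey_norm (s t K : R) g : 0 < t -> t <= s ->
  ball_growth t (n%:R - n%:R * t / s) K g ->
  (morrey_norm s t g <= (K `^ t^-1 * n%:R `^ (n%:R * (t^-1 - s^-1)))%:E)%E.
Proof.
move=> t0 ts gK; have K0 := ball_growth_ge0 gK.
have s0 : 0 < s := lt_le_trans t0 ts.
apply: ge_ereal_sup => _ [x _ [r /= r0 <-]].
set B := eball x r; pose v := fine (mu B).
have vE : mu B = v%:E by rewrite fineK// lebesgue_eball_fin.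
have v1 : (r / n%:R) ^+ n <= v by rewrite -lee_fin -vE; exact: lebesgue_eball_ge.
have rn : 0 < r / n%:R by rewrite divr_gt0.
have v0 : 0 < v by apply: lt_le_trans v1; rewrite exprn_gt0.
have tV : 0 < t^-1 by rewrite invr_gt0.
have := gK x r r0; set I := (\int[mu]_(y in B) _)%E.
have I0 : (0 <= I)%E by apply: integral_ge0 => y _; rewrite lee_fin; exact: powR_ge0.
case: I I0 => [i| |] //; rewrite !lee_fin => i0 ik.
rewrite vE !poweR_EFin -EFinM lee_fin.
have est : s^-1 - t^-1 <= 0 by rewrite subr_le0 lef_pV2.
have h1 : v `^ (s^-1 - t^-1) <= (r / n%:R) `^ (n%:R * (s^-1 - t^-1)).
  rewrite powRrM powR_mulrn ?(ltW rn)//; apply: powR_le_neg => //.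
  by rewrite exprn_gt0.
have h2 : i `^ t^-1 <= K `^ t^-1 * r `^ (n%:R * (t^-1 - s^-1)).
  apply: (le_trans (powR_le_pos (ltW tV) i0 ik)).
  rewrite powRM ?powR_ge0// -powRrM; apply: ler_eq.
  by congr (_ * _ `^ _); field; rewrite !gt_eqF.
apply: (le_trans (ler_pM (powR_ge0 _ _) (powR_ge0 _ _) h1 h2)).
rewrite mulrCA ler_wpM2l ?powR_ge0// powRM ?invr_ge0 ?(ltW r0) ?(ltW nR_gt0)//.
rewrite powRpV// mulrAC -powRpD// (_ : _ + _ = 0); last by ring.
rewrite powRr0 mul1r; apply: ler_eq.
by congr (_ `^ _); ring.
Qed.

(** A substitute for Hölder's inequality: values below the threshold [k] are bounded by the
    constant, and above it the lower power is dominated by the higher one. *)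
Lemma powR_le_powR_cst (a s q k : R) : 0 < s -> s <= q -> 0 <= a -> 0 < k ->
  a `^ s <= k `^ (s - q) * a `^ q + k `^ s.
Proof.
move=> s0 sq a0 k0; have [ak|ka] := leP a k.
  apply: (le_trans (powR_le_pos (ltW s0) a0 ak)); rewrite lerDr.
  by apply: mulr_ge0; exact: powR_ge0.
have a1 : 0 < a := lt_trans k0 ka.
apply: ler_wpDr; first exact: powR_ge0.
rewrite [leLHS](_ : _ = a `^ (s - q) * a `^ q); last by rewrite -powRpD// subrK.
apply: ler_wpM2r; first exact: powR_ge0.
by apply: powR_le_neg => //; [rewrite subr_le0|exact: ltW].
Qed.

Lemma integral_powR_le_powR f (E : set (Rn R n)) (s q k m : R) :
  measRn f -> measurable E ->
  0 < s -> s <= q -> 0 < k -> (mu E <= m%:E)%E ->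
  (\int[mu]_(y in E) (`|f y| `^ s)%:E <=
   (k `^ (s - q))%:E * (\int[mu]_(y in E) (`|f y| `^ q)%:E) + (k `^ s * m)%:E)%E.
Proof.
move=> mf mE s0 sq k0 Em.
apply: (ae_integral_le_affine mE (measurable_powR_norm s mf) (measurable_powR_norm q mf)
  (fun=> powR_ge0 _ _) (fun=> powR_ge0 _ _) Em (powR_ge0 _ _) (powR_ge0 _ _)).
by apply/aeW => y _; exact: powR_le_powR_cst.
Qed.

Lemma ball_growth_lower f (s q p K : R) :
  measRn f -> 0 < s -> s <= q -> 0 < p ->
  ball_growth q (n%:R - n%:R * q / p) K f ->
  ball_growth s (n%:R - n%:R * s / p) (K + 2 ^+ n) f.
Proof.
(* The threshold [r^(-n/p)] balances the two terms of the splitting: both become multiples of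
   [r^(n - n s / p)]. *)
move=> mf s0 sq p0 fK x r r0; have k0 : 0 < r `^ (- (n%:R / p)) by exact: powR_gt0.
apply: (le_trans (integral_powR_le_powR mf (measurable_eball x r) s0 sq k0
  (lebesgue_eball_le x r0))).
apply: (@le_trans _ _ (((r `^ (- (n%:R / p))) `^ (s - q))%:E *
    (K * r `^ (n%:R - n%:R * q / p))%:E +
    ((r `^ (- (n%:R / p))) `^ s * (2 * r) ^+ n)%:E)%E).
  by rewrite leeD2r// lee_wpmul2l ?lee_fin ?powR_ge0//; exact: fK.
rewrite -EFinM -EFinD lee_fin [leRHS]mulrDl; apply: ler_eq; congr (_ + _).
  rewrite mulrCA -powRrM -powRpD//; congr (_ * _ `^ _).
  by field; rewrite gt_eqF.
rewrite exprMn mulrCA -(powR_mulrn n (ltW r0)) -powRrM -powRpD//.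
by congr (_ * _ `^ _); field; rewrite gt_eqF.
Qed.

Lemma integral_powR1 f (E : set (Rn R n)) :
  (\int[mu]_(y in E) (`|f y| `^ 1)%:E = \int[mu]_(y in E) `|f y|%:E)%E.
Proof. by apply: eq_integral => y _; rewrite powRr1. Qed.

End morrey_growth.


(** * Measurability of Riesz potentials and commutators *)

Section measurable_riesz.
Context (R : realType) (n : nat) (alpha : R).
Local Notation V := 'rV[R]_n.
Local Notation mu := (lebesgue_Rn R n).
Implicit Types (f g b : V -> R).

Lemma measurable_enorm_diff :
  measurable_fun [set: Rn R n * Rn R n]
    (fun z : Rn R n * Rn R n => enorm ((z.1 : V) - (z.2 : V))).
Proof.
apply: measurable_enorm => i.
apply: (eq_measurable_fun (fun z : Rn R n * Rn R n =>
  (z.1 : V) ord0 i - (z.2 : V) ord0 i)).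
  by move=> z _; rewrite !mxE.
apply: measurable_funB.
  exact: (measurableT_comp (measurable_coord i) measurable_fst).
exact: (measurableT_comp (measurable_coord i) measurable_snd).
Qed.

Lemma measurable_riesz_integrand2 f : measRn f -> measurable_fun [set: Rn R n * Rn R n]
    (fun z : Rn R n * Rn R n => (riesz_integrand alpha f z.1 z.2)%:E).
Proof.
move=> mf; apply/measurable_EFinP; apply: measurable_funM.
  exact: (measurableT_comp mf measurable_snd).
apply: (eq_measurable_fun (fun z : Rn R n * Rn R n =>
    enorm ((z.1 : V) - (z.2 : V)) `^ (- (n%:R - alpha)))).
  by move=> z _; rewrite powRN.
exact: (measurableT_comp (measurable_powR _) measurable_enorm_diff).
Qed.

(** The integral may diverge at some points, so Tonelli's theorem is applied to the positive and
    negative parts separately; [riesz] is [fine] of their difference at every point. *)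
Lemma measurable_riesz f : measRn f -> measRn (riesz alpha f).
Proof.
move=> mf; have mk := measurable_riesz_integrand2 mf.
pose F (z : Rn R n * Rn R n) := (riesz_integrand alpha f z.1 z.2)%:E.
apply: measurableT_comp; first exact: (@fine_measurable R setT measurableT).
apply: (eq_measurable_fun (fun x : Rn R n => fubini_F mu F^\+ x - fubini_F mu F^\- x)%E).
  move=> x _; rewrite /fubini_F [RHS]integralE.
  by congr (_ - _)%E; apply: eq_integral => y _; rewrite ?funeposE ?funenegE.
apply: emeasurable_funB.
  apply: measurable_fun_fubini_tonelli_F => //.
  exact: measurable_funepos.
apply: measurable_fun_fubini_tonelli_F => //.
exact: measurable_funeneg.
Qed.

Lemma measurable_commutator b f : measRn b -> measRn f ->
  measRn (commutator alpha b f).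
Proof.
move=> mb mf; apply: measurable_funB.
  by apply: measurable_funM; [exact: mb|exact: measurable_riesz].
by apply: measurable_riesz; exact: measurable_funM.
Qed.

End measurable_riesz.

(** * Powers of dyadic scales and interpolation *)

Section dyadic_powers.
Context (R : realType).
Implicit Types delta e : R.

Lemma one_powR e : 1 `^ e = 1 :> R.
Proof. by rewrite powR1. Qed.

Lemma powR_half_le delta e j : 0 <= delta -> delta <= e ->
  (2^-1 ^+ j.+1) `^ e <= (2 `^ (- delta)) ^+ j :> R.
Proof.
move=> d0 de; rewrite exprVn powRpV ?exprn_gt0//.
rewrite -powR_mulrn// -powRrM -powR_mulrn ?powR_ge0// -powRrM.
apply: ler_powR; first by lra.
rewrite -natr1; have : 0 <= (e - delta) * j%:R by rewrite mulr_ge0// subr_ge0.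
by move: (j%:R) => u; lra.
Qed.

Lemma powR_double_le delta e j : e <= - delta ->
  (2 ^+ j) `^ e <= (2 `^ (- delta)) ^+ j :> R.
Proof.
move=> de; rewrite -powR_mulrn// -powRrM -powR_mulrn ?powR_ge0// -powRrM.
apply: ler_powR; first by lra.
by rewrite mulrC ler_wpM2r.
Qed.

Lemma half_pow_gt0 j : 0 < 2^-1 ^+ j :> R.
Proof. by rewrite exprn_gt0// invr_gt0. Qed.

Lemma half_pow_le1 j : 2^-1 ^+ j <= 1 :> R.
Proof. by rewrite exprn_ile1// ?invr_ge0//; lra. Qed.

Lemma double_pow_ge1 j : 1 <= 2 ^+ j :> R.
Proof. by rewrite exprn_ege1//; lra. Qed.

Lemma powR2_ratio delta : 0 < delta -> 0 < (2 : R) `^ (- delta) < 1.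
Proof.
move=> d0; rewrite powR_gt0//= powRN invf_lt1 ?powR_gt0//.
by rewrite -[ltLHS](one_powR delta) gt0_ltr_powR ?nnegrE// ltr1n.
Qed.

Lemma minr_powR (rho e : R) : 0 <= e -> 0 < rho ->
  (minr 1 rho) `^ e = minr 1 (rho `^ e).
Proof.
move=> e0 rho0; have [r1|r1] := leP rho 1.
  by rewrite min_r// -(one_powR e) powR_le_pos// ltW.
by rewrite powR1 min_l// -[leLHS](one_powR e) powR_le_pos// ltW.
Qed.

(** Write [D = D^(1 - gamma) D^gamma] and use one bound in each factor. *)
Lemma holder_interpolation (C m e D gamma : R) : 0 <= gamma < 1 -> 0 <= C ->
  0 <= m -> 0 <= e -> 0 <= D -> D <= C * m -> D <= C * e ->
  D <= C * (m `^ (1 - gamma) * e `^ gamma).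
Proof.
move=> /andP[g0 g1] C0 m0 e0 D0 h1 h2.
have self u : 0 <= u -> u `^ (1 - gamma) * u `^ gamma = u.
  rewrite le_eqVlt => /predU1P[<-|u0].
    by rewrite powR0 ?mul0r// gt_eqF// subr_gt0.
  by rewrite -powRpD// subrK powRr1// ltW.
rewrite -[leLHS]self// -[X in X * (_ * _)]self// mulrACA -!powRM//.
by apply: ler_pM; rewrite ?powR_ge0// powR_le_pos// subr_ge0 ltW.
Qed.

End dyadic_powers.



(** * Averages over balls of fixed radius *)

Lemma measurable_ball_indic (R : realType) (n : nat) (rho : R) :
  measurable_fun [set: Rn R n * Rn R n]
    (fun z => \1_(eball (z.1 : 'rV[R]_n) rho) z.2 : R).
Proof.
rewrite (_ : (fun _ => _) = \1_[set z | enorm ((z.1 : 'rV[R]_n) - (z.2 : 'rV[R]_n)) < rho]).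
  apply: measurable_indic.
  have := @measurable_enorm_diff R n measurableT `]-oo, rho[%classic (measurable_itv _).
  by rewrite setTI.
apply/funext => z; rewrite !indicE; congr (_%:R); congr nat_of_bool.
by apply/idP/idP; rewrite !inE/= /eball/= enormBC.
Qed.

Lemma measurable_indic_eball (R : realType) (n : nat) (c : 'rV[R]_n) (r : R) :
  measRn (fun x => (\1_(eball c r) x : R)%:E).
Proof. by apply/measurable_EFinP; apply: measurable_indic; exact: measurable_eball. Qed.

Lemma measurable_ball_section (R : realType) (n : nat) (rho : R) (E : set (Rn R n)) : measurable E ->
  measRn (fun y => lebesgue_Rn R n (E `&` eball (y : 'rV[R]_n) rho)).
Proof.
move=> mE.
pose G (z : Rn R n * Rn R n) : \bar R :=
  (\1_(eball (z.1 : 'rV[R]_n) rho) z.2 * \1_E z.2)%:E.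
have mG : measurable_fun [set: Rn R n * Rn R n] G.
  apply/measurable_EFinP; apply: measurable_funM; first exact: measurable_ball_indic.
  by apply: measurableT_comp measurable_snd; exact: measurable_indic.
have G0 z : (0 <= G z)%E by rewrite lee_fin mulr_ge0.
apply: (eq_measurable_fun (fubini_F (lebesgue_Rn R n) G)); last first.
  by apply: measurable_fun_fubini_tonelli_F; [exact: mG|exact: G0].
move=> y _; rewrite /fubini_F/= -[in RHS](setIT (_ `&` _)) -integral_indic//; last first.
  by apply: measurableI => //; exact: measurable_eball.
apply: eq_integral => x _; congr _%:E; by rewrite /= indicI /= mulrC.
Qed.

Section ball_averages.
Context (R : realType) (n : nat).
Local Notation V := 'rV[R]_n.
Local Notation mu := (lebesgue_Rn R n).
Context (f : V -> R).
Hypothesis mf : measRn f.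

(** Jensen's inequality with the extra factor [2^q], from the threshold splitting at half the mean,
    [k = a / (2 m)]: values below [k] contribute at most [a / 2], which is absorbed on the left. *)
Lemma powR_integral_norm_le (E : set (Rn R n)) (q m : R) :
  measurable E -> 1 <= q -> 0 < m -> (mu E <= m%:E)%E ->
  (\int[mu]_(y in E) `|f y|%:E < +oo)%E ->
  ((fine (\int[mu]_(y in E) `|f y|%:E) `^ q)%:E <=
   (2 `^ q * m `^ (q - 1))%:E * \int[mu]_(y in E) (`|f y| `^ q)%:E)%E.
Proof.
move=> mE q1 m0 Em fin.
have q0 : 0 < q by lra.
have J0 : (0 <= \int[mu]_(y in E) (`|f y| `^ q)%:E)%E.
  by apply: integral_ge0 => y _; rewrite lee_fin powR_ge0.
have a0 : (0 <= \int[mu]_(y in E) `|f y|%:E)%E.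
  by apply: integral_ge0 => y _; rewrite lee_fin.
set a := fine _.
have aE : (\int[mu]_(y in E) `|f y|%:E = a%:E)%E.
  by rewrite fineK// ge0_fin_numE.
move: a0; rewrite aE lee_fin le_eqVlt => /predU1P[<-|a_gt0].
  by rewrite powR0 ?gt_eqF// mule_ge0// lee_fin mulr_ge0 ?powR_ge0.
have k0 : 0 < a / (2 * m) by rewrite divr_gt0// mulr_gt0.
have := integral_powR_le_powR mf mE ltr01 q1 k0 Em.
rewrite integral_powR1 powRr1 ?(ltW k0)// aE.
move: J0; move: (integral _ _ _) => [j| |]//; last first.
  by move=> _ _; rewrite gt0_muley ?leey// lte_fin mulr_gt0// powR_gt0.
rewrite -!EFinM -EFinD !lee_fin => j0.
have am : a = 2 * (a / (2 * m) * m).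
  by field; rewrite gt_eqF.
move: k0 am; set k := a / (2 * m) => k0 am h.
have {}h : k * m <= k `^ (1 - q) * j by lra.
have {}h : k `^ q * m <= j.
  have -> : k `^ q * m = k `^ (q - 1) * (k * m).
    by rewrite mulrA -[X in _ * X * _](powRr1 (ltW k0)) -powRpD// subrK.
  have -> : j = k `^ (q - 1) * (k `^ (1 - q) * j).
    by rewrite mulrA -powRpD// (_ : q - 1 + (1 - q) = 0) ?powRr0 ?mul1r//; ring.
  by rewrite ler_wpM2l ?powR_ge0.
rewrite am powRM//; last by rewrite mulr_ge0// ltW.
rewrite powRM ?(ltW k0) ?(ltW m0)//.
have -> : m `^ q = m * m `^ (q - 1).
  by rewrite -[X in X * _](powRr1 (ltW m0)) -powRpD//; congr (_ `^ _); ring.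
have -> : 2 `^ q * (k `^ q * (m * m `^ (q - 1))) =
   2 `^ q * m `^ (q - 1) * (k `^ q * m) by ring.
by rewrite ler_wpM2l// mulr_ge0// powR_ge0.
Qed.

Let F (q rho : R) (z : Rn R n * Rn R n) : \bar R :=
  (`|f z.2| `^ q * \1_(eball (z.1 : V) rho) z.2)%:E.

Let FE q rho x :
  (\int[mu]_(y in eball x rho) (`|f y| `^ q)%:E = \int[mu]_y F q rho (x, y))%E.
Proof.
rewrite integral_mkcond; apply: eq_integral => y _; rewrite /F/= patchE indicE.
by case: ifPn; rewrite ?mulr1 ?mulr0.
Qed.

Let mF q rho : measurable_fun [set: Rn R n * Rn R n] (F q rho).
Proof.
apply/measurable_EFinP; apply: measurable_funM; last exact: measurable_ball_indic.
apply: (measurableT_comp (measurable_powR q)).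
apply: (measurableT_comp (@normr_measurable R setT)).
exact: (measurableT_comp mf measurable_snd).
Qed.

Let F0 q rho z : (0 <= F q rho z)%E.
Proof. by rewrite lee_fin mulr_ge0// powR_ge0. Qed.

Lemma measurable_ball_integral q rho : measRn   (fun x : Rn R n => (\int[mu]_(y in eball (x : V) rho) (`|f y| `^ q)%:E)%E).
Proof.
apply: (eq_measurable_fun (fubini_F mu (F q rho))).
  by move=> x _; rewrite /fubini_F FE.
apply: measurable_fun_fubini_tonelli_F; [exact: mF|exact: F0].
Qed.

(** Tonelli's theorem, with the symmetry that [y] lies in the ball around [x] exactly when [x] lies
    in the ball around [y]. *)
Lemma double_ball_integral (q rho : R) (E : set (Rn R n)) : measurable E ->
  (\int[mu]_(x in E) \int[mu]_(y in eball (x : V) rho) (`|f y| `^ q)%:E =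
   \int[mu]_y ((`|f y| `^ q)%:E * mu (E `&` eball (y : V) rho)))%E.
Proof.
move=> mE.
have mEF : measurable_fun [set: Rn R n * Rn R n]
    (fun z => (F q rho z * (\1_E z.1)%:E)%E).
  apply: emeasurable_funM; first exact: mF.
  apply/measurable_EFinP; apply: measurableT_comp measurable_fst.
  exact: measurable_indic.
have EF0 z : (0 <= F q rho z * (\1_E z.1)%:E)%E by rewrite mule_ge0// lee_fin.
transitivity (\int[mu]_x \int[mu]_y (F q rho (x, y) * (\1_E x)%:E))%E.
  rewrite integral_mkcond; apply: eq_integral => x _; rewrite patchE indicE.
  case: ifPn => xE; last by rewrite integral0_eq// => y _; rewrite mule0.
  by rewrite FE; apply: eq_integral => y _; rewrite mule1.
rewrite (@fubini_tonelli _ _ _ _ _ mu mu (fun z => (F q rho z * (\1_E z.1)%:E)%E) mEF EF0).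
apply: eq_integral => y _.
have mEB : measurable (E `&` eball (y : V) rho).
  by apply: measurableI => //; exact: measurable_eball.
rewrite -[in RHS](setIT (E `&` _)) -(integral_indic _ measurableT mEB).
rewrite -ge0_integralZl; [|exact: measurableT| | |]; last 3 first.
- by apply/measurable_EFinP; exact: measurable_indic.
- by move=> x _; rewrite lee_fin.
- by rewrite lee_fin powR_ge0.
apply: eq_integral => x _; rewrite /F/= -!EFinM indicI mulrA mulrAC; congr (_ * _ * _)%:E.
rewrite !indicE; congr (_%:R); congr nat_of_bool.
by apply/idP/idP; rewrite !inE/= /eball/= enormBC.
Qed.

(** Two regimes give the same bound. If [rho <= r], only [y] in the doubled ball count, each with
    weight at most [(2 rho)^n]. If [rho > r], the growth of [f] is used at every [x], and
    [r^(n - d) <= rho^(n - d)]. *)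
Lemma double_ball_integral_le (q d K rho r : R) (x0 : V) : 0 <= d <= n%:R ->
  ball_growth q d K f -> 0 < rho -> 0 < r ->
  (\int[mu]_(x in eball x0 r) \int[mu]_(y in eball (x : V) rho) (`|f y| `^ q)%:E <=
   (2 `^ n%:R * 2 `^ n%:R * K * rho `^ n%:R * r `^ d)%:E)%E.
Proof.
move=> /andP[d0 dn] fK rho0 r0; have K0 := ball_growth_ge0 fK.
have mB (x : V) s : measurable (@eball R n x s) by exact: measurable_eball.
have two1 : (1 : R) <= 2 `^ n%:R.
  by rewrite -[leLHS](one_powR n%:R) powR_le_pos// ler1n.
have [rr|rr] := leP rho r.
  rewrite double_ball_integral//.
  have r20 : 0 < 2 * r by lra.
  apply: (@le_trans _ _ (\int[mu]_(y in eball x0 (2 * r)) ((2 * rho) `^ n%:R * `|f y| `^ q)%:E)%E).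
    rewrite [leRHS]integral_mkcond.
    apply: ge0_le_integral; first exact: measurableT.
    + by move=> y _; rewrite mule_ge0// lee_fin powR_ge0.
    + apply: emeasurable_funM; first exact: measurable_powR_norm.
      exact: measurable_ball_section.
    + apply/(measurable_restrictT _ (mB _ _)).
      apply: measurable_funTS; apply/measurable_EFinP.
      apply: measurable_funM; first exact: measurable_cst.
      apply/measurable_EFinP; exact: measurable_powR_norm.
    + move=> y _; rewrite patchE; case: ifPn => yE.
        rewrite muleC EFinM; apply: lee_wpmul2r; first by rewrite lee_fin powR_ge0.
        apply: (@le_trans _ _ (mu (eball (y : V) rho))).
          by apply: le_measure; rewrite ?inE; [apply: measurableI|exact: mB|exact: subIsetr].
        by apply: (le_trans (lebesgue_eball_le _ rho0)); rewrite powR_mulrn ?lee_fin//; lra.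
      rewrite (_ : _ `&` _ = set0) ?measure0 ?mule0//.
      apply/seteqP; split => // z [/= z1 z2].
      move/negP: yE; apply; rewrite inE/= /eball/=.
      have := enormB_triangle z (y : V) x0; rewrite (enormBC (y : V) z).
      by move: z1 z2; rewrite /eball/=; lra.
  under eq_integral do rewrite EFinM.
  rewrite ge0_integralZl; [|exact: mB| | |]; last 3 first.
  + by apply: measurable_funTS; exact: measurable_powR_norm.
  + by move=> y _; rewrite lee_fin powR_ge0.
  + by rewrite lee_fin powR_ge0.
  apply: (le_trans (lee_wpmul2l _ (fK x0 _ r20))); first by rewrite lee_fin powR_ge0.
  rewrite -EFinM lee_fin !powRM ?(ltW r0) ?(ltW rho0)//.
  have -> : 2 `^ n%:R * 2 `^ n%:R * K * rho `^ n%:R * r `^ d =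
    2 `^ n%:R * rho `^ n%:R * (K * r `^ d) * 2 `^ n%:R by ring.
  have -> : 2 `^ n%:R * rho `^ n%:R * (K * (2 `^ d * r `^ d)) =
    2 `^ n%:R * rho `^ n%:R * (K * r `^ d) * 2 `^ d by ring.
  rewrite ler_wpM2l ?mulr_ge0 ?powR_ge0//.
  by apply: ler_powR => //; rewrite ler1n.
apply: (@le_trans _ _ (\int[mu]_(x in eball x0 r) (K * rho `^ d)%:E)%E).
  apply: ge0_le_integral; first exact: mB.
  + by move=> x _; apply: integral_ge0 => y _; rewrite lee_fin powR_ge0.
  + by apply: measurable_funTS; exact: measurable_ball_integral.
  + exact: measurable_cst.
  + by move=> x _; exact: fK.
rewrite integral_cst//.
have Kr : 0 <= K * rho `^ d by rewrite mulr_ge0// powR_ge0.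
apply: (le_trans (lee_wpmul2l _ (lebesgue_eball_le x0 r0))); first by rewrite lee_fin.
rewrite -EFinM lee_fin -powR_mulrn; last by lra.
rewrite powRM ?(ltW r0)//.
have h : r `^ (n%:R - d) <= rho `^ (n%:R - d) by apply: powR_le_pos; lra.
have -> : r `^ n%:R = r `^ d * r `^ (n%:R - d).
  by rewrite -powRpD//; congr (_ `^ _); ring.
have -> : rho `^ n%:R = rho `^ d * rho `^ (n%:R - d).
  by rewrite -powRpD//; congr (_ `^ _); ring.
have -> : 2 `^ n%:R * 2 `^ n%:R * K * (rho `^ d * rho `^ (n%:R - d)) * r `^ d =
  (K * rho `^ d * 2 `^ n%:R * r `^ d) * (2 `^ n%:R * rho `^ (n%:R - d)) by ring.
have -> : K * rho `^ d * (2 `^ n%:R * (r `^ d * r `^ (n%:R - d))) =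
  (K * rho `^ d * 2 `^ n%:R * r `^ d) * r `^ (n%:R - d) by ring.
rewrite ler_wpM2l//; first by rewrite !mulr_ge0 ?powR_ge0.
by rewrite (le_trans h)// ler_peMl// powR_ge0.
Qed.

End ball_averages.

(** The intersection is no larger than the smaller ball, and [min(r, s)^n <= r^d s^(n - d)]. In this
    way bounded functions of bounded support acquire the growth [r^d]. *)
Lemma lebesgue_ball_inter_le (R : realType) (n : nat) (x y : 'rV[R]_n) (r s d : R) :
  0 < r -> 0 < s -> 0 <= d <= n%:R ->
  (lebesgue_Rn R n (eball x r `&` eball y s) <=
   (2 `^ n%:R * (r `^ d * s `^ (n%:R - d)))%:E)%E.
Proof.
move=> r0 s0 /andP[d0 dn].
have mB (z : 'rV[R]_n) v : measurable (@eball R n z v) by exact: measurable_eball.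
have split u : 0 < u -> u `^ d * u `^ (n%:R - d) = u ^+ n.
  by move=> u0; rewrite -powRpD// addrC subrK powR_mulrn// ltW.
have [rs|sr] := leP r s.
  apply: (@le_trans _ _ (lebesgue_Rn R n (eball x r))).
    by apply: le_measure; rewrite ?inE; [exact: measurableI|exact: mB|exact: subIsetl].
  apply: (le_trans (lebesgue_eball_le _ r0)); rewrite lee_fin exprMn powR_mulrn//.
  rewrite ler_wpM2l ?exprn_ge0// -split// ler_wpM2l ?powR_ge0//.
  by apply: powR_le_pos; lra.
apply: (@le_trans _ _ (lebesgue_Rn R n (eball y s))).
  by apply: le_measure; rewrite ?inE; [exact: measurableI|exact: mB|exact: subIsetr].
apply: (le_trans (lebesgue_eball_le _ s0)); rewrite lee_fin exprMn powR_mulrn//.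
rewrite ler_wpM2l ?exprn_ge0// -split// ler_wpM2r ?powR_ge0//.
by apply: powR_le_pos; lra.
Qed.

Section morrey_growth_pieces.
Context (R : realType) (n : nat).
Local Notation V := 'rV[R]_n.
Local Notation mu := (lebesgue_Rn R n).

Lemma powR_normD_le (t x y : R) : 0 <= t ->
  `|x + y| `^ t <= 2 `^ t * (`|x| `^ t + `|y| `^ t).
Proof.
move=> t0; wlog xy : x y / `|x| <= `|y|.
  move=> H; have [/H//|/ltW/H] := leP `|x| `|y|.
  by rewrite addrC (addrC (`|y| `^ t)).
apply: (@le_trans _ _ ((2 * `|y|) `^ t)).
  apply: powR_le_pos => //; apply: (le_trans (ler_normD _ _)); lra.
rewrite powRM// ler_wpM2l ?powR_ge0// lerDr powR_ge0//.
Qed.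

Lemma ball_growthD (t d K K' : R) (u v : V -> R) : 0 <= t ->
  measRn u ->
  measRn v ->
  ball_growth t d K u -> ball_growth t d K' v ->
  ball_growth t d (2 `^ t * (K + K')) (fun x => u x + v x).
Proof.
move=> t0 mu_ mv uK vK x r r0; have p2 : 0 <= 2 `^ t :> R by exact: powR_ge0.
apply: (le_trans (ae_integral_le_linear (measurable_eball x r)
  (measurable_powR_norm t (measurable_funD mu_ mv)) (measurable_powR_norm t mu_)
  (fun=> powR_ge0 _ _) (fun=> powR_ge0 _ _) (measurable_powR_norm t mv)
  (fun=> powR_ge0 _ _) p2 p2 _)).
  by apply/aeW => y _; rewrite -mulrDr; exact: powR_normD_le.
rewrite -mulrA mulrDl mulrDr EFinD; apply: leeD; rewrite EFinM;
  apply: lee_wpmul2l; rewrite ?lee_fin//; [exact: uK|exact: vK].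
Qed.

Lemma ball_growth_le (t d K K' : R) (u : V -> R) : K <= K' ->
  ball_growth t d K u -> ball_growth t d K' u.
Proof.
move=> KK uK x r r0; apply: (le_trans (uK x r r0)).
by rewrite lee_fin ler_wpM2r// powR_ge0.
Qed.

End morrey_growth_pieces.


(** * Size and smoothness of the pieces of the commutator *)

Section commutator_pieces.
Context (R : realType) (n : nat) (alpha p q : R).
Local Notation V := 'rV[R]_n.
Local Notation mu := (lebesgue_Rn R n).
Hypothesis halpha : 0 < alpha < n%:R.
Hypothesis hq : 1 < q.
Hypothesis hqp : q <= p.
Context (b f : V -> R) (Mb Lb Rb : R).
Hypothesis b_cont : continuous b.
Hypothesis b_bnd : forall x, `|b x| <= Mb.
Hypothesis b_lip : forall x y, `|b x - b y| <= Lb * enorm (x - y).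
Hypothesis Lb_ge0 : 0 <= Lb.
Hypothesis b_supp : forall x, Rb <= enorm x -> b x = 0.
Hypothesis Rb_gt0 : 0 < Rb.
Hypothesis mf : measRn f.
Context (K : R).
Hypothesis f_growth : ball_growth q (n%:R - n%:R * q / p) K f.

(** The kernel decays like [rho^(-lam)]; the integrals of [|f|^q] and [|f|] over balls grow like
    [r^d] and [r^d1]; their balance [sigma = lam - d1] governs the size of a piece. *)
Local Notation lam := (n%:R - alpha).
Local Notation sigma := (n%:R / p - alpha).
Local Notation d := (n%:R - n%:R * q / p).
Local Notation d1 := (n%:R - n%:R / p).
Local Notation K1 := (K + 2 ^+ n).

Let mfn := measurable_norm_EFin mf.

Lemma kernel_integral_le (h : V -> R) (c : R) (E : set (Rn R n)) :
  measRn h -> measurable E -> 0 <= c ->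
  (\int[mu]_(y in E) `|f y|%:E < +oo)%E ->
  (forall y, E y -> `|h y| <= c * `|f y|) -> (forall y, ~ E y -> h y = 0) ->
  mu.-integrable [set: Rn R n] (fun y => (h y)%:E) /\
  (`|\int[mu]_y h y|%:E <= c%:E * \int[mu]_(y in E) `|f y|%:E)%E.
Proof.
move=> mh mE c0 If hE hNE.
have mhn := measurable_norm_EFin mh.
have H : (\int[mu]_y `|h y|%:E <= c%:E * \int[mu]_(y in E) `|f y|%:E)%E.
  rewrite (_ : (\int[mu]_y _)%E = (\int[mu]_(y in E) `|h y|%:E)%E); last first.
    rewrite [RHS]integral_mkcond; apply: eq_integral => y _.
    rewrite patchE; case: ifPn => //; rewrite notin_setE => /hNE ->.
    by rewrite normr0.
  apply: (ae_integral_le_scale mE mhn mfn (fun=> normr_ge0 _) (fun=> normr_ge0 _) c0).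
  by apply/aeW => y; exact: hE.
have Hoo : (c%:E * \int[mu]_(y in E) `|f y|%:E < +oo)%E.
  have I0 : (0 <= \int[mu]_(y in E) `|f y|%:E)%E.
    by apply: integral_ge0 => y _; rewrite lee_fin.
  by apply: lte_mul_pinfty; rewrite ?lee_fin.
have ih : mu.-integrable [set: Rn R n] (fun y => (h y)%:E).
  apply/integrableP; split; first by apply/measurable_EFinP.
  exact: le_lt_trans H Hoo.
split => //; apply: (le_trans _ H).
have := le_normr_Rintegral measurableT ih.
rewrite -lee_fin => /le_trans; apply.
rewrite /Rintegral fineK// ge0_fin_numE; first exact: le_lt_trans H Hoo.
by apply: integral_ge0 => y _; rewrite lee_fin.
Qed.

Let hlam : 0 < lam <= n%:R.
Proof. by have := halpha => /andP[? ?]; apply/andP; split; lra. Qed.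

Let n_ge1 : 1 <= n%:R :> R.
Proof.
have /andP[a0 an] := halpha; have := lt_trans a0 an.
by rewrite ltr0n ler1n.
Qed.

Let p0 : 0 < p. Proof. by have := hq; have := hqp; lra. Qed.
Let q1 : 1 <= q. Proof. exact: ltW. Qed.
Let K0 : 0 <= K. Proof. exact: ball_growth_ge0 f_growth. Qed.
Let K10 : 0 <= K1. Proof. by rewrite addr_ge0// exprn_ge0. Qed.

Let d_bounds : 0 <= d <= n%:R.
Proof. exact: morrey_exponent_bounds (lt_le_trans ltr01 q1) hqp. Qed.

Let growth1 x r : 0 < r ->
  (\int[mu]_(y in eball x r) `|f y|%:E <= (K1 * r `^ d1)%:E)%E.
Proof.
move=> r0; have := ball_growth_lower mf ltr01 q1 p0 f_growth x r0.
by rewrite mulr1 integral_powR1.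
Qed.

Let f_loc x r : 0 < r -> (\int[mu]_(y in eball x r) `|f y|%:E < +oo)%E.
Proof. by move=> r0; exact: le_lt_trans (growth1 x r0) (ltry _). Qed.

Let mb : measRn b.
Proof. exact: continuous_measurable_Rn. Qed.

Definition shell_integrand (rho : R) (x y : V) : R :=
  (b x - b y) * shell_kernel lam rho (enorm (x - y)) * f y.

Definition shell_operator (rho : R) (x : V) : R :=
  \int[mu]_y shell_integrand rho x y.

Let Mb_ge0 : 0 <= Mb.
Proof. by rewrite (le_trans _ (b_bnd 0)). Qed.

Lemma measurable_enorm_sub (x : V) :
  measRn (fun y => enorm (x - (y : V))).
Proof.
apply: (eq_measurable_fun (fun y : Rn R n => enorm ((y : V) - x))).
  by move=> y _; exact: enormBC.
exact: measurable_enormB.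
Qed.

Lemma measurable_shell_kernel rho : 0 < rho ->
  measurable_fun [set: R] (shell_kernel lam rho).
Proof.
move=> rho0; apply: measurable_funB.
  apply: (measurableT_comp (measurable_powR (- lam))).
  by apply: measurable_maxr.
apply: (measurableT_comp (measurable_powR (- lam))).
by apply: measurable_maxr.
Qed.

Lemma measurable_shell_integrand rho x : 0 < rho ->
  measRn (shell_integrand rho x).
Proof.
move=> rho0; apply: measurable_funM; last exact: mf.
apply: measurable_funM.
  by apply: measurable_funB; [exact: measurable_cst|exact: mb].
apply: (measurableT_comp (measurable_shell_kernel rho0)).
exact: measurable_enorm_sub.
Qed.

Definition commutator_bound := 2 * Lb + 2 * Mb.

Local Notation CB := commutator_bound.

Let CB0 : 0 <= CB.
Proof. by rewrite addr_ge0// mulr_ge0// Mb_ge0. Qed.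

(** Boundedness of [b] gives [2 Mb], its Lipschitz constant gives [2 Lb rho]. The factor [rho] at
    small scales is the gain of the commutator over the Riesz potential itself. *)
Lemma b_sub_le rho x y : 0 < rho -> enorm (x - y) <= 2 * rho ->
  `|b x - b y| <= CB * minr 1 rho.
Proof.
move=> rho0 xy; rewrite /CB.
have h1 : `|b x - b y| <= 2 * Mb.
  apply: (le_trans (ler_normB _ _)); have := b_bnd x; have := b_bnd y; lra.
have h2 : `|b x - b y| <= 2 * Lb * rho.
  apply: (le_trans (b_lip _ _)).
  by rewrite (mulrC 2) -[leRHS]mulrA ler_wpM2l.
have M0 := Mb_ge0.
have rM := mulr_ge0 M0 (ltW rho0).
move: h1 h2; move: `|b x - b y| => u h1 h2.
have := Lb_ge0; rewrite /minr; case: ltP => _ L0; lra.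
Qed.

Lemma shell_integrand_le rho x y : 0 < rho -> eball x (2 * rho) y ->
  `|shell_integrand rho x y| <=
  CB * minr 1 rho * rho `^ (- lam) * `|f y|.
Proof.
rewrite /eball/= => rho0 xy.
rewrite /shell_integrand !normrM ler_wpM2r// ler_pM//.
  by apply: b_sub_le => //; rewrite enormBC ltW.
by rewrite ger0_norm ?(shell_kernel_ge0 hlam)// (shell_kernel_le hlam).
Qed.

Lemma shell_integrand_out rho x y : 0 < rho -> ~ eball x (2 * rho) y ->
  shell_integrand rho x y = 0.
Proof.
rewrite /eball/= => rho0 /negP; rewrite -leNgt => xy.
by rewrite /shell_integrand (shell_kernel_out _ rho0) ?mulr0 ?mul0r// enormBC.
Qed.

Lemma shell_integrand_out_support rho x y : 0 < rho -> Rb <= enorm x ->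
  ~ eball 0 Rb y -> shell_integrand rho x y = 0.
Proof.
rewrite /eball/= subr0 => rho0 xR /negP; rewrite -leNgt => yR.
by rewrite /shell_integrand (b_supp xR) (b_supp yR) subrr !mul0r.
Qed.

Let I1 x r := (\int[mu]_(y in eball x r) `|f y|%:E)%E.

Lemma shell_operator_integrable rho x : 0 < rho ->
  mu.-integrable [set: Rn R n] (fun y => (shell_integrand rho x y)%:E) /\
  (`|shell_operator rho x|%:E <=
   (CB * minr 1 rho * rho `^ (- lam))%:E * I1 x (2 * rho))%E.
Proof.
move=> rho0; apply: kernel_integral_le.
- exact: measurable_shell_integrand.
- exact: measurable_eball.
- rewrite !mulr_ge0 ?powR_ge0 ?CB0//.
  by rewrite le_min ler01 ltW.
- by apply: f_loc; lra.
- by move=> y; exact: shell_integrand_le.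
- by move=> y; exact: shell_integrand_out.
Qed.

(** Here [b x = 0], so only [y] in the fixed ball of radius [Rb] contribute. The integral of [|f|]
    stays bounded as [rho] grows, and the decay is [rho^(-lam)] instead of the weaker
    [rho^(-sigma)]. *)
Lemma shell_operator_far rho x : 0 < rho -> 0 < Rb -> Rb <= enorm x ->
  (`|shell_operator rho x|%:E <=
   (CB * minr 1 rho * rho `^ (- lam))%:E * I1 0%R Rb)%E.
Proof.
move=> rho0 Rb0 xR.
have c0 : 0 <= CB * minr 1 rho * rho `^ (- lam).
  rewrite !mulr_ge0 ?powR_ge0 ?CB0//.
  by rewrite le_min ler01 ltW.
apply: (kernel_integral_le _ _ c0 _ _ _).2.
- exact: measurable_shell_integrand.
- exact: measurable_eball.
- exact: f_loc.
- move=> y _; have [xy|xy] := pselect (eball x (2 * rho) y).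
    exact: shell_integrand_le.
  by rewrite shell_integrand_out// normr0 mulr_ge0.
- by move=> y; exact: shell_integrand_out_support.
Qed.

Lemma shell_operator_support rho x : 0 < rho -> Rb + 2 * rho <= enorm x ->
  shell_operator rho x = 0.
Proof.
move=> rho0 xR; rewrite /shell_operator (@eq_Rintegral _ _ _ mu _ (fun=> 0)).
  by rewrite Rintegral_cst ?mul0r.
move=> y _; have [xy|xy] := pselect (eball x (2 * rho) y); last exact: shell_integrand_out.
apply: shell_integrand_out_support => //; first by lra.
rewrite /eball/= subr0; apply/negP; rewrite -leNgt.
have := enorm_lipschitz x (y : V); rewrite ler_norml => /andP[_].
by move: xy; rewrite /eball/= enormBC; lra.
Qed.

(** Varying the kernel costs a factor [1 / rho], which is recovered from [|b x - b y| <= CB rho];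
    this needs [y] close to [x]. Points close to [x'] are handled by exchanging the roles of [x] and
    [x']. *)
Lemma shell_integrand_lipschitz rho x x' y : 0 < rho ->
  eball x (2 * rho) y ->
  `|shell_integrand rho x y - shell_integrand rho x' y| <=
  (Lb + CB * (2 * n%:R)) * rho `^ (- lam) * enorm (x - x') * `|f y|.
Proof.
move=> rho0 xy.
have -> : shell_integrand rho x y - shell_integrand rho x' y =
    ((b x - b x') * shell_kernel lam rho (enorm (x' - y)) +
     (b x - b y) * (shell_kernel lam rho (enorm (x - y)) -
                    shell_kernel lam rho (enorm (x' - y)))) * f y.
  rewrite /shell_integrand; move: (b x) (b x') (b y) (f y) => B1 B2 B3 F.
  by move: (shell_kernel _ _ _) (shell_kernel _ _ _) => k1 k2; ring.
rewrite normrM ler_wpM2r// (le_trans (ler_normD _ _))// !normrM.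
rewrite -mulrA mulrDl; apply: lerD.
  rewrite (mulrC (rho `^ _)) mulrA ler_pM//.
  by rewrite ger0_norm ?(shell_kernel_ge0 hlam)//; exact: (shell_kernel_le hlam).
apply: (@le_trans _ _ (CB * minr 1 rho *
  (2 * n%:R * rho `^ (- lam - 1) * enorm (x - x')))).
  apply: ler_pM => //.
    by apply: b_sub_le => //; rewrite enormBC ltW.
  apply: (le_trans (shell_kernel_lipschitz hlam _ _ rho0)).
  rewrite ler_wpM2l ?mulr_ge0 ?powR_ge0//.
  apply: (le_trans (enorm_lipschitz _ _)).
  by rewrite (_ : x - y - (x' - y) = x - x') // opprB addrA subrK.
rewrite -!mulrA ler_wpM2l//.
have -> : rho `^ (- lam) = rho * rho `^ (- lam - 1).
  by rewrite -{2}(powRr1 (ltW rho0)) -powRpD// addrCA subrr addr0.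
have m1 : minr 1 rho <= rho by rewrite ge_min lexx orbT.
rewrite [leRHS](_ : _ = rho * (2 * (n%:R * (rho `^ (- lam - 1) * enorm (x - x')))));
  last by ring.
rewrite [leLHS](_ : _ = minr 1 rho * (2 * (n%:R * (rho `^ (- lam - 1) * enorm (x - x')))));
  last by ring.
by rewrite ler_wpM2r// !mulr_ge0// ?powR_ge0 ?enorm_ge0.
Qed.

Lemma integral_norm_setU_le (A B : set (Rn R n)) : measurable A -> measurable B ->
  (\int[mu]_(y in A `|` B) `|f y|%:E <=
   \int[mu]_(y in A) `|f y|%:E + \int[mu]_(y in B) `|f y|%:E)%E.
Proof.
move=> mA mB; have mBA : measurable (B `\` A) by exact: measurableD.
have -> : A `|` B = A `|` (B `\` A).
  apply/seteqP; split => y; last by move=> [?|[? _]]; [left|right].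
  by have [Ay|nAy] := pselect (A y); [left|move=> [//|By]; right].
rewrite ge0_integral_setU; [|exact: mA|exact: mBA| | |].
- rewrite leeD2l//; apply: ge0_subset_integral; [exact: mBA|exact: mB| | |].
  + exact: (measurable_funTS mfn).
  + by move=> y _; rewrite lee_fin.
  + exact: subDsetl.
- exact: (measurable_funTS mfn).
- by move=> y _; rewrite lee_fin.
- by apply/disj_setPS => y [? []].
Qed.

Lemma shell_operator_lipschitz rho x x' : 0 < rho ->
  (`|shell_operator rho x - shell_operator rho x'|%:E <=
   ((Lb + CB * (2 * n%:R)) * rho `^ (- lam) * enorm (x - x'))%:E *
   (I1 x (2 * rho) + I1 x' (2 * rho)))%E.
Proof.
move=> rho0; have rho20 : 0 < 2 * rho by lra.
have [ix _] := shell_operator_integrable x rho0.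
have [ix' _] := shell_operator_integrable x' rho0.
rewrite /shell_operator -(RintegralB measurableT ix ix').
set c := (Lb + _) * _ * _.
have c0 : 0 <= c.
  rewrite mulr_ge0 ?enorm_ge0// mulr_ge0 ?powR_ge0// addr_ge0// mulr_ge0//.
have mB z : measurable (@eball R n z (2 * rho)) by exact: measurable_eball.
pose E := eball x (2 * rho) `|` eball x' (2 * rho).
have sub := integral_norm_setU_le (mB x) (mB x').
apply: (@le_trans _ _ (c%:E * \int[mu]_(y in E) `|f y|%:E)%E); last first.
  by apply: lee_wpmul2l => //; rewrite lee_fin.
apply: (kernel_integral_le _ _ c0 _ _ _).2.
- by apply: measurable_funB; exact: measurable_shell_integrand.
- exact: measurableU.
- by apply: (le_lt_trans sub); rewrite lte_add_pinfty// f_loc.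
- move=> y [xy|xy]; first exact: shell_integrand_lipschitz.
  by rewrite distrC /c (enormBC x); exact: shell_integrand_lipschitz.
- move=> y /not_orP[xy xy'].
  by rewrite !shell_integrand_out ?subrr.
Qed.

Definition commutator_piece (jx : nat * V) : R :=
  shell_operator (2^-1 ^+ jx.1.+1) jx.2 + shell_operator (2 ^+ jx.1) jx.2.

Let partial_integrand m (x y : V) : R :=
  (b x - b y) * (\sum_(j < m) shell_pair lam j (enorm (x - y))) * f y.

Let integrable_shell (rho : R) x : 0 < rho ->
  mu.-integrable [set: Rn R n] (fun y => (shell_integrand rho x y)%:E).
Proof.
by move=> rho0; exact: (shell_operator_integrable x rho0).1.
Qed.

Let sum_piece m x :
  mu.-integrable [set: Rn R n] (fun y => (partial_integrand m x y)%:E) /\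
  \sum_(j < m) commutator_piece (nat_of_ord j, x) = \int[mu]_y partial_integrand m x y.
Proof.
elim: m => [|m [IH1 IH2]].
  have E : partial_integrand 0 x = fun=> 0.
    by apply/funext => y; rewrite /partial_integrand big_ord0 mulr0 mul0r.
  rewrite E big_ord0; split; first exact: integrable0.
  by rewrite Rintegral_cst// mul0r.
have r1 : 0 < 2^-1 ^+ m.+1 :> R by rewrite exprn_gt0.
have r2 : 0 < 2 ^+ m :> R by rewrite exprn_gt0.
have E : partial_integrand m.+1 x = fun y => partial_integrand m x y +
   (shell_integrand (2^-1 ^+ m.+1) x y + shell_integrand (2 ^+ m) x y).
  apply/funext => y; rewrite /partial_integrand big_ord_recr/= /shell_integrand.
  rewrite /shell_pair; move: (\sum_(i < m) _) (b x) (b y) (f y) => s B1 B2 F.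
  by move: (shell_kernel _ _ _) (shell_kernel _ _ _) => k1 k2; ring.
have i1 := integrable_shell x r1; have i2 := integrable_shell x r2.
have i12 : mu.-integrable [set: Rn R n] (fun y =>
   (shell_integrand (2^-1 ^+ m.+1) x y + shell_integrand (2 ^+ m) x y)%:E).
  exact: (integrableD measurableT i1 i2).
rewrite E big_ord_recr/= IH2; split.
  exact: (integrableD measurableT IH1 i12).
by rewrite (RintegralD measurableT IH1 i12) (RintegralD measurableT i1 i2).
Qed.

(** Dominated convergence with majorant [2 Mb] times the absolute Riesz integrand, available at
    those [x] where the potential of [f] converges. *)
Lemma commutator_piece_sum_cvg x :
  mu.-integrable [set: Rn R n] (fun y => (riesz_integrand alpha f x y)%:E) ->
  \sum_(j < m) commutator_piece (nat_of_ord j, x) @[m --> \oo] -->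
  commutator alpha b f x.
Proof.
move=> If.
pose F y := (b x - b y) * riesz_integrand alpha f x y.
have mk : measRn     (fun y : Rn R n => (enorm (x - (y : V)) `^ (n%:R - alpha))^-1).
  apply: (eq_measurable_fun (fun y : Rn R n => enorm (x - (y : V)) `^ (- (n%:R - alpha)))).
    by move=> y _; rewrite powRN.
  exact: (measurableT_comp (measurable_powR _) (measurable_enorm_sub x)).
have mr : measRn (riesz_integrand alpha f x).
  apply: measurable_funM; first exact: mf.
  exact: mk.
have mbx : measRn (fun y => b x - b y).
  by apply: measurable_funB; [exact: measurable_cst|exact: mb].
have dist_gt0 (y : V) : y != x -> 0 < enorm (x - y).
  by move=> yx; apply: enorm_gt0; rewrite subr_eq0 eq_sym.
have Ibf : mu.-integrable [set: Rn R n] (fun y => (riesz_integrand alpha (b \* f) x y)%:E).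
  have IM : mu.-integrable [set: Rn R n] (fun y => (Mb * riesz_integrand alpha f x y)%:E).
    exact: (integrableZl measurableT Mb If).
  apply: (le_integrable measurableT _ _ IM).
    apply/measurable_EFinP; apply: measurable_funM.
      by apply: measurable_funM; [exact: mb|exact: mf].
    exact: mk.
  move=> y _; rewrite lee_fin /riesz_integrand -mulrA !normrM ler_wpM2r//.
  exact: le_trans (b_bnd _) (ler_norm _).
have Ibxf : mu.-integrable [set: Rn R n] (fun y => (b x * riesz_integrand alpha f x y)%:E).
  exact: (integrableZl measurableT (b x) If).
have -> : commutator alpha b f x = \int[mu]_y F y.
  rewrite /commutator /riesz -(RintegralZl (b x) measurableT If).
  rewrite -(RintegralB measurableT Ibxf Ibf); apply: eq_Rintegral => y _.
  rewrite /F /riesz_integrand /mul_fun /=.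
  by move: (_ `^ _)^-1 (b x) (b y) (f y) => k B1 B2 F1; ring.
have [IF Icvg] : mu.-integrable [set: Rn R n] (fun y => (F y)%:E) /\
    (\int[mu]_y (partial_integrand m x y)%:E)%E @[m --> \oo] -->
    (\int[mu]_y (F y)%:E)%E.
  pose G y := ((2 * Mb) * `|riesz_integrand alpha f x y|)%:E.
  have IG : mu.-integrable [set: Rn R n] G.
    have Ia : mu.-integrable [set: Rn R n] (fun y => `|riesz_integrand alpha f x y|%:E).
      exact: (integrable_norm If).
    exact: (integrableZl measurableT (2 * Mb) Ia).
  have mP m : measRn (fun y => (partial_integrand m x y)%:E).
    by have [/integrableP[]] := sum_piece m x.
  have mF : measRn (fun y => (F y)%:E).
    by apply/measurable_EFinP; apply: measurable_funM; [exact: mbx|exact: mr].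
  have ptw : {ae mu, forall y, [set: Rn R n] y ->
      (partial_integrand m x y)%:E @[m --> \oo] --> (F y)%:E}.
    apply/aeW => y _; apply: cvg_EFin; first exact: nearW.
    (* On the diagonal the factor [b x - b y] vanishes, whatever values the kernels take there. *)
    have [->|yx] := eqVneq y x.
      rewrite /F subrr mul0r; apply: cvg_near_cst; apply: nearW => m /=.
      by rewrite /partial_integrand subrr !mul0r.
    have e0 := dist_gt0 _ yx.
    have -> : F y = (b x - b y) * (enorm (x - y) `^ (- lam)) * f y.
      by rewrite /F /riesz_integrand powRN -mulrA; congr (_ * _); rewrite mulrC.
    apply: cvgM; last exact: cvg_cst.
    by apply: cvgM; [exact: cvg_cst|exact: (sum_shell_pair_cvg hlam e0)].
  have dom : {ae mu, forall y, forall m, [set: Rn R n] y ->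
      (`|(partial_integrand m x y)%:E| <= G y)%E}.
    apply/aeW => y m _; rewrite lee_fin /partial_integrand.
    have [->|yx] := eqVneq y x.
      by rewrite subrr !mul0r normr0 !mulr_ge0.
    have e0 := dist_gt0 _ yx.
    rewrite /riesz_integrand !normrM -mulrA ler_pM ?mulr_ge0//.
      apply: (le_trans (ler_normB _ _)); have := b_bnd x; have := b_bnd y; lra.
    rewrite mulrC ler_wpM2l// ger0_norm ?(sum_shell_pair_ge0 hlam)//.
    rewrite -powRN ger0_norm ?powR_ge0//; exact: (sum_shell_pair_le hlam).
  by have [IF _ h] := dominated_convergence measurableT mP mF ptw IG dom.
under eq_fun do rewrite (sum_piece _ x).2.
apply: fine_cvg; rewrite /Rintegral fineK//.
exact: integrable_fin_num.
Qed.

(** One constant for both the sup and the Lipschitz bound; [2 K1 2^d1] comes from the integrals of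
    [|f|] over two balls of radius [2 rho]. *)
Definition piece_const := (Lb + CB * (2 * n%:R)) * (2 * K1 * 2 `^ d1).

Lemma piece_const_ge0 : 0 <= piece_const.
Proof. by rewrite !mulr_ge0 ?powR_ge0// addr_ge0// !mulr_ge0. Qed.

(** Height of the kernel times growth of the integral of [|f|]: the exponents add up to
    [d1 - lam = - sigma]. *)
Let shell_pow rho : 0 < rho -> rho `^ (- lam) * (2 * rho) `^ d1 = 2 `^ d1 * rho `^ (- sigma).
Proof.
move=> rho0; rewrite powRM ?(ltW rho0)// mulrCA -powRpD//.
by congr (_ * _ `^ _); ring.
Qed.

Lemma shell_operator_sup rho x : 0 < rho ->
  `|shell_operator rho x| <= piece_const * minr 1 rho * rho `^ (- sigma).
Proof.
move=> rho0; have rho20 : 0 < 2 * rho by lra.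
have m0 : 0 <= minr 1 rho by rewrite le_min ler01 ltW.
rewrite -lee_fin.
apply: (le_trans (shell_operator_integrable x rho0).2).
apply: (le_trans (lee_wpmul2l _ (growth1 x rho20))).
  by rewrite lee_fin !mulr_ge0 ?powR_ge0.
rewrite -EFinM lee_fin.
have -> : CB * minr 1 rho * rho `^ (- lam) * (K1 * (2 * rho) `^ d1) =
    CB * minr 1 rho * K1 * (rho `^ (- lam) * (2 * rho) `^ d1) by ring.
rewrite shell_pow// /piece_const.
have -> : CB * minr 1 rho * K1 * (2 `^ d1 * rho `^ (- sigma)) =
  CB * (K1 * 2 `^ d1) * minr 1 rho * rho `^ (- sigma) by ring.
rewrite ler_wpM2r ?powR_ge0// ler_wpM2r//.
have -> : (Lb + CB * (2 * n%:R)) * (2 * K1 * 2 `^ d1) =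
  ((Lb + CB * (2 * n%:R)) * 2) * (K1 * 2 `^ d1) by ring.
rewrite ler_wpM2r ?mulr_ge0 ?powR_ge0//.
have : CB * 1 <= CB * n%:R by rewrite ler_wpM2l.
have := Lb_ge0; have := mulr_ge0 CB0 (ler0n R n); lra.
Qed.

Lemma shell_operator_lip rho x y : 0 < rho ->
  `|shell_operator rho x - shell_operator rho y| <=
  piece_const * rho `^ (- sigma) * enorm (x - y).
Proof.
move=> rho0; have rho20 : 0 < 2 * rho by lra.
rewrite -lee_fin.
apply: (le_trans (shell_operator_lipschitz x y rho0)).
have h := leeD (growth1 x rho20) (growth1 y rho20).
apply: (le_trans (lee_wpmul2l _ h)).
  by rewrite lee_fin !mulr_ge0 ?powR_ge0 ?enorm_ge0// addr_ge0// !mulr_ge0.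
rewrite -EFinD -EFinM lee_fin /piece_const; apply: ler_eq.
rewrite (_ : _ * (_ + _) = (Lb + CB * (2 * n%:R)) * (2 * K1) *
  (rho `^ (- lam) * (2 * rho) `^ d1) * enorm (x - y)); last by ring.
by rewrite shell_pow//; ring.
Qed.

Lemma shell_operator_far_le rho x : 0 < rho -> 0 < Rb -> Rb <= enorm x ->
  `|shell_operator rho x| <=
  CB * K1 * Rb `^ d1 * minr 1 rho * rho `^ (- lam).
Proof.
move=> rho0 Rb0 xR; rewrite -lee_fin.
have m0 : 0 <= minr 1 rho by rewrite le_min ler01 ltW.
apply: (le_trans (shell_operator_far rho0 Rb0 xR)).
apply: (le_trans (lee_wpmul2l _ (growth1 0 Rb0))).
  by rewrite lee_fin !mulr_ge0 ?powR_ge0.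
by rewrite -EFinM lee_fin; apply: ler_eq; ring.
Qed.

(** Serves as sup bound and as Lipschitz constant. It need not decay in [j], since it is used for
    compactness only, where each index is treated separately. *)
Definition piece_sup_bound (j : nat) : R :=
  piece_const * ((2^-1 ^+ j.+1) `^ (- sigma) + (2 ^+ j) `^ (- sigma)).

Lemma commutator_piece_equilipschitz :
  equilipschitz piece_sup_bound piece_sup_bound (fun j => Rb + 2 * 2 ^+ j)
    (commutator_piece).
Proof.
have r1 j := half_pow_gt0 R j.
have r2 j : 0 < 2 ^+ j :> R by rewrite exprn_gt0.
have A0 := piece_const_ge0.
have sup rho x : 0 < rho ->
    `|shell_operator rho x| <= piece_const * rho `^ (- sigma).
  move=> rho0; apply: (le_trans (shell_operator_sup x rho0)).
  rewrite ler_wpM2r ?powR_ge0// -[leRHS]mulr1 ler_wpM2l//.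
  by rewrite ge_min lexx.
split.
- move=> j x; rewrite /commutator_piece/= /piece_sup_bound mulrDr.
  apply: (le_trans (ler_normD _ _)); apply: lerD; exact: sup.
- move=> j x y; rewrite /commutator_piece/= /piece_sup_bound opprD addrACA mulrDr mulrDl.
  by apply: (le_trans (ler_normD _ _)); apply: lerD; exact: shell_operator_lip.
- move=> j x xR; rewrite /commutator_piece/=.
  rewrite !(shell_operator_support) ?addr0//.
  rewrite (le_trans _ xR)// lerD2l ler_wpM2l//.
  exact: le_trans (half_pow_le1 _ _) (double_pow_ge1 _ _).
Qed.

(** The sup bound carries [min(1, rho)] and the Lipschitz bound carries the distance, both next to
    the same [rho^(-sigma)]; interpolation raises the minimum to the power [1 - gamma] and the
    distance to [gamma]. *)
Lemma shell_operator_holder rho gamma x y : 0 < rho -> 0 <= gamma < 1 ->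
  `|shell_operator rho x - shell_operator rho y| <=
  2 * piece_const * minr 1 (rho `^ (1 - gamma)) * rho `^ (- sigma) *
    enorm (x - y) `^ gamma.
Proof.
move=> rho0 /andP[g0 g1]; have A0 := piece_const_ge0.
have m0 : 0 <= minr 1 rho by rewrite le_min ler01 ltW.
have h1 := lerD (shell_operator_sup x rho0) (shell_operator_sup y rho0).
have h2 := shell_operator_lip x y rho0.
have P0 := powR_ge0 rho (- sigma).
have E0 : 0 <= 2 * piece_const * rho `^ (- sigma) by rewrite mulr_ge0// mulr_ge0.
have := @holder_interpolation R _ _ _
  `|shell_operator rho x - shell_operator rho y| gamma
  _ E0 m0 (enorm_ge0 (x - y)) (normr_ge0 _).
rewrite g0 g1 => /(_ isT).
set D := `|_|; rewrite minr_powR ?subr_ge0 ?(ltW g1)//.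
rewrite (_ : 2 * piece_const * _ * _ * _ =
  2 * piece_const * rho `^ (- sigma) * (minr 1 (rho `^ (1 - gamma)) * enorm (x - y) `^ gamma));
  last by ring.
apply.
  apply: (le_trans (ler_normB _ _)); apply: (le_trans h1).
  by apply: ler_eq; ring.
apply: (le_trans h2); rewrite ler_wpM2r ?enorm_ge0// -mulrA ler_peMl ?(mulr_ge0 A0 P0)//.
by rewrite ler1n.
Qed.

Lemma commutator_piece_sup (delta : R) j x : 0 < delta -> delta <= sigma ->
  delta <= 1 - sigma ->
  `|commutator_piece (j, x)| <= 2 * piece_const * (2 `^ (- delta)) ^+ j.
Proof.
move=> d0 ds d1s; have A0 := piece_const_ge0.
have rho1 := half_pow_gt0 R j.+1.
rewrite /commutator_piece/= mulrAC -mulrA mulr_natl mulr2n.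
apply: (le_trans (ler_normD _ _)); apply: lerD.
  apply: (le_trans (shell_operator_sup _ rho1)).
  rewrite min_r ?half_pow_le1// -mulrA mulrC ler_wpM2r//.
  rewrite -{1}(powRr1 (ltW rho1)) -powRpD//; apply: powR_half_le => //; exact: ltW.
apply: (le_trans (shell_operator_sup _ _)); first by rewrite exprn_gt0.
rewrite min_l ?double_pow_ge1// mulr1 mulrC ler_wpM2r//.
by apply: powR_double_le; lra.
Qed.

Lemma commutator_piece_holder (delta gamma : R) j x y : 0 < delta -> 0 <= gamma < 1 ->
  delta <= sigma -> delta <= 1 - gamma - sigma ->
  `|commutator_piece (j, x) - commutator_piece (j, y)| <=
  4 * piece_const * (2 `^ (- delta)) ^+ j * enorm (x - y) `^ gamma.
Proof.
move=> d0 hg ds d1s; have A0 := piece_const_ge0.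
have rho1 := half_pow_gt0 R j.+1.
have rho2 : 0 < 2 ^+ j :> R by rewrite exprn_gt0.
have e0 := powR_ge0 (enorm (x - y)) gamma.
have /andP[g0 g1] := hg.
rewrite /commutator_piece/= opprD addrACA.
have A1 : 0 <= 2 * piece_const * enorm (x - y) `^ gamma.
  by rewrite mulr_ge0// mulr_ge0.
set T := _ `^ (- delta) ^+ j.
have -> : 4 * piece_const * T * enorm (x - y) `^ gamma =
   T * (2 * piece_const * enorm (x - y) `^ gamma) +
   T * (2 * piece_const * enorm (x - y) `^ gamma) by ring.
apply: (le_trans (ler_normD _ _)); apply: lerD.
  apply: (le_trans (shell_operator_holder _ _ rho1 hg)).
  rewrite min_r; last first.
    by rewrite -[leRHS](one_powR (1 - gamma)) powR_le_pos ?half_pow_le1 ?subr_ge0 ?(ltW g1)// ltW.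
  rewrite (_ : _ * _ * _ * _ = ((2^-1 ^+ j.+1) `^ (1 - gamma) * (2^-1 ^+ j.+1) `^ (- sigma)) *
    (2 * piece_const * enorm (x - y) `^ gamma)); last by ring.
  rewrite ler_wpM2r// -powRpD//; apply: powR_half_le => //; exact: ltW.
apply: (le_trans (shell_operator_holder _ _ rho2 hg)).
rewrite min_l; last first.
  rewrite -[leLHS](one_powR (1 - gamma)) powR_le_pos ?double_pow_ge1 ?subr_ge0 ?(ltW g1)//.
rewrite mulr1 (_ : _ * _ * _ = (2 ^+ j) `^ (- sigma) *
    (2 * piece_const * enorm (x - y) `^ gamma)); last by ring.
by rewrite ler_wpM2r// /T; apply: powR_double_le; rewrite lerN2.
Qed.

(** * Growth of the pieces for a Morrey target *)

Context (t : R).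
Hypothesis hqt : q <= t.
Hypothesis hst : sigma * t = n%:R * q / p.

Let t0 : 0 < t. Proof. by have := hq; have := hqt; lra. Qed.

Lemma measurable_shell_operator rho : 0 < rho ->
  measRn (shell_operator rho).
Proof.
move=> rho0; apply: continuous_measurable_Rn.
exact: (lipschitz_continuous_Rn (fun x y => shell_operator_lip x y rho0)).
Qed.

Definition small_shell_const : R :=
  CB `^ t * (K1 * 2 `^ d1) `^ (t - q) * (2 `^ q * (4 `^ n%:R) `^ (q - 1)) *
  (2 `^ n%:R * 2 `^ n%:R * K * 2 `^ n%:R).

(** Sup bounds need not decay here, as [sigma] may exceed 1. With [a] the integral of [|f|] over the
    ball of radius [2 rho], the operator is at most [CB rho^(1 - lam) a]. The power [a^t] is split
    into [a^(t - q)], bounded by the growth of [f], and [a^q], bounded by the integral of [|f|^q]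
    over the same ball, which is then averaged over [x]. By [hst] all powers of [rho] combine to
    [rho^t]. *)
Lemma small_shell_growth rho : 0 < rho -> rho <= 1 ->
  ball_growth t d (small_shell_const * rho `^ t) (shell_operator rho).
Proof.
move=> rho0 rho1 x0 r r0.
have rho20 : 0 < 2 * rho by lra.
have mB : measurable (@eball R n x0 r) by exact: measurable_eball.
pose J x := (\int[mu]_(y in eball x (2 * rho)) (`|f y| `^ q)%:E)%E.
have J0 x : (0 <= J x)%E by apply: integral_ge0 => y _; rewrite lee_fin powR_ge0.
pose c := CB `^ t * (K1 * 2 `^ d1) `^ (t - q) * (2 `^ q * (4 `^ n%:R) `^ (q - 1)) *
  ((rho * rho `^ (- lam)) `^ t * (rho `^ d1) `^ (t - q) * (rho `^ n%:R) `^ (q - 1)).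
have c0 : 0 <= c by rewrite /c; repeat apply: mulr_ge0; exact: powR_ge0.
have PJ x : ((`|shell_operator rho x| `^ t)%:E <= c%:E * J x)%E.
  pose a := fine (I1 x (2 * rho)); have Ifin := f_loc x rho20.
  have I0 : (0 <= I1 x (2 * rho))%E by apply: integral_ge0 => y _; rewrite lee_fin.
  have aE : I1 x (2 * rho) = a%:E by rewrite fineK// ge0_fin_numE.
  have a0 : 0 <= a by rewrite -lee_fin -aE.
  have a1 : a <= K1 * 2 `^ d1 * rho `^ d1.
    have := growth1 x rho20; rewrite -/(I1 _ _) aE lee_fin powRM ?mulrA//; exact: ltW.
  have m0 : 0 < (2 * (2 * rho)) ^+ n by rewrite exprn_gt0// mulr_gt0.
  have := powR_integral_norm_le mf (measurable_eball x (2 * rho)) q1 m0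
    (lebesgue_eball_le x rho20) Ifin.
  rewrite -/(I1 _ _) -/a -/(J x) => aJ.
  have Pa : `|shell_operator rho x| <= CB * (rho * rho `^ (- lam)) * a.
    have := (shell_operator_integrable x rho0).2.
    by rewrite aE -EFinM lee_fin min_r// mulrA.
  have Pt : `|shell_operator rho x| `^ t <= CB `^ t * (rho * rho `^ (- lam)) `^ t *
      (a `^ (t - q) * a `^ q).
    apply: (le_trans (powR_le_pos (ltW t0) (normr_ge0 _) Pa)).
    rewrite !powRM ?powR_ge0 ?mulr_ge0 ?powR_ge0 ?(ltW rho0)//.
    have [->|a_neq0] := eqVneq a 0.
      by rewrite powR0 ?gt_eqF// mulr0 !mulr_ge0 ?powR_ge0.
    by rewrite -powRpD ?lt_def ?a_neq0// subrK.
  have at_ : a `^ (t - q) <= (K1 * 2 `^ d1) `^ (t - q) * (rho `^ d1) `^ (t - q).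
    rewrite -powRM ?mulr_ge0 ?powR_ge0//; apply: powR_le_pos => //.
    by rewrite subr_ge0.
  have -> : c = CB `^ t * (rho * rho `^ (- lam)) `^ t *
     ((K1 * 2 `^ d1) `^ (t - q) * (rho `^ d1) `^ (t - q)) *
     (2 `^ q * ((2 * (2 * rho)) ^+ n) `^ (q - 1)).
    have -> : (2 * (2 * rho)) ^+ n = 4 `^ n%:R * rho `^ n%:R.
      rewrite -powRM ?(ltW rho0)// powR_mulrn ?mulr_ge0 ?(ltW rho0)//.
      by congr (_ ^+ _); ring.
    by rewrite (powRM _ (powR_ge0 _ _) (powR_ge0 _ _)) /c; ring_powR.
  rewrite EFinM -muleA.
  apply: (@le_trans _ _ ((CB `^ t * (rho * rho `^ (- lam)) `^ t *
     ((K1 * 2 `^ d1) `^ (t - q) * (rho `^ d1) `^ (t - q)))%:E * (a `^ q)%:E)%E).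
    rewrite -EFinM lee_fin; apply: (le_trans Pt); rewrite mulrA.
    apply: ler_wpM2r; first exact: powR_ge0.
    by apply: ler_wpM2l at_; apply: mulr_ge0; exact: powR_ge0.
  apply: lee_wpmul2l aJ; rewrite lee_fin.
  by apply: mulr_ge0; apply: mulr_ge0; exact: powR_ge0.
apply: (@le_trans _ _ (\int[mu]_(x in eball x0 r) (c%:E * J x))%E).
  apply: ge0_le_integral; first exact: mB.
  - by move=> x _; rewrite lee_fin powR_ge0.
  - by apply: measurable_funTS; apply: measurable_powR_norm; exact: measurable_shell_operator.
  - apply: emeasurable_funM; first exact: measurable_cst.
    by apply: measurable_funTS; exact: measurable_ball_integral.
  - by move=> x _; exact: PJ.
rewrite ge0_integralZl; [|exact: mB| | |]; last 3 first.
- by apply: measurable_funTS; exact: measurable_ball_integral.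
- by move=> x _; exact: J0.
- by rewrite lee_fin.
apply: (le_trans (lee_wpmul2l _ (double_ball_integral_le mf x0 d_bounds f_growth rho20 r0))).
  by rewrite lee_fin.
rewrite -EFinM lee_fin; apply: ler_eq.
rewrite /c /small_shell_const (powRM _ (ler0n _ _) (ltW rho0)).
have -> : rho `^ t = (rho * rho `^ (- lam)) `^ t * (rho `^ d1) `^ (t - q) *
    (rho `^ n%:R) `^ (q - 1) * rho `^ n%:R.
  rewrite -[X in (X * _) `^ _](powRr1 (ltW rho0)) -powRpD// -!powRrM -!powRpD//.
  congr (_ `^ _).
  have -> : (1 + - lam) * t + d1 * (t - q) + n%:R * (q - 1) + n%:R =
     t + (n%:R * q / p - sigma * t) by ring.
  by rewrite hst subrr addr0.
ring_powR.
Qed.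

Definition large_shell_const : R :=
  piece_const `^ t * (2 `^ n%:R * Rb `^ (n%:R - d)) +
  (CB * K1 * Rb `^ d1) `^ t * (2 `^ n%:R * (Rb + 2) `^ (n%:R - d)).

(** In the ball of radius [Rb] the sup bound [rho^(-sigma)] is used; outside it the stronger
    [rho^(-lam)], up to radius [(Rb + 2) rho], beyond which the operator vanishes. The size of that
    second region costs [rho^(n - d) = rho^(sigma t)], and [sigma - lam = - d1] leaves
    [rho^(- d1 t)]. *)
Lemma large_shell_growth delta rho : 1 <= rho ->
  delta <= sigma * t -> delta <= d1 * t ->
  ball_growth t d (large_shell_const * rho `^ (- delta)) (shell_operator rho).
Proof.
move=> rho1 ds dd x0 r r0.
have rho0 : 0 < rho by lra.
have mB x s : measurable (@eball R n x s) by exact: measurable_eball.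
have A0 := piece_const_ge0.
pose a := (piece_const * rho `^ (- sigma)) `^ t.
pose c := (CB * K1 * Rb `^ d1 * rho `^ (- lam)) `^ t.
have a0 : 0 <= a by exact: powR_ge0.
have c0 : 0 <= c by exact: powR_ge0.
have Rr0 : 0 < (Rb + 2) * rho by rewrite mulr_gt0// addr_gt0.
have Pt x : `|shell_operator rho x| `^ t <= a * \1_(eball 0 Rb) x + c * \1_(eball 0 ((Rb + 2) * rho)) x.
  have [xR|xR] := ltP (enorm x) Rb.
    rewrite -[leLHS]addr0; apply: lerD; last by apply: mulr_ge0; [exact: c0|rewrite indicE].
    rewrite indicE mem_set ?mulr1; last by rewrite /eball/= subr0.
    apply: powR_le_pos; [exact: ltW|exact: normr_ge0|].
    apply: (le_trans (shell_operator_sup x rho0)).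
    by rewrite min_l// mulr1.
  rewrite -[leLHS]add0r; apply: lerD; first by apply: mulr_ge0; [exact: a0|rewrite indicE].
  have [xr|xr] := ltP (enorm x) ((Rb + 2) * rho).
    rewrite indicE mem_set ?mulr1; last by rewrite /eball/= subr0.
    apply: powR_le_pos; [exact: ltW|exact: normr_ge0|].
    have := shell_operator_far_le rho0 Rb_gt0 xR.
    by rewrite min_l// mulr1.
  rewrite (shell_operator_support rho0); last first.
    apply: le_trans xr; have : Rb * 1 <= Rb * rho by apply: ler_wpM2l => //; exact: ltW.
    lra.
  rewrite normr0 powR0; last by rewrite gt_eqF.
  by apply: mulr_ge0; [exact: c0|rewrite indicE].
have mP := measurable_powR_norm t (measurable_shell_operator rho0).
have mI s := measurable_indic_eball (0 : V) s.
have H := ae_integral_le_linear (mB x0 r) mP (mI Rb) (fun=> powR_ge0 _ _)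
  (fun=> ler0n R _) (mI ((Rb + 2) * rho)) (fun=> ler0n R _) a0 c0 (aeW mu (fun x _ => Pt x)).
apply: (le_trans H).
have Ib s e : 0 < s -> 0 <= e -> (e%:E * \int[mu]_(x in eball x0 r) (\1_(eball (0 : V) s) x : R)%:E <=
    (e * (2 `^ n%:R * (r `^ d * s `^ (n%:R - d))))%:E)%E.
  move=> s0 e0; rewrite EFinM; apply: lee_wpmul2l; first by rewrite lee_fin.
  by rewrite integral_indic// setIC; exact: lebesgue_ball_inter_le.
apply: (le_trans (leeD (Ib _ _ Rb_gt0 a0) (Ib _ _ Rr0 c0))).
rewrite -EFinD lee_fin /a /c /large_shell_const.
set A := piece_const in A0 *; set B := CB * K1 * Rb `^ d1.
have B0 : 0 <= B by rewrite /B; repeat apply: mulr_ge0 => //; exact: powR_ge0.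
rewrite (powRM _ A0 (powR_ge0 _ _)) (powRM _ B0 (powR_ge0 _ _)).
rewrite (@powRM _ (Rb + 2) rho) ?(ltW rho0)//; last by rewrite addr_ge0// ltW.
have nd : n%:R - d = sigma * t by rewrite hst; ring.
rewrite [leRHS]mulrAC mulrDl !mulrDl; apply: lerD.
  rewrite (_ : A `^ t * _ * _ = A `^ t * (2 `^ n%:R * Rb `^ (n%:R - d)) * r `^ d *
    (rho `^ (- sigma)) `^ t); last first.
    ring_powR.
  apply: ler_wpM2l; first by repeat apply: mulr_ge0; exact: powR_ge0.
  rewrite -powRrM; apply: ler_powR => //.
  by rewrite mulNr lerN2.
rewrite (_ : B `^ t * _ * _ = B `^ t * (2 `^ n%:R * (Rb + 2) `^ (n%:R - d)) * r `^ d *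
    ((rho `^ (- lam)) `^ t * rho `^ (n%:R - d))); last first.
  ring_powR.
apply: ler_wpM2l; first by repeat apply: mulr_ge0; exact: powR_ge0.
rewrite -powRrM -powRpD//; apply: ler_powR => //.
rewrite nd -mulrDl.
by rewrite (_ : - lam + sigma = - d1) ?mulNr ?lerN2//; ring.
Qed.

Lemma commutator_piece_growth delta j : 0 <= delta -> delta <= t ->
  delta <= sigma * t -> delta <= d1 * t ->
  ball_growth t d (2 `^ t * (small_shell_const + large_shell_const) *
    (2 `^ (- delta)) ^+ j) (fun x => commutator_piece (j, x)).
Proof.
move=> de0 dt ds dd.
have r1 := half_pow_gt0 R j.+1.
have r2 : 0 < 2 ^+ j :> R by rewrite exprn_gt0.
have g1 := small_shell_growth r1 (half_pow_le1 _ _).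
have g2 := large_shell_growth (double_pow_ge1 R j) ds dd.
have := ball_growthD (ltW t0) (measurable_shell_operator r1)
  (measurable_shell_operator r2) g1 g2.
apply: ball_growth_le.
rewrite -mulrA; apply: ler_wpM2l; first exact: powR_ge0.
rewrite [leRHS]mulrDl; apply: lerD.
  apply: ler_wpM2l; last exact: powR_half_le.
  by rewrite /small_shell_const; repeat apply: mulr_ge0 => //; exact: powR_ge0.
apply: ler_wpM2l; last by apply: powR_double_le.
by rewrite /large_shell_const addr_ge0//; repeat apply: mulr_ge0 => //; exact: powR_ge0.
Qed.

End commutator_pieces.


(** * Geometric series *)

Section geometric_sums.
Context (R : realType).

Lemma nneseries_le_sup (f : nat -> \bar R) (c : \bar R) :
  (forall j, (0 <= f j)%E) -> (forall m, (\sum_(j < m) f j <= c)%E) ->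
  (\sum_(j <oo) f j <= c)%E.
Proof.
move=> f0 fc; apply: lime_le; first by apply: is_cvg_nneseries => j _ _; exact: f0.
by apply: nearW => m; rewrite big_mkord; exact: fc.
Qed.

Lemma sum_le_powR_sup (omega t c : R) (a : nat -> R) m : 0 < omega < 1 -> 0 < t ->
  0 <= c -> (forall j, `|a j| `^ t <= (omega ^+ j) `^ t * c) ->
  `|\sum_(j < m) a j| `^ t <= ((1 - omega)^-1) `^ t * c.
Proof.
move=> /andP[w0 w1] t0 c0 ac.
have aj j : `|a j| <= omega ^+ j * c `^ t^-1.
  have oj : 0 <= omega ^+ j by rewrite exprn_ge0// ltW.
  apply: (le_trans (le_powR_inv t0 (normr_ge0 _) (ac j))).
  by rewrite powRM ?powR_ge0// -powRrM mulfV ?lt0r_neq0// powRr1.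
have ic : 0 <= (1 - omega)^-1 by rewrite invr_ge0 subr_ge0 ltW.
have -> : ((1 - omega)^-1) `^ t * c = ((1 - omega)^-1 * c `^ t^-1) `^ t.
  by rewrite powRM ?powR_ge0// powR_invK.
apply: powR_le_pos; [exact: ltW|exact: normr_ge0|].
apply: (le_trans (ler_norm_sum _ _ _)).
apply: (@le_trans _ _ (\sum_(j < m) omega ^+ j * c `^ t^-1)).
  by apply: ler_sum => j _; exact: aj.
rewrite -mulr_suml; apply: ler_wpM2r; first exact: powR_ge0.
by apply: sum_geometric_le; rewrite (ltW w0).
Qed.

Lemma cvg_sum_geometric (omega c : R) (a : nat -> R) : 0 < omega < 1 ->
  (forall j, `|a j| <= c * omega ^+ j) -> cvgn (fun m => \sum_(j < m) a j).
Proof.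
move=> /andP[w0 w1] ac.
have -> : (fun m => \sum_(j < m) a j) = series a.
  by apply/funext => m; rewrite /series/= big_mkord.
apply: normed_cvg; apply: (@series_le_cvg _ _ (geometric c omega)).
- by move=> j /=; exact: normr_ge0.
- move=> j /=; exact: le_trans (normr_ge0 _) (ac j).
- by move=> j /=; exact: ac.
- by apply: is_cvg_geometric_series; rewrite ger0_norm ?ltW.
Qed.

End geometric_sums.

Lemma geometric_small (R : realType) (theta A e : R) : 0 < theta < 1 -> 0 <= A -> 0 < e ->
  exists m, A * theta ^+ m <= e.
Proof.
move=> /andP[t0 t1] A0 e0.
have h : A * theta ^+ k @[k --> \oo] --> A * 0.
  by apply: cvgMr; apply: cvg_expr; rewrite ger0_norm// ltW.
rewrite mulr0 in h.
have /cvgrPdist_le/(_ e e0)[m _ Hm] := h.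
exists m; have := Hm m (leqnn _); rewrite /= sub0r normrN ger0_norm//.
by rewrite mulr_ge0// exprn_ge0// ltW.
Qed.

Lemma powR_small (R : realType) (A g e : R) : 0 <= A -> 0 < g -> 0 < e ->
  exists2 a : R, 0 < a & forall x, 0 <= x -> x <= a -> A * x `^ g <= e.
Proof.
move=> A0 g0 e0; have A1 : 0 < A + 1 by lra.
have eA : 0 < e / (A + 1) by rewrite divr_gt0.
exists ((e / (A + 1)) `^ g^-1); first exact: powR_gt0.
move=> x x0 xa; apply: (@le_trans _ _ (A * (e / (A + 1)))).
  apply: ler_wpM2l => //; apply: (le_trans (powR_le_pos (ltW g0) x0 xa)).
  by rewrite powR_invK// ltW.
rewrite mulrA ler_pdivrMr//.
by have := ltW e0; lra.
Qed.

(** * Almost everywhere sums of sequences of functions *)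

Section sums_of_functions.
Context (R : realType) (n : nat).
Local Notation V := 'rV[R]_n.
Local Notation mu := (lebesgue_Rn R n).

(** A relation rather than an operator: the sum is determined up to a null set, and [commutator] has
    its own values on that set. *)
Definition sums_to (G : nat * V -> R) (h : V -> R) : Prop :=
  {ae mu, forall x : Rn R n, \sum_(j < m) G (nat_of_ord j, (x : V)) @[m --> \oo] --> h x}.

Lemma sums_toB (G G' : nat * V -> R) (h h' : V -> R) : sums_to G h -> sums_to G' h' ->
  sums_to (fun jx => G' jx - G jx) (fun x => h' x - h x).
Proof.
apply: filterS2 => x Gx G'x; under eq_fun do rewrite sumrB.
exact: cvgB G'x Gx.
Qed.

(** The upper limit of the partial sums is measurable everywhere and equals the sum wherever the
    series converges. *)
Lemma measurable_sums_to (G : nat * V -> R) :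
  (forall j, measRn (fun x : V => G (j, x))) ->
  {ae mu, forall x : Rn R n, cvgn (fun m => \sum_(j < m) G (nat_of_ord j, (x : V)))} ->
  exists2 h : V -> R, measRn h & sums_to G h.
Proof.
move=> mG Gc.
pose S m (x : Rn R n) : \bar R := (\sum_(j < m) G (nat_of_ord j, (x : V)))%:E.
exists (fun x => fine (limn_esup (S ^~ x))).
  apply: (measurableT_comp (@fine_measurable R setT measurableT)).
  apply: measurable_fun_limn_esup => m.
  by apply/measurable_EFinP; apply: measurable_sum => j; exact: mG.
apply: filterS Gc => x /cvg_ex[l Gl].
have Sl : S m x @[m --> \oo] --> l%:E by apply/fine_cvgP; split; [exact: nearW|exact: Gl].
suff -> : fine (limn_esup (S ^~ x)) = l by exact: Gl.
rewrite (_ : limn_esup _ = l%:E)//.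
exact: (cvg_limn_einf_sup Sl).2.
Qed.

Context (omega t d A : R) (G : nat * V -> R).
Hypothesis omega01 : 0 < omega < 1.
Hypothesis t0 : 0 < t.
Hypothesis mG : forall j, measRn (fun x : V => G (j, x)).
Hypothesis G_growth : forall j,
  ball_growth t d (A * (omega ^+ j) `^ (t + 1)) (fun x => G (j, x)).

(** These weighted powers replace Minkowski's inequality. Of the decay [omega^(j (t + 1))], the
    power [t] pays for the weight and the remaining [omega^j] makes their sum [T] locally
    integrable. Where [T] is finite, [|G_j| <= omega^j T^(1/t)], so the series converges and its sum
    is at most [T^(1/t) / (1 - omega)] in absolute value. *)
Let g j (x : Rn R n) : \bar R := ((omega ^+ j) `^ (- t) * `|G (j, (x : V))| `^ t)%:E.
Let T x := (\sum_(j <oo) g j x)%E.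

Let w0 j : 0 < omega ^+ j.
Proof. by rewrite exprn_gt0//; have /andP[] := omega01. Qed.

Let g0 j x : (0 <= g j x)%E.
Proof. by rewrite lee_fin; apply: mulr_ge0; exact: powR_ge0. Qed.

Let mg j : measRn (g j).
Proof.
apply/measurable_EFinP; apply: measurable_funM; first exact: measurable_cst.
by apply/measurable_EFinP; apply: measurable_powR_norm; exact: mG.
Qed.

Let mT : measRn T.
Proof.
apply: ge0_emeasurable_sum => j; first by move=> x _ _; exact: g0.
by move=> _; exact: mg.
Qed.

Let T0 x : (0 <= T x)%E. Proof. by apply: nneseries_ge0 => j _ _; exact: g0. Qed.

Let A0 : 0 <= A.
Proof.
have := ball_growth_ge0 (G_growth 0).
by rewrite expr0 powR1 mulr1.
Qed.

Let T_growth x r : 0 < r ->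
  (\int[mu]_(y in eball x r) T y <= (A / (1 - omega) * r `^ d)%:E)%E.
Proof.
move=> r0; have mB : measurable (@eball R n x r) by exact: measurable_eball.
rewrite integral_nneseries//; last first.
  by move=> j; apply: measurable_funTS; exact: mg.
apply: nneseries_le_sup => [j|m]; first by apply: integral_ge0 => y _; exact: g0.
apply: (@le_trans _ _ (\sum_(j < m) (A * r `^ d * omega ^+ j)%:E)%E).
  apply: lee_sum => j _.
  under eq_integral do rewrite /g EFinM.
  rewrite ge0_integralZl; [|exact: mB| | |]; last 3 first.
  - by apply: measurable_funTS; apply: measurable_powR_norm; exact: mG.
  - by move=> y _; rewrite lee_fin powR_ge0.
  - by rewrite lee_fin powR_ge0.
  apply: (le_trans (lee_wpmul2l _ (G_growth j x r0))); first by rewrite lee_fin powR_ge0.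
  rewrite -EFinM lee_fin; apply: ler_eq.
  rewrite [X in X * r `^ d]mulrC !mulrA -powRpD// addrA addNr add0r.
  rewrite powRr1; last exact: ltW.
  by ring.
rewrite sumEFin lee_fin -mulr_sumr.
have -> : A / (1 - omega) * r `^ d = A * r `^ d * (1 - omega)^-1 by ring.
apply: ler_wpM2l; first by apply: mulr_ge0 => //; exact: powR_ge0.
by apply: sum_geometric_le; have /andP[/ltW-> ->] := omega01.
Qed.

Let T_fin : {ae mu, forall x, (T x < +oo)%E}.
Proof.
have H k : {ae mu, forall x, eball (0 : V) k.+1%:R x -> T x \is a fin_num}.
  apply: integrable_ae; first exact: measurable_eball.
  apply/integrableP; split; first by apply: measurable_funTS; exact: mT.
  under eq_integral do rewrite gee0_abs//.
  exact: (le_lt_trans (T_growth 0 (ltr0Sn _ k)) (ltry _)).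
have /ae_foralln := H; apply: filterS => x Hx.
rewrite -ge0_fin_numE//; apply: (Hx (Num.truncn (enorm (x : V)))).
by rewrite /eball/= subr0 truncnS_gt.
Qed.

Let G_le_T x j : (T x < +oo)%E -> `|G (j, x)| `^ t <= (omega ^+ j) `^ t * fine (T x).
Proof.
move=> Tx; have gT : (g j x <= T x)%E.
  have := @nneseries_lim_ge R (g ^~ x) xpredT 0 j.+1 (fun k _ _ => g0 k x).
  apply: le_trans; rewrite big_mkord big_ord_recr/= leeDr//.
  by apply: sume_ge0 => k _; exact: g0.
have -> : `|G (j, x)| `^ t = (omega ^+ j) `^ t * ((omega ^+ j) `^ (- t) * `|G (j, x)| `^ t).
  by rewrite mulrA -powRpD// subrr powRr0 mul1r.
apply: ler_wpM2l; first exact: powR_ge0.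
by rewrite -lee_fin fineK// ge0_fin_numE.
Qed.

Lemma sums_to_exists :
  exists2 h : V -> R, measRn h & sums_to G h.
Proof.
apply: measurable_sums_to => //; apply: filterS T_fin => x Tx.
apply: (@cvg_sum_geometric R omega ((fine (T x)) `^ t^-1) (fun j => G (j, x)) omega01) => j.
have c0 : 0 <= fine (T x) by exact: fine_ge0.
apply: (le_trans (le_powR_inv t0 (normr_ge0 _) (G_le_T j Tx))).
by rewrite powRM ?powR_ge0// -powRrM mulfV ?lt0r_neq0// powRr1 ?(ltW (w0 j))// mulrC.
Qed.

Lemma sums_to_growth (h : V -> R) :
  measRn h -> sums_to G h ->
  ball_growth t d (((1 - omega)^-1) `^ t * (A / (1 - omega))) h.
Proof.
move=> mh Gh x r r0.
have mB : measurable (@eball R n x r) by exact: measurable_eball.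
pose c := ((1 - omega)^-1) `^ t.
have c0 : 0 <= c by exact: powR_ge0.
apply: (@le_trans _ _ (\int[mu]_(y in eball x r) (c%:E * T y))%E).
  apply: ae_ge0_le_integral; first exact: mB.
  - by move=> y _; rewrite lee_fin powR_ge0.
  - by apply: measurable_funTS; apply: measurable_powR_norm.
  - by move=> y _; apply: mule_ge0; [rewrite lee_fin|exact: T0].
  - apply: emeasurable_funM; first exact: measurable_cst.
    by apply: measurable_funTS; exact: mT.
  apply: filterS2 T_fin Gh => y Ty Gy _.
  rewrite -(fineK (_ : T y \is a fin_num)); last by rewrite ge0_fin_numE.
  rewrite -EFinM lee_fin.
  have Ty0 : 0 <= fine (T y) by exact: fine_ge0.
  have S m := @sum_le_powR_sup R omega t (fine (T y)) (fun j => G (j, y)) m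
    omega01 t0 Ty0 (fun j => G_le_T j Ty).
  have hc : `|h y| <= (c * fine (T y)) `^ t^-1.
    apply: (cvgr_to_le (cvg_norm Gy)).
    by apply: nearW => m; apply: le_powR_inv (S m).
  apply: (le_trans (powR_le_pos (ltW t0) (normr_ge0 _) hc)).
  by rewrite powR_invK// mulr_ge0.
rewrite ge0_integralZl; [|exact: mB| | |]; last 3 first.
- by apply: measurable_funTS; exact: mT.
- by move=> y _; exact: T0.
- by rewrite lee_fin.
rewrite -mulrA EFinM; apply: lee_wpmul2l; first by rewrite lee_fin.
exact: T_growth.
Qed.

End sums_of_functions.


(** * Sums of pieces in a Morrey space *)

Section morrey_target.
Context (R : realType) (n : nat).
Hypothesis n_gt0 : (0 < n)%N.
Local Notation V := 'rV[R]_n.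
Local Notation mu := (lebesgue_Rn R n).
Context (s t : R).
Hypothesis t_gt1 : 1 < t.
Hypothesis hts : t <= s.
Local Notation d := (n%:R - n%:R * t / s).

Let t0 : 0 < t. Proof. by have := t_gt1; lra. Qed.
Let s0 : 0 < s. Proof. exact: lt_le_trans hts. Qed.
Let nR_gt0 : 0 < n%:R :> R. Proof. by rewrite ltr0n. Qed.

Let d_bounds : 0 <= d <= n%:R.
Proof. exact: morrey_exponent_bounds. Qed.

Lemma morrey_norm_ge0 (f : V -> R) : (0 <= morrey_norm s t f)%E.
Proof.
apply: le_trans (ereal_sup_ubound _); last first.
  by exists (0 : V) => //; exists 1; [exact: ltr01|reflexivity].
by apply: mule_ge0; exact: poweR_ge0.
Qed.

Lemma eq_morrey_norm (f g : V -> R) : (forall x, `|f x| = `|g x|) ->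
  morrey_norm s t f = morrey_norm s t g.
Proof.
move=> fg; rewrite /morrey_norm.
have -> // : (fun y : Rn R n => (`|f y| `^ t)%:E) = (fun y : Rn R n => (`|g y| `^ t)%:E).
by apply/funext => y; rewrite fg.
Qed.

Lemma ball_growth_norm_lt (e : R) : 0 < e -> exists2 K0 : R, 0 < K0 &
  forall g : V -> R, ball_growth t d K0 g -> (morrey_norm s t g < e%:E)%E.
Proof.
move=> e0; set c := n%:R `^ (n%:R * (t^-1 - s^-1)).
have c0 : 0 < c by exact: powR_gt0.
exists ((e / (2 * c)) `^ t); first by rewrite powR_gt0// divr_gt0// mulr_gt0.
move=> g gK; apply: (le_lt_trans (growth_morrey_norm n_gt0 t0 hts gK)).
rewrite lte_fin -powRrM mulfV ?lt0r_neq0// powRr1; last first.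
  by rewrite divr_ge0 ?(ltW e0)// mulr_ge0// ltW.
rewrite -/c (_ : e / (2 * c) * c = e / 2); last by field; rewrite lt0r_neq0.
lra.
Qed.

Lemma ball_growth_morrey (K : R) (g : V -> R) :
  measRn g -> ball_growth t d K g -> morrey s t g.
Proof.
move=> mg gK; split => //.
exact: (le_lt_trans (growth_morrey_norm n_gt0 t0 hts gK) (ltry _)).
Qed.

Lemma ball_growth0 (K : R) : 0 <= K -> ball_growth t d K ((fun=> 0) : V -> R).
Proof.
move=> K0 x r r0; under eq_integral do rewrite normr0 powR0 ?lt0r_neq0//.
by rewrite integral0 lee_fin mulr_ge0// powR_ge0.
Qed.

Lemma morrey_norm0 : morrey_norm s t ((fun=> 0) : V -> R) = 0%E.
Proof.
apply/eqP; rewrite eq_le morrey_norm_ge0 andbT; apply/lee_addgt0Pr => e e0.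
have [K0 K00 H] := ball_growth_norm_lt e0.
by rewrite add0e ltW// H//; apply: ball_growth0; exact: ltW.
Qed.

(** Smallness is all that is needed, so the argument passes through [ball_growth] and back, losing
    constants. *)
Lemma morrey_norm_quasi_triangle (e : R) : 0 < e -> exists2 de : R, 0 < de &
  forall f g h : V -> R, morrey s t f -> morrey s t g -> morrey s t h ->
    (morrey_norm s t (fun x => (g x - f x)%R) < de%:E)%E ->
    (morrey_norm s t (fun x => (h x - g x)%R) < de%:E)%E ->
    (morrey_norm s t (fun x => (h x - f x)%R) < e%:E)%E.
Proof.
move=> e0; have [K0 K00 H] := ball_growth_norm_lt e0.
(* [2^t] comes from the power of a sum, 2 from its two terms, and [2^d] from turning a norm bound
   into growth. *)
pose c := 2 `^ t * 2 * 2 `^ d.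
have c0 : 0 < c by rewrite !mulr_gt0 ?powR_gt0.
have de0 : 0 < (K0 / c) `^ t^-1 by rewrite powR_gt0// divr_gt0.
exists ((K0 / c) `^ t^-1) => // f g h [mf _] [mg _] [mh _] /ltW gf /ltW hg.
have G1 := morrey_norm_growth n_gt0 t0 hts (ltW de0) gf.
have G2 := morrey_norm_growth n_gt0 t0 hts (ltW de0) hg.
have G := ball_growthD (ltW t0) (measurable_funB mh mg) (measurable_funB mg mf) G2 G1.
apply: H; rewrite (_ : (fun x => _) = (fun x => h x - g x + (g x - f x))); last first.
  by apply/funext => x; rewrite addrA subrK.
apply: ball_growth_le G; rewrite powR_invK//; last first.
  by rewrite divr_ge0// ltW.
apply: ler_eq.
rewrite (_ : 2 `^ t * (K0 / c * 2 `^ d + K0 / c * 2 `^ d) = K0 / c * (2 `^ t * 2 * 2 `^ d)).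
  by rewrite -/c divfK// lt0r_neq0.
by ring.
Qed.

Lemma ball_growth_bounded_support (u : V -> R) (de rho : R) :
  measRn u -> 0 < rho ->
  (forall x, `|u x| <= de) -> (forall x, rho <= enorm x -> u x = 0) ->
  ball_growth t d (de `^ t * (2 `^ n%:R * rho `^ (n%:R - d))) u.
Proof.
move=> mu_ rho0 ude usupp x r r0.
have mB z v : measurable (@eball R n z v) by exact: measurable_eball.
have H := ae_integral_le_scale (mB x r) (measurable_powR_norm t mu_)
  (measurable_indic_eball (0 : V) rho) (fun=> powR_ge0 _ _) (fun=> ler0n R _) (powR_ge0 de t) (aeW mu (fun y _ => _)).
apply: (le_trans (H _)) => [y|].
  have [yr|yr] := ltP (enorm (y : V)) rho.
    rewrite indicE mem_set ?mulr1; last by rewrite /eball/= subr0.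
    by apply: powR_le_pos; [exact: ltW|exact: normr_ge0|exact: ude].
  by rewrite usupp// normr0 powR0 ?lt0r_neq0// mulr_ge0// powR_ge0.
rewrite -[_ * _ * r `^ d]mulrA EFinM; apply: lee_wpmul2l; first by rewrite lee_fin powR_ge0.
rewrite integral_indic// setIC; apply: (le_trans (lebesgue_ball_inter_le x 0 r0 rho0 d_bounds)).
by rewrite lee_fin mulrA mulrAC.
Qed.

Context (M L rr : nat -> R) (K : set (nat * V -> R)) (C omega : R).
Hypothesis K_lip : K `<=` equilipschitz M L rr.
Hypothesis omega01 : 0 < omega < 1.
Hypothesis K_growth : forall G, K G -> forall j,
  ball_growth t d (C * ((omega ^+ j) `^ (t + 1)) ^+ 2) (fun x => G (j, x)).

(** The decay of [K] is the square of [kap]: one factor is consumed by the summation, the other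
    makes the tail beyond an index [m] small. *)
Local Notation kap j := ((omega ^+ j) `^ (t + 1)).

Let w0 j : 0 < omega ^+ j.
Proof. by rewrite exprn_gt0//; have /andP[] := omega01. Qed.

Let kap_le j : kap j <= omega ^+ j.
Proof.
rewrite powRpD// powRr1 ?(ltW (w0 j))//; apply: ler_piMl; first exact: ltW.
rewrite -(one_powR t); apply: powR_le_pos; [exact: ltW|exact: ltW|].
by rewrite exprn_ile1//; have /andP[/ltW ? /ltW] := omega01.
Qed.

Let kap_le1 j : kap j <= 1.
Proof.
apply: (le_trans (kap_le j)).
by rewrite exprn_ile1//; have /andP[/ltW ? /ltW] := omega01.
Qed.

Lemma equilipschitz_measurable G j : equilipschitz M L rr G ->
  measRn (fun x : V => G (j, x)).
Proof.
move=> [_ GL _]; apply: continuous_measurable_Rn.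
exact: (lipschitz_continuous_Rn (GL j)).
Qed.

(** On a fixed ball an error [de] in one piece adds at most [2^t de^t] times the volume, and [de]
    may be chosen after the ball. The lost factor [2^t] again stands in for Minkowski's
    inequality. *)
Let closure_growth G (j : nat) (KG : unif_closure M L rr K G) :
  ball_growth t d (2 `^ t * C * (kap j) ^+ 2) (fun x => G (j, x)).
Proof.
move: KG => [EG KG] x r r0; apply/lee_addgt0Pr => e e0.
have mB : measurable (@eball R n x r) by exact: measurable_eball.
have c0 : 0 < 2 `^ t * (2 * r) ^+ n by rewrite mulr_gt0 ?powR_gt0// exprn_gt0// mulr_gt0.
pose de := (e / (2 `^ t * (2 * r) ^+ n)) `^ t^-1.
have de0 : 0 < de by rewrite powR_gt0// divr_gt0.
have [H KH GH] := KG j.+1 de de0.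
have mp F : equilipschitz M L rr F ->
    measRn (fun y => (`|F (j, (y : V))| `^ t)%:E).
  by move=> EF; apply: measurable_powR_norm; exact: equilipschitz_measurable.
have p2 : 0 <= 2 `^ t :> R by exact: powR_ge0.
have GHt (y : V) : `|G (j, y)| `^ t <= 2 `^ t * `|H (j, y)| `^ t + 2 `^ t * de `^ t.
  rewrite -mulrDr -[G _](subrK (H (j, y))) addrC.
  apply: (le_trans (powR_normD_le _ _ (ltW t0))); apply: ler_wpM2l => //.
  apply: lerD => //; apply: powR_le_pos; [exact: ltW|exact: normr_ge0|exact: GH].
have I := ae_integral_le_affine mB (mp G EG) (mp H (K_lip KH)) (fun=> powR_ge0 _ _)
  (fun=> powR_ge0 _ _) (lebesgue_eball_le x r0) p2 (mulr_ge0 p2 (powR_ge0 de t))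
  (aeW mu (fun y _ => GHt y)).
apply: (le_trans I); have := K_growth KH j x r0.
move/(lee_wpmul2l (_ : (0 <= (2 `^ t)%:E)%E)); rewrite lee_fin => /(_ p2) h.
apply: (le_trans (leeD h (lexx _))); rewrite -EFinM -!EFinD lee_fin !mulrA lerD2l.
rewrite mulrAC powR_invK//; last exact: divr_ge0 (ltW e0) (ltW c0).
by rewrite mulrC divfK// lt0r_neq0.
Qed.

Let C_ge0 : (exists G, K G) -> 0 <= C.
Proof. by move=> [G /K_growth/(_ 0)/ball_growth_ge0]; rewrite expr0 powR1 expr1n mulr1. Qed.

Lemma morrey_sums_exist G : unif_closure M L rr K G ->
  exists2 h, morrey s t h & sums_to G h.
Proof.
move=> KG; have EG := KG.1.
have K0 : exists G, K G by have [H KH _] := KG.2 0 1 ltr01; exists H.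
have C0 := C_ge0 K0.
have growth j : ball_growth t d (2 `^ t * C * kap j) (fun x => G (j, x)).
  apply: ball_growth_le (closure_growth j KG); apply: ler_wpM2l.
    by apply: mulr_ge0 => //; exact: powR_ge0.
  by rewrite expr2 ler_piMr ?powR_ge0.
have mG j := equilipschitz_measurable j EG.
have [h mh Gh] := sums_to_exists omega01 t0 mG growth.
exists h => //; apply: (ball_growth_morrey mh).
exact: (sums_to_growth omega01 t0 mG growth mh Gh).
Qed.

(** Apply the summation bound to the difference [U]. For [j < m] it is uniformly small with support
    in a common ball; for [j >= m] the spare factor [kap j] is at most [omega^m]. *)
Lemma morrey_sums_continuous G : unif_closure M L rr K G ->
  forall e : R, 0 < e -> exists m, exists2 de : R, 0 < de &
  forall G' h h', unif_closure M L rr K G' -> unif_close m de G G' ->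
    morrey s t h -> morrey s t h' -> sums_to G h -> sums_to G' h' ->
    (morrey_norm s t (fun x => (h' x - h x)%R) < e%:E)%E.
Proof.
move=> KG e e0; have [K0 K00 HK] := ball_growth_norm_lt e0.
have exK : exists G, K G by have [H KH _] := KG.2 0 1 ltr01; exists H.
have C0 := C_ge0 exK.
have /andP[om0 om1] := omega01.
pose a := ((1 - omega)^-1) `^ t / (1 - omega).
have a0 : 0 < a by rewrite divr_gt0 ?subr_gt0// powR_gt0// invr_gt0 subr_gt0.
(* [a] is the factor lost in [sums_to_growth], so growth [eta kap j] of the differences yields the
   constant [K0] for their sum. *)
pose eta := K0 / a.
have eta0 : 0 < eta by rewrite divr_gt0.
pose C4 := 2 `^ t * (2 `^ t * C + 2 `^ t * C).
have C40 : 0 <= C4.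
  by rewrite /C4; repeat (apply: mulr_ge0 || apply: addr_ge0) => //; exact: powR_ge0.
have [m mC] := geometric_small omega01 C40 eta0.
pose rho := 1 + \sum_(j < m) `|rr j|.
have rho0 : 0 < rho by rewrite ltr_pwDl// sumr_ge0.
have rr_rho j : (j < m)%N -> rr j <= rho.
  move=> jm; apply: (le_trans (ler_norm _)).
  rewrite /rho (bigD1 (Ordinal jm))//= addrCA lerDl addr_ge0// sumr_ge0//.
pose c := 2 `^ n%:R * rho `^ (n%:R - d).
have c0 : 0 < c by rewrite mulr_gt0 ?powR_gt0.
(* Chosen so that [de^t c = eta kap m]. As [kap] is nonincreasing, this serves every [j < m]. *)
pose de := (eta * kap m / c) `^ t^-1.
have de0 : 0 < de by rewrite powR_gt0// divr_gt0// mulr_gt0// powR_gt0.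
exists m, de => // G' h h' KG' GG' [mh _] [mh' _] Gh Gh'.
have mG j := equilipschitz_measurable j KG.1.
have mG' j := equilipschitz_measurable j KG'.1.
pose U (jx : nat * V) := G' jx - G jx.
have mU j : measRn (fun x : V => U (j, x)).
  by apply: measurable_funB; [exact: mG'|exact: mG].
have U_growth j : ball_growth t d (eta * kap j) (fun x => U (j, x)).
  have [jm|mj] := ltnP j m.
    have := @ball_growth_bounded_support (fun x => U (j, x)) de rho (mU j) rho0.
    have u1 x : `|U (j, x)| <= de by rewrite /U distrC; exact: GG'.
    have u2 x : rho <= enorm x -> U (j, x) = 0.
      move=> xr; have jx := le_trans (rr_rho j jm) xr.
      have [_ _ G0] := KG.1; have [_ _ G'0] := KG'.1.
      by rewrite /U G0// G'0// subrr.
    move=> /(_ u1 u2); apply: ball_growth_le.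
    rewrite -/c powR_invK//; last first.
      by rewrite divr_ge0 ?(ltW c0)// mulr_ge0 ?(ltW eta0)// powR_ge0.
    rewrite divfK ?lt0r_neq0//; apply: ler_wpM2l; first exact: ltW.
    apply: powR_le_pos; [by have := t0; lra|exact: ltW|].
    by apply: ler_wiXn2l; [exact: ltW|exact: ltW|exact: ltnW].
  have GN : ball_growth t d (2 `^ t * C * (kap j) ^+ 2) (fun x => - G (j, x)).
    move=> x r r0; under eq_integral do rewrite normrN.
    exact: (closure_growth j KG).
  have mGN : measRn (fun x => - G (j, (x : V))).
    by apply: (measurableT_comp (@oppr_measurable R setT)); exact: mG.
  have := ball_growthD (ltW t0) (mG' j) mGN (closure_growth j KG') GN.
  apply: ball_growth_le.
  have -> : 2 `^ t * (2 `^ t * C * kap j ^+ 2 + 2 `^ t * C * kap j ^+ 2) = C4 * kap j * kap j.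
    by rewrite /C4; ring_powR.
  apply: ler_wpM2r; first exact: powR_ge0.
  apply: le_trans mC; apply: ler_wpM2l => //; apply: (le_trans (kap_le j)).
  by apply: ler_wiXn2l; [exact: ltW|exact: ltW|].
apply: HK; have := sums_to_growth omega01 t0 mU U_growth (measurable_funB mh' mh) (sums_toB Gh Gh').
apply: ball_growth_le; apply: ler_eq.
rewrite /eta /a; field.
by apply/andP; split; rewrite lt0r_neq0// ?powR_gt0 ?invr_gt0 ?subr_gt0.
Qed.

Lemma morrey_precompact (A : set (V -> R)) :
  (forall h, A h -> exists2 G, K G & sums_to G h) ->
  precompact [set g : seminormed (morrey s t) (morrey_norm s t) | A (sval g)].
Proof.
move=> AK; apply: (@precompact_of_sums R n (morrey s t) (morrey_norm s t) M L rr K A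
  (@sums_to R n)).
- exact: morrey_norm0.
- by move=> f g _ _; apply: eq_morrey_norm => x; rewrite distrC.
- exact: morrey_norm_quasi_triangle.
- exact: K_lip.
- exact: AK.
- exact: morrey_sums_exist.
- exact: morrey_sums_continuous.
Qed.

End morrey_target.


(** * Mean oscillation on cubes *)

Section oscillation.
Context (R : realType) (n : nat).
Hypothesis n_gt0 : (0 < n)%N.
Local Notation V := 'rV[R]_n.
Local Notation mu := (lebesgue_Rn R n).
Context (gamma : R).
Hypothesis hgamma : 0 <= gamma < 1.
Implicit Types (c : V) (l : R) (u v h : V -> R).

Let nR_gt0 : 0 < n%:R :> R. Proof. by rewrite ltr0n. Qed.

Lemma cube_enorm c l x : 0 < l -> cube c l x -> enorm ((x : V) - c) <= n%:R * l.
Proof.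
move=> l0 xc; apply: (le_trans (enorm_le_sum _)).
apply: (@le_trans _ _ (\sum_(i < n) l)).
  apply: ler_sum => i _; have := xc i; rewrite !mxE => /andP[? ?].
  by rewrite ger0_norm; lra.
by rewrite sumr_const card_ord mulr_natl.
Qed.

Lemma measurable_compact_Rn (A : set V) : compact A -> measurable (A : set (Rn R n)).
Proof.
move=> cA; rewrite -[X in measurable X]setCK; apply: measurableC; apply: open_measurable_Rn.
by apply: closed_openC; apply: compact_closed; first exact: norm_hausdorff.
Qed.

Lemma lebesgue_cube_fin c l : 0 < l -> mu (cube c l) \is a fin_num.
Proof.
move=> l0; rewrite ge0_fin_numE//.
exact: (le_lt_trans (lebesgue_cube_le c l0) (ltry _)).
Qed.

Lemma locally_integrable_cube h c l : locally_integrable_Rn h -> 0 < l ->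
  mu.-integrable (cube c l) (fun x => (h x)%:E).
Proof.
move=> [mh hK] l0; apply/integrableP; split.
  by apply: measurable_funTS; apply/measurable_EFinP.
have sub : cube c l `<=` [set x : V | enorm x <= n%:R * l + enorm c].
  move=> x /(cube_enorm l0) xc /=; have := enormD ((x : V) - c) c.
  by rewrite subrK; lra.
have cB := @compact_closed_ball R n (n%:R * l + enorm c).
have mcb := measurable_compact_Rn cB.
apply: (le_lt_trans _ (hK _ cB)).
under eq_integral do rewrite abse_EFin.
apply: ge0_subset_integral; [exact: measurable_cube|exact: mcb| | |exact: sub]; last by move=> x _; rewrite lee_fin.
by apply: measurable_funTS; apply/measurable_EFinP; apply: measurableT_comp.
Qed.

Lemma oscillation_ge0 u c l : (0 <= oscillation gamma u (cube c l))%E.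
Proof.
apply: mule_ge0; first exact: poweR_ge0.
by apply: integral_ge0 => x _; rewrite lee_fin.
Qed.

Lemma eq_oscillation u v c l : (forall x, u x = - v x) ->
  mu.-integrable (cube c l) (fun x => (v x)%:E) ->
  oscillation gamma u (cube c l) = oscillation gamma v (cube c l).
Proof.
move=> uv iv; rewrite /oscillation.
have -> : average u (cube c l) = - average v (cube c l).
  rewrite /average -mulrN; congr (_ * _).
  under eq_Rintegral do rewrite uv -mulN1r.
  by rewrite RintegralZl ?mulN1r//; exact: measurable_cube.
by under eq_integral do rewrite uv -opprD normrN.
Qed.

Lemma measurable_dist_cst u (a : R) : measRn u ->
  measRn (fun x => `|u x - a|%:E).
Proof.
move=> mu_; apply: measurable_norm_EFin.
by apply: measurable_funB; [exact: mu_|exact: measurable_cst].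
Qed.

Lemma oscillationD u v c l : 0 < l -> measRn u -> measRn v ->
  mu.-integrable (cube c l) (fun x => (u x)%:E) ->
  mu.-integrable (cube c l) (fun x => (v x)%:E) ->
  (oscillation gamma (fun x => (u x + v x)%R) (cube c l) <=
   oscillation gamma u (cube c l) + oscillation gamma v (cube c l))%E.
Proof.
move=> l0 mu_ mv iu iv; rewrite /oscillation -ge0_muleDr; last 2 first.
- by apply: integral_ge0 => x _; rewrite lee_fin.
- by apply: integral_ge0 => x _; rewrite lee_fin.
apply: lee_wpmul2l; first exact: poweR_ge0.
have mQ := @measurable_cube R n c l.
have H := ae_integral_le_linear mQ (measurable_dist_cst _ (measurable_funD mu_ mv))
  (measurable_dist_cst (average u (cube c l)) mu_) (fun=> normr_ge0 _) (fun=> normr_ge0 _)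
  (measurable_dist_cst (average v (cube c l)) mv) (fun=> normr_ge0 _) ler01 ler01
  (aeW mu (fun x _ => _)).
rewrite -[X in (_ <= X + _)%E]mul1e -[X in (_ <= _ + X)%E]mul1e; apply: H => x.
rewrite !mul1r /average RintegralD// mulrDr opprD addrACA.
exact: ler_normD.
Qed.

(** Any constant may replace the average at the price of a factor 2, because the average differs
    from [a] by at most the mean of [|h - a|]. *)
Lemma oscillation_le_integral h c l (a : R) : 0 < l -> measRn h -> mu.-integrable (cube c l) (fun x => (h x)%:E) ->
  (oscillation gamma h (cube c l) <=
   (2 * l `^ (- n%:R - gamma))%:E * \int[mu]_(x in cube c l) `|h x - a|%:E)%E.
Proof.
move=> l0 mh ih; set Q := cube c l.
have mQ : measurable Q by exact: measurable_cube.
have QE : mu Q = (fine (mu Q))%:E by rewrite fineK// lebesgue_cube_fin.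
have Ql : l ^+ n <= fine (mu Q) by rewrite -lee_fin -QE; exact: lebesgue_cube_ge.
have ln0 : 0 < l ^+ n by rewrite exprn_gt0.
set w := fine (mu Q) in QE Ql; have w0 : 0 < w by exact: lt_le_trans Ql.
have cstE (r : R) : (\int[mu]_(x in Q) (cst r%:E) x = (r * w)%:E)%E.
  by rewrite integral_cst//; exact: (congr1 (fun z => r%:E * z)%E QE).
have /andP[g0 g1] := hgamma.
have ga0 : 0 <= gamma / n%:R by rewrite divr_ge0// ltW.
have icst : mu.-integrable Q (fun=> a%:E).
  apply/integrableP; split; first by apply/measurable_EFinP; exact: measurable_cst.
  have -> : (\int[mu]_(x in Q) `|a%:E| = \int[mu]_(x in Q) (cst `|a|%:E) x)%E by [].
  by rewrite cstE ltry.
have ia : mu.-integrable Q (fun x => (h x - a)%:E).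
  apply: (eq_integrable mQ (fun x => (h x)%:E - (cst a x)%:E)%E).
    by move=> x _; rewrite EFinB.
  by apply: integrableB => //; exact: icst.
have I0 : (0 <= \int[mu]_(x in Q) `|h x - a|%:E)%E.
  by apply: integral_ge0 => x _; rewrite lee_fin.
pose I := fine (\int[mu]_(x in Q) `|h x - a|%:E)%E.
have IE : (\int[mu]_(x in Q) `|h x - a|%:E = I%:E)%E.
  rewrite fineK// ge0_fin_numE//.
  by have /integrableP[_] := ia; under eq_integral do rewrite abse_EFin.
have avg : `|average h Q - a| <= w^-1 * I.
  have -> : average h Q - a = w^-1 * \int[mu]_(x in Q) (h x - a).
    rewrite RintegralB// Rintegral_cst// -/w /average -/w mulrBr; congr (_ - _).
    by field; rewrite lt0r_neq0.
  rewrite normrM ger0_norm ?invr_ge0 ?(ltW w0)//; apply: ler_wpM2l.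
    by rewrite invr_ge0 ltW.
  exact: le_normr_Rintegral mQ ia.
rewrite /oscillation QE poweR_EFin.
apply: (@le_trans _ _ ((l `^ (- n%:R - gamma))%:E * (2 * I)%:E)%E); last first.
  by rewrite IE -!EFinM lee_fin [leLHS]mulrCA mulrA.
apply: lee_pmul.
- by rewrite lee_fin powR_ge0.
- by apply: integral_ge0 => x _; rewrite lee_fin.
- rewrite lee_fin; apply: (le_trans (powR_le_neg ln0 _ Ql)); first by lra.
  rewrite -powR_mulrn ?(ltW l0)// -powRrM.
  by rewrite (_ : n%:R * _ = - n%:R - gamma)//; field; rewrite lt0r_neq0.
- have wI0 : 0 <= w^-1 * I.
    by apply: mulr_ge0; [rewrite invr_ge0 ltW|rewrite -lee_fin -IE].
  have Qw : (mu Q <= w%:E)%E by rewrite QE.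
  have H := ae_integral_le_affine mQ (measurable_dist_cst (average h Q) mh)
    (measurable_dist_cst a mh) (fun=> normr_ge0 _) (fun=> normr_ge0 _) Qw ler01 wI0
    (aeW mu (fun x _ => _)).
  apply: (le_trans (H _)) => [x|].
    rewrite mul1r (_ : h x - average h Q = (h x - a) - (average h Q - a)).
      by apply: (le_trans (ler_normB _ _)); exact: lerD.
    by rewrite opprB addrA subrK.
  rewrite IE mul1e -EFinD lee_fin mulrAC mulVf ?lt0r_neq0// mul1r.
  lra.
Qed.

Lemma oscillation_le_sup h c l (a w : R) : 0 < l -> 0 <= w -> measRn h -> mu.-integrable (cube c l) (fun x => (h x)%:E) ->
  {ae mu, forall x : Rn R n, cube c l x -> `|h x - a| <= w} ->
  (oscillation gamma h (cube c l) <= (2 ^+ n.+1 * (l `^ (- gamma) * w))%:E)%E.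
Proof.
move=> l0 w0 mh ih hw; apply: (le_trans (oscillation_le_integral a l0 mh ih)).
have mQ := @measurable_cube R n c l.
have h1 : (\int[mu]_(x in cube c l) `|h x - a|%:E <= (w * (2 * l) ^+ n)%:E)%E.
  have H := ae_integral_le_affine mQ (measurable_dist_cst a mh) (measurable_cst (0 : R)%:E)
    (fun=> normr_ge0 _) (fun=> lexx 0) (lebesgue_cube_le c l0) (lexx 0) w0.
  apply: le_trans (H _) _; last by rewrite mul0e add0e.
  by apply: filterS hw => x hx Qx; rewrite mul0r add0r; exact: hx.
apply: (le_trans (lee_wpmul2l _ h1)).
  by rewrite lee_fin; apply: mulr_ge0 => //; exact: powR_ge0.
rewrite -EFinM lee_fin; apply: ler_eq.
have -> : l `^ (- gamma) = l `^ (- n%:R - gamma) * l ^+ n.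
  by rewrite -powR_mulrn ?(ltW l0)// -powRpD//; congr (_ `^ _); ring.
rewrite exprMn exprS; ring_powR.
Qed.

Lemma BMO_norm_ge0 h : (0 <= BMO_norm gamma h)%E.
Proof.
apply: le_trans (ereal_sup_ubound _); last first.
  by exists (0 : V) => //; exists 1; [exact: ltr01|reflexivity].
exact: oscillation_ge0.
Qed.

Lemma oscillation0 c l : oscillation gamma ((fun=> 0) : V -> R) (cube c l) = 0%E.
Proof.
rewrite /oscillation [X in (_ * X)%E](_ : _ = 0%E) ?mule0//.
apply: integral0_eq => x _.
by rewrite /average Rintegral_cst ?mul0r ?mulr0 ?subrr ?normr0//; exact: measurable_cube.
Qed.

Lemma BMO_norm0 : BMO_norm gamma ((fun=> 0) : V -> R) = 0%E.
Proof.
apply/eqP; rewrite eq_le BMO_norm_ge0 andbT; apply: ge_ereal_sup => _ [c _ [l _ <-]].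
by rewrite oscillation0.
Qed.

Lemma locally_integrableB u v : locally_integrable_Rn u -> locally_integrable_Rn v ->
  forall c l, 0 < l -> mu.-integrable (cube c l) (fun x => (u x - v x)%:E).
Proof.
move=> hu hv c l l0.
apply: (eq_integrable (measurable_cube c l) (fun x => (u x)%:E - (v x)%:E)%E).
  by move=> x _; rewrite EFinB.
by apply: integrableB; [exact: measurable_cube|exact: locally_integrable_cube..].
Qed.

Lemma BMO_normBC u v : locally_integrable_Rn u -> locally_integrable_Rn v ->
  BMO_norm gamma (fun x => v x - u x) = BMO_norm gamma (fun x => u x - v x).
Proof.
have half (f g : V -> R) : locally_integrable_Rn f -> locally_integrable_Rn g ->
    (BMO_norm gamma (fun x => (g x - f x)%R) <= BMO_norm gamma (fun x => (f x - g x)%R))%E.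
  move=> hf hg; apply: ge_ereal_sup => _ [c _ [l /= l0 <-]].
  rewrite (@eq_oscillation _ (fun x => f x - g x)); last 2 first.
  - by move=> x; rewrite opprB.
  - exact: locally_integrableB.
  by apply: ereal_sup_ubound; exists c => //; exists l.
by move=> hu hv; apply/eqP; rewrite eq_le; apply/andP; split; exact: half.
Qed.

Lemma BMO_norm_quasi_triangle (e : R) : 0 < e -> exists2 de : R, 0 < de &
  forall f g h : V -> R, locally_integrable_Rn f -> locally_integrable_Rn g ->
    locally_integrable_Rn h ->
    (BMO_norm gamma (fun x => (g x - f x)%R) < de%:E)%E ->
    (BMO_norm gamma (fun x => (h x - g x)%R) < de%:E)%E ->
    (BMO_norm gamma (fun x => (h x - f x)%R) < e%:E)%E.
Proof.
move=> e0; exists (e / 2); first by rewrite divr_gt0.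
move=> f g h hf hg hh gf hgn.
apply: (@le_lt_trans _ _ (BMO_norm gamma (fun x => (h x - g x)%R) +
    BMO_norm gamma (fun x => (g x - f x)%R))%E); last first.
  rewrite [e]splitr.
  by rewrite EFinD; exact: (lteD hgn gf).
apply: ge_ereal_sup => _ [c _ [l /= l0 <-]].
rewrite (_ : (fun x => _) = (fun x => h x - g x + (g x - f x))); last first.
  by apply/funext => x; rewrite addrA subrK.
have [mf _] := hf; have [mg _] := hg; have [mh _] := hh.
have := oscillationD l0 (measurable_funB mh mg) (measurable_funB mg mf)
  (locally_integrableB hh hg c l0) (locally_integrableB hg hf c l0).
move/le_trans; apply; apply: leeD.
  by apply: ereal_sup_ubound; exists c => //; exists l.
by apply: ereal_sup_ubound; exists c => //; exists l.
Qed.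

End oscillation.


(** * Sums of pieces in CMO *)

Lemma cvge0_le (R : realType) (T : Type) (F : set_system T) {FF : Filter F} (f : T -> \bar R) :
  (\forall x \near F, (0 <= f x)%E) ->
  (forall e : R, 0 < e -> \forall x \near F, (f x <= e%:E)%E) ->
  f x @[x --> F] --> 0%E.
Proof.
move=> f0 fe; apply/fine_cvgP; split.
  apply: filterS2 f0 (fe 1 ltr01) => x x0 x1.
  by rewrite ge0_fin_numE// (le_lt_trans x1)// ltry.
apply/cvgrPdist_le => e e0; apply: filterS2 f0 (fe e e0) => x x0 xe.
rewrite /= sub0r normrN ger0_norm ?fine_ge0//.
by rewrite -lee_fin fineK// ge0_fin_numE// (le_lt_trans xe)// ltry.
Qed.

Lemma infinity_nbhs_filter (R : realType) (n : nat) : Filter (@infinity_nbhs R n).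
Proof.
apply: filter_from_filter; first by exists 0.
move=> M N _ _; exists (maxr M N) => // z /=.
by rewrite gt_max => /andP[].
Qed.

Lemma cvg_sum_head_tail (R : realType) (theta B v : R) (u : nat -> R) m :
  0 < theta < 1 -> (forall j, `|u j| <= B * theta ^+ j) ->
  \sum_(j < k) u j @[k --> \oo] --> v ->
  `|v| <= \sum_(j < m) `|u j| + B * theta ^+ m / (1 - theta).
Proof.
move=> /andP[t0 t1] uB uv; apply: (cvgr_to_le (cvg_norm uv)); exists m => // k /= mk.
rewrite -(subnKC mk) big_split_ord/=; apply: (le_trans (ler_normD _ _)).
apply: lerD; first exact: ler_norm_sum.
apply: (le_trans (ler_norm_sum _ _ _)).
apply: (@le_trans _ _ (\sum_(i < k - m) B * theta ^+ m * theta ^+ i)).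
  by apply: ler_sum => i _; rewrite -mulrA -exprD; exact: uB.
rewrite -mulr_sumr; apply: ler_wpM2l.
  exact: le_trans (normr_ge0 _) (uB m).
by apply: sum_geometric_le; rewrite (ltW t0).
Qed.

Section cmo_target.
Context (R : realType) (n : nat).
Hypothesis n_gt0 : (0 < n)%N.
Local Notation V := 'rV[R]_n.
Local Notation mu := (lebesgue_Rn R n).
Context (gamma theta : R).
Hypothesis hgamma : 0 <= gamma < 1.
Hypothesis theta01 : 0 < theta < 1.
Implicit Types (G U : nat * V -> R) (h : V -> R) (c : V).

Let nR_gt0 : 0 < n%:R :> R. Proof. by rewrite ltr0n. Qed.
Let t1_gt0 : 0 < 1 - theta. Proof. by rewrite subr_gt0; have /andP[] := theta01. Qed.
Let theta_ge0 : 0 <= theta. Proof. by have /andP[/ltW] := theta01. Qed.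
Let two_gt0 : 0 < 2 ^+ n.+1 :> R. Proof. by rewrite exprn_gt0. Qed.

Lemma equilipschitz_cube (M L rr : nat -> R) G c l j x : equilipschitz M L rr G ->
  0 < l -> cube c l x -> `|G (j, x) - G (j, c)| <= `|L j| * (n%:R * l).
Proof.
move=> [_ GL _] l0 xc; apply: (le_trans (GL j x c)).
apply: (@le_trans _ _ (`|L j| * enorm (x - c))).
  by apply: ler_wpM2r; [exact: enorm_ge0|exact: ler_norm].
by apply: ler_wpM2l => //; exact: cube_enorm.
Qed.

(** The sup bounds make the series converge everywhere; the Hölder bounds match the factor
    [l^(-gamma)] of the oscillation, so that tails are small on cubes of every size. *)
Definition holder_decay (B : R) : set (nat * V -> R) :=
  [set G | (forall j x, `|G (j, x)| <= B * theta ^+ j) /\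
    forall j x y, `|G (j, x) - G (j, y)| <= B * theta ^+ j * enorm (x - y) `^ gamma].

Lemma holder_decay_ge0 B G : holder_decay B G -> 0 <= B.
Proof. by move=> [/(_ 0 0)/(le_trans (normr_ge0 _)) + _]; rewrite mulr1. Qed.

Lemma holder_decay_cvg B G x : holder_decay B G ->
  cvgn (fun m => \sum_(j < m) G (nat_of_ord j, x)).
Proof. by move=> [GB _]; exact: (@cvg_sum_geometric _ theta B (fun j => G (j, x))). Qed.

Lemma sums_to_bounded B G h m : holder_decay B G -> sums_to G h ->
  {ae mu, forall x : Rn R n, `|h x| <= \sum_(j < m) `|G (nat_of_ord j, (x : V))| +
    B * theta ^+ m / (1 - theta)}.
Proof.
move=> [GB _]; apply: filterS => x Gx.
exact: (@cvg_sum_head_tail _ theta B (h x) (fun j => G (j, x))).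
Qed.

Lemma sums_to_locally_integrable B G h : holder_decay B G ->
  measRn h -> sums_to G h ->
  locally_integrable_Rn h.
Proof.
move=> GB mh Gh; have B0 := holder_decay_ge0 GB; split => // A cA.
have mA := measurable_compact_Rn cA.
have [r r0 Ar] := compact_enorm_bounded cA.
have b0 : 0 <= B / (1 - theta) by rewrite divr_ge0// ltW.
have Am : (mu A <= ((2 * r) ^+ n)%:E)%E.
  apply: le_trans (lebesgue_eball_le (0 : V) r0).
  apply: le_measure; rewrite ?inE; [exact: mA|exact: measurable_eball|].
  by move=> x /Ar; rewrite /eball/= subr0.
have H := ae_integral_le_affine mA (measurable_norm_EFin mh) (measurable_cst (0 : R)%:E)
  (fun=> normr_ge0 _) (fun=> lexx 0) Am (lexx 0) b0.
apply: le_lt_trans (H _) _; last by rewrite mul0e add0e ltry.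
apply: filterS (sums_to_bounded 0 GB Gh) => x hx _.
by move: hx; rewrite big_ord0 expr0 mulr1 mul0r.
Qed.

(** The subtracted constant is the sum of the series at the corner [c], not [h c], since [h] is that
    sum only almost everywhere. The first [m] pieces are left to [H]; in the tail [l^gamma] from the
    Hölder bound cancels [l^(-gamma)]. *)
Lemma sums_to_oscillation B U h c (l H : R) m : 0 < l -> holder_decay B U ->
  measRn h -> sums_to U h ->
  (forall x, cube c l x -> \sum_(j < m) `|U (nat_of_ord j, x) - U (nat_of_ord j, c)| <= H) ->
  (oscillation gamma h (cube c l) <=
   (2 ^+ n.+1 * (l `^ (- gamma) * H + B * n%:R `^ gamma * theta ^+ m / (1 - theta)))%:E)%E.
Proof.
move=> l0 UB mh Uh UH; have B0 := holder_decay_ge0 UB.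
have /andP[g0 g1] := hgamma.
have /cvg_ex[a Ua] := @holder_decay_cvg B U c UB.
have nl0 : 0 < n%:R * l by rewrite mulr_gt0.
pose T := B * (n%:R * l) `^ gamma.
have T0 : 0 <= T by apply: mulr_ge0 => //; exact: powR_ge0.
have H0 : 0 <= H.
  have cc : cube c l c by move=> i; rewrite lexx lerDl ltW.
  by apply: le_trans (UH c cc); apply: sumr_ge0.
have W0 : 0 <= H + T * theta ^+ m / (1 - theta).
  apply: addr_ge0 => //; apply: divr_ge0; last exact: ltW.
  by apply: mulr_ge0 => //; exact: exprn_ge0.
have ih := locally_integrable_cube c (sums_to_locally_integrable UB mh Uh) l0.
have := @oscillation_le_sup R n n_gt0 gamma hgamma h c l a _ l0 W0 mh ih.
have hw : {ae mu, forall x : Rn R n, cube c l x ->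
    `|h x - a| <= H + T * theta ^+ m / (1 - theta)}.
  apply: filterS Uh => x Ux xc.
  have Uxc : \sum_(j < k) (U (nat_of_ord j, (x : V)) - U (nat_of_ord j, c)) @[k --> \oo] --> h x - a.
    have -> : (fun k => \sum_(j < k) (U (nat_of_ord j, (x : V)) - U (nat_of_ord j, c))) =
        (fun k => \sum_(j < k) U (nat_of_ord j, (x : V)) - \sum_(j < k) U (nat_of_ord j, c)).
      by apply/funext => k; rewrite sumrB.
    exact: cvgB Ux Ua.
  have uT j : `|U (j, (x : V)) - U (j, c)| <= T * theta ^+ j.
    apply: (le_trans (UB.2 j x c)); rewrite /T mulrAC; apply: ler_wpM2r; first exact: exprn_ge0.
    apply: ler_wpM2l => //; apply: powR_le_pos => //; first exact: enorm_ge0.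
    exact: cube_enorm.
  apply: (le_trans (@cvg_sum_head_tail _ theta T _ (fun j => U (j, (x : V)) - U (j, c)) m theta01 uT Uxc)).
  by rewrite lerD2r; exact: UH.
move=> /(_ hw)/le_trans; apply; rewrite lee_fin; apply: ler_wpM2l; first exact: ltW.
rewrite mulrDr lerD2l /T powRM ?(ltW l0)//.
rewrite (_ : l `^ (- gamma) * _ = (l `^ (- gamma) * l `^ gamma) *
    (B * n%:R `^ gamma * theta ^+ m / (1 - theta))); last first.
  ring_powR.
by rewrite -powRpD// addNr powRr0 mul1r.
Qed.

Let tail B m := B * n%:R `^ gamma * theta ^+ m / (1 - theta).

Let tail_small B e : 0 <= B -> 0 < e -> exists m, 2 ^+ n.+1 * tail B m <= e.
Proof.
move=> B0 e0.
have A0 : 0 <= 2 ^+ n.+1 * (B * n%:R `^ gamma / (1 - theta)).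
  by apply: mulr_ge0; [exact: ltW|apply: divr_ge0 (ltW _) => //; apply: mulr_ge0 => //; exact: powR_ge0].
have [m mP] := geometric_small theta01 A0 e0; exists m; apply: le_trans mP.
apply: ler_eq; rewrite /tail.
ring_powR.
Qed.

(** Up to a tail that is small uniformly over all cubes, [h] is a finite sum of Lipschitz functions
    of bounded support; each of the three limits is checked on this finite part. *)
Lemma sums_to_CMO (M L rr : nat -> R) B G h : equilipschitz M L rr G ->
  holder_decay B G -> measRn h ->
  sums_to G h -> CMO gamma h.
Proof.
move=> Glip GB mh Gh; have [_ _ Gr] := Glip; have B0 := holder_decay_ge0 GB.
have /andP[g0 g1] := hgamma.
have lh := sums_to_locally_integrable GB mh Gh.
have osc0 c l : (0 <= oscillation gamma h (cube c l))%E by exact: oscillation_ge0.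
split.
- split => //; apply: le_lt_trans (ltry (2 ^+ n.+1 * tail B 0)).
  apply: ge_ereal_sup => _ [c _ [l /= l0 <-]].
  have := @sums_to_oscillation B G h c l 0 0 l0 GB mh Gh.
  rewrite mulr0 add0r; apply => x _; by rewrite big_ord0.
- apply: cvge0_le.
    near=> a; apply: le_trans (osc0 0 a) _; apply: ereal_sup_ubound.
    exists (0 : V) => //; exists a => //=; rewrite lexx andbT.
    by near: a; exact: nbhs_right_gt.
  move=> e e0; have e20 : 0 < e / 2 by rewrite divr_gt0.
  have [m mP] := tail_small B0 e20.
  pose A := 2 ^+ n.+1 * ((\sum_(j < m) `|L j|) * n%:R).
  have A0 : 0 <= A.
    by rewrite /A; apply: mulr_ge0; [exact: ltW|apply: mulr_ge0 => //; exact: sumr_ge0].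
  have g10 : 0 < 1 - gamma by rewrite subr_gt0.
  (* On a cube of edge [l] the finite part varies by a multiple of [l], which gives [l^(1 - gamma)]
     after normalisation. *)
  have [a a0 aP] := @powR_small R A (1 - gamma) (e / 2) A0 g10 e20.
  apply: filterS (nbhs_right_le a0) => a' a'a.
  apply: ge_ereal_sup => _ [c _ [l /= /andP[l0 la] <-]].
  have Hb x : cube c l x -> \sum_(j < m) `|G (nat_of_ord j, x) - G (nat_of_ord j, c)| <=
      (\sum_(j < m) `|L j|) * (n%:R * l).
    by move=> xc; rewrite mulr_suml; apply: ler_sum => j _; exact: equilipschitz_cube Glip l0 xc.
  apply: (le_trans (sums_to_oscillation l0 GB mh Gh Hb)).
  rewrite lee_fin mulrDr; rewrite [e]splitr.
  apply: lerD mP; have := aP l (ltW l0) (le_trans la a'a); apply: le_trans.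
  apply: ler_eq.
  rewrite powRpD// powRr1 ?(ltW l0)// /A.
  ring_powR.
- move=> c l l0; have Fi := @infinity_nbhs_filter R n; apply: cvge0_le.
    by apply: filterE => z; exact: osc0.
  move=> e e0; have [m mP] := tail_small B0 e0.
  (* Beyond this distance the translated cube misses the supports of the first [m] pieces, so the
     finite part contributes 0. *)
  exists (\sum_(j < m) `|rr j| + enorm c + n%:R * l) => // z /= zr.
  have Hb x : cube (c + z) l x ->
      \sum_(j < m) `|G (nat_of_ord j, x) - G (nat_of_ord j, c + z)| <= 0.
    move=> xc; rewrite big1// => j _.
    have jr : rr j <= \sum_(j < m) `|rr j|.
      apply: (le_trans (ler_norm _)); rewrite (bigD1 j)//= lerDl.
      exact: sumr_ge0.
    have h1 : enorm z <= enorm (c + z) + enorm c.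
      by have := enormD (c + z) (- c); rewrite enormN addrAC subrr add0r.
    have h2 : enorm (c + z) <= enorm (x - (c + z)) + enorm x.
      by have := enormB_triangle x (c + z) 0; rewrite !subr0 (enormBC _ x).
    have h3 := cube_enorm l0 xc; have h4 : 0 <= n%:R * l by rewrite mulr_ge0 ?ltW.
    by rewrite !Gr ?subrr ?normr0//; lra.
  apply: (le_trans (sums_to_oscillation l0 GB mh Gh Hb)).
  by rewrite lee_fin mulr0 add0r.
- apply: cvge0_le.
    near=> a; apply: le_trans (osc0 0 (maxr a 1)) _; apply: ereal_sup_ubound.
    by exists (0 : V) => //; exists (maxr a 1) => //=; rewrite le_max lexx.
  move=> e e0; have e20 : 0 < e / 2 by rewrite divr_gt0.
  (* For [gamma = 0] the factor [l^(-gamma)] gives no decay, so another comparison is made, with the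
     constant 0: [|h|] is at most [S + w] on a fixed ball containing the supports of the first [m]
     pieces, and at most the small [w] off it. On a large cube the ball is negligible. *)
  have [m mP] := @geometric_small R theta (2 ^+ n.+1 * (B / (1 - theta))) (e / 2) theta01
    (mulr_ge0 (ltW two_gt0) (divr_ge0 B0 (ltW t1_gt0))) e20.
  pose r := 1 + \sum_(j < m) `|rr j|.
  have r0 : 0 < r by rewrite ltr_pwDl// sumr_ge0.
  pose S := B / (1 - theta).
  have S0 : 0 <= S by rewrite /S divr_ge0// ltW.
  pose w := B * theta ^+ m / (1 - theta).
  have w0 : 0 <= w by apply: divr_ge0; [apply: mulr_ge0 => //; exact: exprn_ge0|exact: ltW].
  pose A := 2 * (S * (2 * r) ^+ n).
  have A0 : 0 <= A.
    by rewrite /A; apply: mulr_ge0 => //; apply: mulr_ge0 => //; apply: exprn_ge0; rewrite mulr_ge0// ltW.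
  have hae : {ae mu, forall x : Rn R n,
      `|h x| <= S * \1_(eball (0 : V) r) x + w}.
    apply: filterS2 (sums_to_bounded 0 GB Gh) (sums_to_bounded m GB Gh) => x h0 hm.
    have [xr|xr] := ltP (enorm (x : V)) r.
      rewrite indicE mem_set ?mulr1; last by rewrite /eball/= subr0.
      by apply: (le_trans h0); rewrite big_ord0 add0r expr0 mulr1 lerDl.
    rewrite indicE memNset ?mulr0 ?add0r; last by rewrite /eball/= subr0; apply/negP; rewrite -leNgt.
    apply: (le_trans hm); rewrite big1 ?add0r// => j _; rewrite Gr ?normr0//.
    apply: le_trans xr; apply: (le_trans (ler_norm _)).
    by rewrite /r (bigD1 j)//= addrCA lerDl addr_ge0// sumr_ge0.
  near=> a; apply: ge_ereal_sup => _ [c _ [l /= al <-]].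
  have a1 : 1 <= a by near: a; apply: nbhs_pinfty_ge; exact: num_real.
  have aA : A / (e / 2) <= a by near: a; apply: nbhs_pinfty_ge; exact: num_real.
  have l1 : 1 <= l by exact: le_trans al.
  have l0 : 0 < l by lra.
  have mQ := @measurable_cube R n c l.
  apply: (le_trans (oscillation_le_integral n_gt0 hgamma 0 l0 mh (locally_integrable_cube c lh l0))).
  have h1 : (\int[mu]_(x in cube c l) `|h x - 0|%:E <=
      (S * (2 * r) ^+ n + w * (2 * l) ^+ n)%:E)%E.
    have H := ae_integral_le_affine mQ (measurable_dist_cst 0 mh)
      (measurable_indic_eball (0 : V) r) (fun=> normr_ge0 _) (fun=> ler0n R _) (lebesgue_cube_le c l0) S0 w0.
    apply: le_trans (H _) _; first by apply: filterS hae => x hx _; rewrite subr0.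
    rewrite (EFinD (S * _)) (EFinM S); apply: leeD => //; apply: lee_wpmul2l; first by rewrite lee_fin.
    rewrite integral_indic//; last exact: measurable_eball.
    apply: le_trans (lebesgue_eball_le (0 : V) r0).
    apply: le_measure; rewrite ?inE; [apply: measurableI| |]; rewrite //; exact: measurable_eball.
  apply: (le_trans (lee_wpmul2l _ h1)).
    by rewrite lee_fin; apply: mulr_ge0 => //; exact: powR_ge0.
  rewrite -EFinM lee_fin mulrDr; rewrite [e]splitr.
  have lnl : l `^ (- n%:R - gamma) * l ^+ n <= 1.
    rewrite -powR_mulrn ?(ltW l0)// -powRpD// -(powRr0 l); apply: ler_powR => //; lra.
  apply: lerD.
    have lA : l `^ (- n%:R - gamma) <= l^-1.
      rewrite -(powR_inv1 (ltW l0)); apply: ler_powR => //.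
      have : 1 <= n%:R :> R by rewrite ler1n.
      lra.
    rewrite (_ : 2 * _ * _ = A * l `^ (- n%:R - gamma)); last by rewrite /A mulrAC.
    apply: (@le_trans _ _ (A * l^-1)); first exact: ler_wpM2l.
    rewrite ler_pdivrMr// mulrC -ler_pdivrMr//; exact: le_trans al.
  apply: le_trans mP.
  have -> : 2 * l `^ (- n%:R - gamma) * (w * (2 * l) ^+ n) =
     (l `^ (- n%:R - gamma) * l ^+ n) * (2 ^+ n.+1 * (B / (1 - theta)) * theta ^+ m).
    rewrite /w exprMn exprS.
    ring_powR.
  apply: ler_piMl => //; apply: mulr_ge0; last exact: exprn_ge0.
  by apply: mulr_ge0; [exact: ltW|].
Unshelve. all: by end_near. Qed.

End cmo_target.


(** * Precompactness of sums in CMO *)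

Section cmo_precompactness.
Context (R : realType) (n : nat).
Hypothesis n_gt0 : (0 < n)%N.
Local Notation V := 'rV[R]_n.
Local Notation mu := (lebesgue_Rn R n).
Context (gamma theta B : R).
Hypothesis hgamma : 0 <= gamma < 1.
Hypothesis theta01 : 0 < theta < 1.
Context (M L rr : nat -> R) (K : set (nat * V -> R)).
Hypothesis K_lip : K `<=` equilipschitz M L rr.
Hypothesis K_decay : K `<=` holder_decay gamma theta B.

Lemma unif_closure_decay : unif_closure M L rr K `<=` holder_decay gamma theta B.
Proof.
move=> G [_ KG]; split => [j x|j x y]; apply/ler_addgt0Pr => e e0.
  have [H /K_decay[HB _] GH] := KG j.+1 e e0.
  rewrite -(subrK (H (j, x)) (G (j, x))) addrC; apply: (le_trans (ler_normD _ _)).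
  by apply: lerD; [exact: HB|exact: GH].
have e20 : 0 < e / 2 by rewrite divr_gt0.
have [H /K_decay[_ HB] GH] := KG j.+1 (e / 2) e20.
have -> : G (j, x) - G (j, y) = (H (j, x) - H (j, y)) +
    ((G (j, x) - H (j, x)) - (G (j, y) - H (j, y))).
  by move: (G _) (G _) (H _) (H _) => z1 z2 z3 z4; ring.
apply: (le_trans (ler_normD _ _)); apply: lerD; first exact: HB.
apply: (le_trans (ler_normB _ _)).
rewrite [e]splitr.
by apply: lerD; exact: GH.
Qed.

Lemma cmo_sums_exist G : unif_closure M L rr K G ->
  exists2 h, CMO gamma h & sums_to G h.
Proof.
move=> KG; have GB := unif_closure_decay KG.
have [h mh Gh] := @measurable_sums_to R n G (fun j => equilipschitz_measurable j KG.1)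
  (aeW mu (fun x => holder_decay_cvg theta01 GB (x := x))).
by exists h => //; exact: (sums_to_CMO n_gt0 hgamma theta01 KG.1 GB mh Gh).
Qed.

(** Uniform closeness of the first [m] pieces does not suffice when [gamma > 0], as oscillations on
    small cubes are divided by [l^gamma]. Interpolating it with their fixed Lipschitz constants
    gives [de^(1 - gamma) (n l)^gamma], which is small after normalisation, uniformly in [l]. *)
Lemma cmo_sums_continuous G : unif_closure M L rr K G ->
  forall e : R, 0 < e -> exists m, exists2 de : R, 0 < de &
  forall G' h h', unif_closure M L rr K G' -> unif_close m de G G' ->
    CMO gamma h -> CMO gamma h' -> sums_to G h -> sums_to G' h' ->
    (BMO_norm gamma (fun x => (h' x - h x)%R) < e%:E)%E.
Proof.
move=> KG e e0; have GB := unif_closure_decay KG.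
have B0 := holder_decay_ge0 GB; have /andP[g0 g1] := hgamma.
have /andP[th0 th1] := theta01.
have e40 : 0 < e / 4 by rewrite divr_gt0.
have two0 : 0 < 2 ^+ n.+1 :> R by rewrite exprn_gt0.
have A0 : 0 <= 2 ^+ n.+1 * ((B + B) * n%:R `^ gamma / (1 - theta)).
  apply: mulr_ge0; first exact: ltW.
  by apply: divr_ge0; [apply: mulr_ge0; [exact: addr_ge0|exact: powR_ge0]|rewrite subr_ge0 ltW].
have [m mP] := geometric_small theta01 A0 e40.
(* Each summand dominates the constants of both bounds to be interpolated: 2 for the sup bound and
   [2 |L j|] for the Lipschitz bound. *)
pose lip := \sum_(j < m) (2 + 2 * `|L j|).
have lip0 : 0 <= lip.
  by apply: sumr_ge0 => j _; apply: addr_ge0 => //; exact: mulr_ge0.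
have D0 : 0 <= 2 ^+ n.+1 * (lip * n%:R `^ gamma).
  by apply: mulr_ge0; [exact: ltW|apply: mulr_ge0 => //; exact: powR_ge0].
have g10 : 0 < 1 - gamma by rewrite subr_gt0.
have [de de0 deP] := powR_small D0 g10 e40.
exists m, de => // G' h h' KG' GG' Ch Ch' Gh Gh'.
have [[[mh _] _] _ _ _] := Ch; have [[[mh' _] _] _ _ _] := Ch'.
have GB' := unif_closure_decay KG'.
pose U (jx : nat * V) := G' jx - G jx.
have UE j x y : U (j, x) - U (j, y) = (G' (j, x) - G' (j, y)) - (G (j, x) - G (j, y)).
  by rewrite /U; move: (G _) (G _) (G' _) (G' _) => z1 z2 z3 z4; ring.
have UB : holder_decay gamma theta (B + B) U.
  split => [j x|j x y].
    by rewrite mulrDl; apply: (le_trans (ler_normB _ _)); apply: lerD; [exact: GB'.1|exact: GB.1].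
  rewrite UE !mulrDl.
  by apply: (le_trans (ler_normB _ _)); apply: lerD; [exact: GB'.2|exact: GB.2].
apply: (@le_lt_trans _ _ (e / 2)%:E); last by rewrite lte_fin; lra.
apply: ge_ereal_sup => _ [c _ [l /= l0 <-]].
have nl0 : 0 <= n%:R * l by rewrite mulr_ge0// ltW.
have Hb x : cube c l x -> \sum_(j < m) `|U (nat_of_ord j, x) - U (nat_of_ord j, c)| <=
    lip * (de `^ (1 - gamma) * (n%:R * l) `^ gamma).
  move=> xc; rewrite mulr_suml; apply: ler_sum => j _.
  have C0 : 0 <= 2 + 2 * `|L j| by apply: addr_ge0 => //; exact: mulr_ge0.
  have L0 : 0 <= 2 * `|L j| by exact: mulr_ge0.
  apply: holder_interpolation => //; first exact: ltW.
    apply: (le_trans (ler_normB _ _)); apply: (@le_trans _ _ (de + de)).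
      by apply: lerD; rewrite /U distrC; exact: GG'.
    have := mulr_ge0 L0 (ltW de0); lra.
  apply: (@le_trans _ _ (2 * `|L j| * (n%:R * l))); last by apply: ler_wpM2r => //; lra.
  rewrite UE.
  apply: (le_trans (ler_normB _ _)).
  have := lerD (equilipschitz_cube j KG'.1 l0 xc) (equilipschitz_cube j KG.1 l0 xc); lra.
have := sums_to_oscillation n_gt0 hgamma theta01 l0 UB (measurable_funB mh' mh) (sums_toB Gh Gh') Hb.
move/le_trans; apply; rewrite lee_fin mulrDr.
have -> : e / 2 = e / 4 + e / 4 by field.
apply: lerD; last first.
  apply: le_trans mP; apply: ler_eq; ring_powR.
apply: le_trans (deP de (ltW de0) (lexx _)).
rewrite powRM ?(ltW l0)//.
have -> : l `^ (- gamma) * (lip * (de `^ (1 - gamma) * (n%:R `^ gamma * l `^ gamma))) =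
   (l `^ (- gamma) * l `^ gamma) * (lip * n%:R `^ gamma * de `^ (1 - gamma)).
  ring_powR.
have -> : l `^ (- gamma) * l `^ gamma = 1 by rewrite -powRpD// addNr powRr0.
by rewrite mul1r !mulrA.
Qed.

Lemma cmo_precompact (A : set (V -> R)) :
  (forall h, A h -> exists2 G, K G & sums_to G h) ->
  precompact [set g : seminormed (CMO gamma) (BMO_norm gamma) | A (sval g)].
Proof.
move=> AK; apply: (@precompact_of_sums R n (CMO gamma) (BMO_norm gamma) M L rr K A
  (@sums_to R n)).
- exact: BMO_norm0.
- by move=> f g [[lf _] _ _ _] [[lg _] _ _ _]; exact: BMO_normBC.
- move=> e e0; have [de de0 H] := @BMO_norm_quasi_triangle R n gamma e e0.
  exists de => // f g h [[lf _] _ _ _] [[lg _] _ _ _] [[lh _] _ _ _].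
  exact: H.
- exact: K_lip.
- exact: AK.
- exact: cmo_sums_exist.
- exact: cmo_sums_continuous.
Qed.

End cmo_precompactness.


(** * Convergence of Riesz potentials forces [alpha < n / p] *)

Section diverging_riesz_integral.
Context (R : realType).

(** The integral comparison for [u^(-s-1)], obtained from [ln (1 - u) <= - u] at [u = 1/(x+1)] and
    from [exp z >= 1 + z]. *)
Lemma powR_telescope_ge (s x : R) : 0 < s -> 0 < x ->
  s * (x + 1) `^ (- s - 1) <= x `^ (- s) - (x + 1) `^ (- s).
Proof.
move=> s0 x0; have y0 : 0 < x + 1 by lra.
have lnx : ln x <= ln (x + 1) - (x + 1)^-1.
  have h1 : 0 < 1 - (x + 1)^-1 by rewrite subr_gt0 invf_lt1//; lra.
  have xE : (x + 1) * (1 - (x + 1)^-1) = x.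
    by rewrite mulrBr mulr1 mulfV ?lt0r_neq0// addrK.
  have -> : ln x = ln (x + 1) + ln (1 - (x + 1)^-1) by rewrite -lnM ?posrE// xE.
  rewrite lerD2l; apply: le_ln1Dx.
  by rewrite ltrN2 invf_lt1//; lra.
have -> : x `^ (- s) = expR (- s * ln x) by rewrite /powR gt_eqF.
have yE : (x + 1) `^ (- s) = expR (- s * ln (x + 1)) by rewrite /powR gt_eqF.
have -> : (x + 1) `^ (- s - 1) = (x + 1) `^ (- s) * (x + 1)^-1.
  by rewrite powRpD// powR_inv1// ltW.
rewrite yE lerBrDr.
apply: (@le_trans _ _ (expR (- s * ln (x + 1)) * expR (s * (x + 1)^-1))); last first.
  rewrite -expRD ler_expR.
  have : s * ln x <= s * (ln (x + 1) - (x + 1)^-1) by apply: ler_wpM2l => //; exact: ltW.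
  lra.
have := expR_ge1Dx (s * (x + 1)^-1); have := expR_gt0 (- s * ln (x + 1)).
set E := expR (- s * ln (x + 1)); set F := expR _; set z := (x + 1)^-1.
move=> E0 /(ler_wpM2l (ltW E0)); lra.
Qed.

Lemma sum_powR_bounded (p : R) m : 1 < p ->
  \sum_(k < m) (k.+1%:R) `^ (- p) <= 1 + (p - 1)^-1.
Proof.
move=> p1; have s0 : 0 < p - 1 by rewrite subr_gt0.
(* The telescoping remainder is kept in the bound so that the induction closes. *)
suff H : \sum_(k < m) (k.+1%:R) `^ (- p) <= 1 + (p - 1)^-1 * (1 - (maxn m 1)%:R `^ (1 - p)).
  apply: (le_trans H); rewrite lerD2l -[leRHS]mulr1; apply: ler_wpM2l.
    by rewrite invr_ge0 ltW.
  by rewrite lerBlDr lerDl powR_ge0.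
elim: m => [|m IHm].
  by rewrite big_ord0 powR1 subrr mulr0 addr0.
case: m IHm => [_|m IHm].
  by rewrite big_ord_recr big_ord0/= !powR1 subrr mulr0 addr0 add0r.
rewrite big_ord_recr/=; apply: (le_trans (lerD IHm (lexx _))).
rewrite !(maxn_idPl _)// -addrA lerD2l.
have := @powR_telescope_ge (p - 1) m.+1%:R s0 (ltr0Sn _ _).
rewrite natr1 (_ : - (p - 1) - 1 = - p); last by ring.
rewrite (_ : - (p - 1) = 1 - p); last by ring.
set X := _ `^ (1 - p); set Y := _ `^ (1 - p); set Z := _ `^ (- p) => h.
have {}h : Z <= (p - 1)^-1 * (X - Y) by rewrite mulrC ler_pdivlMr// mulrC.
apply: (le_trans (lerD (lexx _) h)); rewrite -mulrDr; apply: ler_wpM2l; first by rewrite invr_ge0 ltW.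
lra.
Qed.

Lemma sum_harmonic_unbounded (c : R) : exists m, c < \sum_(k < m) (k.+1%:R)^-1.
Proof.
apply: contrapT => /forallNP H; apply: (@dvg_harmonic R).
apply: nondecreasing_is_cvgn.
  by apply: nondecreasing_series => k _ _; exact: harmonic_ge0.
exists c => _ [m _ <-]; rewrite /series/= big_mkord.
by have /negP := H m; rewrite -leNgt.
Qed.

Context (n : nat).
Hypothesis n_gt0 : (0 < n)%N.
Local Notation V := 'rV[R]_n.
Local Notation mu := (lebesgue_Rn R n).
Context (alpha p q : R).
Hypothesis halpha : 0 < alpha < n%:R.
Hypothesis hq : 1 < q.
Hypothesis hqp : q <= p.

Let p_gt0 : 0 < p. Proof. by have := hq; have := hqp; lra. Qed.

Let e1 : V := delta_mx ord0 (Ordinal n_gt0).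

Let enorm_e1 (a : R) : enorm (a *: e1) = `|a|.
Proof.
rewrite /enorm (bigD1 (Ordinal n_gt0))//= big1; last first.
  by move=> i ni; rewrite !mxE eqxx (negbTE ni) mulr0 expr0n.
by rewrite !mxE !eqxx mulr1 addr0 sqrtr_sqr.
Qed.

(* Disjoint balls, since [2 * 2 ^+ k < enorm y < 4 * 2 ^+ k] on the k-th one. *)
Let D (k : nat) : set (Rn R n) := eball ((3 * 2 ^+ k) *: e1) (2 ^+ k).

Let two0 k : 0 < 2 ^+ k :> R. Proof. by rewrite exprn_gt0. Qed.

Let mD k : measurable (D k). Proof. exact: measurable_eball. Qed.

Let mD_cst (u : nat -> R) k :
  measRn (fun y => (u k * \1_(D k) y)%:E).
Proof.
apply/measurable_EFinP; apply: measurable_funM; first exact: measurable_cst.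
exact: measurable_indic.
Qed.

Let integral_D_cst (u : nat -> R) k : 0 <= u k ->
  (\int[mu]_y (u k * \1_(D k) y)%:E = (u k)%:E * mu (D k))%E.
Proof.
move=> u0; under eq_integral do rewrite EFinM.
rewrite ge0_integralZl; [|exact: measurableT| | |]; last 3 first.
- by apply/measurable_EFinP; exact: measurable_indic.
- by move=> y _; rewrite lee_fin.
- by rewrite lee_fin.
by rewrite integral_indic// ?setIT.
Qed.

Let D_enorm k y : D k y -> 2 * 2 ^+ k < enorm (y : V) < 4 * 2 ^+ k.
Proof.
rewrite /D/eball/= => yk.
have cE : enorm ((3 * 2 ^+ k) *: e1) = 3 * 2 ^+ k.
  by rewrite enorm_e1 ger0_norm// mulr_ge0// ltW.
have := enorm_lipschitz (y : V) ((3 * 2 ^+ k) *: e1); rewrite cE.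
move=> /le_lt_trans/(_ yk); rewrite ltr_norml => /andP[h1 h2].
by apply/andP; split; have := two0 k; lra.
Qed.

Let D_disjoint j k y : D j y -> D k y -> j = k.
Proof.
move=> /D_enorm/andP[j1 j2] /D_enorm/andP[k1 k2].
have lt_imp a c : (a < c)%N -> 2 * 2 ^+ a <= 2 ^+ c :> R.
  by move=> ac; rewrite -exprS ler_eXn2l// ltr1n.
by case: (ltngtP j k) => [/lt_imp h|/lt_imp h|//]; exfalso; lra.
Qed.

Let series_at (u : nat -> R) k y : (forall j, 0 <= u j) -> D k y ->
  (\sum_(j <oo) (u j * \1_(D j) y)%:E = (u k)%:E)%E.
Proof.
move=> u0 Dk.
have t0 j : (0 <= (u j * \1_(D j) y)%:E)%E by rewrite lee_fin mulr_ge0.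
have tk : u k * \1_(D k) y = u k by rewrite indicE mem_set// mulr1.
have tj j : j != k -> u j * \1_(D j) y = 0.
  by move=> jk; rewrite indicE memNset ?mulr0// => /D_disjoint/(_ Dk)/eqP; rewrite (negbTE jk).
apply/eqP; rewrite eq_le; apply/andP; split.
  apply: nneseries_le_sup => // m; rewrite sumEFin lee_fin.
  have [km|mk] := ltnP k m.
    by rewrite (bigD1 (Ordinal km))//= tk big1 ?addr0// => j jk; rewrite tj.
  by rewrite big1// => j _; rewrite tj//; apply: contraTneq mk => <-; rewrite -ltnNge.
have := @nneseries_lim_ge R (fun j => (u j * \1_(D j) y)%:E) xpredT 0 k.+1 (fun j _ _ => t0 j).
apply: le_trans; rewrite big_mkord sumEFin lee_fin big_ord_recr/= tk lerDr.
by apply: sumr_ge0 => j _; rewrite mulr_ge0.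
Qed.

(* The resulting function is in L^p as p > 1, but when n/p <= alpha its Riesz potential
   dominates a harmonic series. *)
Let coef (k : nat) : R := (2 ^+ k) `^ (- (n%:R / p)) * (k.+1%:R)^-1.

Let coef_ge0 k : 0 <= coef k.
Proof. by rewrite mulr_ge0 ?powR_ge0. Qed.

Let f (y : V) : R := fine (\sum_(j <oo) (coef j * \1_(D j) (y : Rn R n))%:E)%E.

Let f_at k y : D k y -> f y = coef k.
Proof. by move=> Dk; rewrite /f (series_at coef_ge0 Dk). Qed.

Let f_out y : (forall k, ~ D k y) -> f y = 0.
Proof.
move=> nD; rewrite /f eseries0// => j _ _.
by rewrite indicE memNset ?mulr0.
Qed.

Let mf : measRn f.
Proof.
apply: (measurableT_comp (@fine_measurable R setT measurableT)).
by apply: ge0_emeasurable_sum => // j y _ _; rewrite lee_fin mulr_ge0.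
Qed.

Let f_Lp : (\int[mu]_y (`|f y| `^ p)%:E <= (2 ^+ n * (1 + (p - 1)^-1))%:E)%E.
Proof.
have cp0 j : 0 <= (coef j) `^ p by exact: powR_ge0.
apply: (@le_trans _ _ (\int[mu]_y \sum_(j <oo) ((coef j) `^ p * \1_(D j) y)%:E)%E).
  apply: ge0_le_integral; first exact: measurableT.
  - by move=> y _; rewrite lee_fin powR_ge0.
  - exact: measurable_powR_norm.
  - by apply: ge0_emeasurable_sum => [j y _ _|j _]; [rewrite lee_fin mulr_ge0|exact: (mD_cst (fun j => coef j `^ p))].
  - move=> y _; have [[k Dk]|nD] := pselect (exists k, D k y).
      by rewrite (series_at cp0 Dk) (f_at Dk) ger0_norm.
    rewrite f_out ?normr0 ?powR0 ?lt0r_neq0//; last by apply/forallNP.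
    by apply: nneseries_ge0 => j _ _; rewrite lee_fin mulr_ge0.
rewrite integral_nneseries; [|exact: measurableT| |]; last 2 first.
- exact: (mD_cst (fun j => coef j `^ p)).
- by move=> j y _; rewrite lee_fin mulr_ge0.
apply: nneseries_le_sup => [j|m]; first by apply: integral_ge0 => y _; rewrite lee_fin mulr_ge0.
apply: (@le_trans _ _ (\sum_(j < m) (2 ^+ n * (j.+1%:R) `^ (- p))%:E)%E).
  apply: lee_sum => j _; rewrite (integral_D_cst (u := fun j => coef j `^ p))//.
  apply: (le_trans (lee_wpmul2l _ (lebesgue_eball_le _ (two0 j)))); first by rewrite lee_fin.
  rewrite -EFinM lee_fin; apply: ler_eq.
  rewrite /coef powRM ?powR_ge0// -powRrM.
  have -> : - (n%:R / p) * p = - n%:R by field; rewrite lt0r_neq0.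
  rewrite exprMn -(powR_mulrn n (ltW (two0 j))).
  have -> : ((j.+1%:R)^-1) `^ p = (j.+1%:R : R) `^ (- p) by rewrite powRpV.
  by rewrite (mulrC (2 ^+ n)) mulrACA -powRpD// addNr powRr0 mul1r mulrC.
rewrite sumEFin lee_fin -mulr_sumr; apply: ler_wpM2l; first exact: exprn_ge0.
by apply: sum_powR_bounded; have := hq; have := hqp; lra.
Qed.

(** [L^p] is the Morrey space with equal exponents, where the growth exponent is 0; lowering the
    exponent from [p] to [q] gives the claim. *)
Let f_morrey : morrey p q f.
Proof.
have q0 : 0 < q by have := hq; lra.
pose I := 2 ^+ n * (1 + (p - 1)^-1).
split => //.
have fp : ball_growth p (n%:R - n%:R * p / p) I f.
  move=> x r r0; rewrite mulfK ?lt0r_neq0// subrr powRr0 mulr1; apply: le_trans f_Lp.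
  apply: ge0_subset_integral; [exact: measurable_eball|exact: measurableT| | |exact: subsetT].
  - exact: measurable_powR_norm.
  - by move=> y _; rewrite lee_fin powR_ge0.
exact: (le_lt_trans (growth_morrey_norm n_gt0 q0 hqp (ball_growth_lower mf q0 hqp p_gt0 fp)) (ltry _)).
Qed.

(** Once [2^k >= |x|], every [y] in [D k] satisfies [|x - y| <= 5 2^k], so [D k] contributes at
    least [c 2^(k (alpha - n/p)) / (k+1) >= c / (k+1)]. Only finitely many harmonic terms, those
    with [k < k0], are discarded. *)
Let f_diverges x : n%:R / p <= alpha ->
  ~ mu.-integrable [set: Rn R n] (fun y => (riesz_integrand alpha f x y)%:E).
Proof.
move=> pa /integrableP[mF Ffin].
have /andP[a0 an] := halpha.
pose lam := n%:R - alpha; have lam0 : 0 < lam by rewrite subr_gt0.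
have [k0 xk0] : exists k0, enorm x <= 2 ^+ k0.
  have half01 : 0 < (2^-1 : R) < 1 by apply/andP; split; lra.
  have [k0 h] := geometric_small half01 (enorm_ge0 x) ltr01.
  by exists k0; move: h; rewrite exprVn ler_pdivrMr ?mul1r.
pose c := 5 `^ (- lam) * (n%:R^-1) ^+ n.
have c0 : 0 < c.
  by rewrite mulr_gt0 ?powR_gt0// exprn_gt0// invr_gt0 ltr0n.
pose v (k : nat) : R := if (k0 <= k)%N then coef k * (5 * 2 ^+ k) `^ (- lam) else 0.
have v0 k : 0 <= v k.
  by rewrite /v; case: ifP => // _; apply: mulr_ge0 => //; exact: powR_ge0.
have F_ge y m : ((\sum_(k < m) v k * \1_(D k) y)%:E <= `|(riesz_integrand alpha f x y)%:E|)%E.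
  rewrite abse_EFin lee_fin.
  have [[k Dk]|nD] := pselect (exists k, D k y); last first.
    rewrite big1// => j _; rewrite indicE memNset ?mulr0// => Dj.
    by apply: nD; exists (nat_of_ord j).
  have sum_le : \sum_(j < m) v j * \1_(D j) y <= v k.
    rewrite -lee_fin -sumEFin -(series_at v0 Dk).
    have := @nneseries_lim_ge R (fun j => (v j * \1_(D j) y)%:E) xpredT 0 m.
    rewrite big_mkord; apply => j _ _; by rewrite lee_fin mulr_ge0.
  apply: (le_trans sum_le); rewrite /v; case: ifP => // kk.
  rewrite /riesz_integrand (f_at Dk) normrM (ger0_norm (coef_ge0 k)).
  rewrite ger0_norm ?invr_ge0 ?powR_ge0//; apply: ler_wpM2l => //.
  have /andP[y1 y2] := D_enorm Dk.
  have xk : enorm x <= 2 ^+ k.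
    by apply: (le_trans xk0); rewrite ler_eXn2l// ltr1n.
  have xy1 : enorm (x - (y : V)) <= 5 * 2 ^+ k.
    have := enormD x (- (y : V)); rewrite enormN; lra.
  have xy0 : 0 < enorm (x - (y : V)).
    have := enorm_lipschitz (y : V) x; rewrite (enormBC y) => /ler_normlP[_].
    by have := two0 k; lra.
  rewrite -powRN; apply: powR_le_neg => //.
  by rewrite oppr_le0 ltW.
have int_ge m : ((c * \sum_(k < m | (k0 <= k)%N) (k.+1%:R)^-1)%:E <=
    \int[mu]_y `|(riesz_integrand alpha f x y)%:E|)%E.
  apply: (@le_trans _ _ (\int[mu]_y (\sum_(k < m) (v k * \1_(D k) y)%:E))%E); last first.
    apply: ge0_le_integral; first exact: measurableT.
    - by move=> y _; apply: sume_ge0 => j _; rewrite lee_fin mulr_ge0.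
    - by apply: emeasurable_sum => j; exact: mD_cst.
    - by apply: measurableT_comp; [exact: abse_measurable|exact: mF].
    - by move=> y _; rewrite sumEFin; exact: F_ge.
  rewrite ge0_integral_sum; [|exact: measurableT| |]; last 2 first.
  - by move=> j; exact: mD_cst.
  - by move=> j y _; rewrite lee_fin mulr_ge0.
  rewrite mulr_sumr -sumEFin big_mkcond/=; apply: lee_sum => k _.
  rewrite integral_D_cst//.
  case: ifP => kk; last by apply: mule_ge0; [rewrite lee_fin|].
  have vk : v k = coef k * (5 * 2 ^+ k) `^ (- lam) by rewrite /v kk.
  rewrite vk.
  apply: (@le_trans _ _ ((coef k * (5 * 2 ^+ k) `^ (- lam))%:E * ((2 ^+ k / n%:R) ^+ n)%:E)%E); last first.
    apply: lee_wpmul2l; first by rewrite lee_fin -vk.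
    exact: lebesgue_eball_ge.
  rewrite -EFinM lee_fin /coef powRM ?(ltW (two0 k))// exprMn -(powR_mulrn n (ltW (two0 k))).
  have -> : (2 ^+ k) `^ (- (n%:R / p)) * (k.+1%:R)^-1 *
      (5 `^ (- lam) * (2 ^+ k) `^ (- lam)) * ((2 ^+ k) `^ n%:R * n%:R^-1 ^+ n) =
    c * (k.+1%:R)^-1 * ((2 ^+ k) `^ (- (n%:R / p)) * (2 ^+ k) `^ (- lam) * (2 ^+ k) `^ n%:R).
    rewrite /c.
    ring_powR.
  rewrite ler_peMr//; first by rewrite mulr_ge0 ?(ltW c0).
  rewrite -!powRpD// -[leLHS](powRr0 (2 ^+ k)); apply: ler_powR; first exact: double_pow_ge1.
  by rewrite /lam; lra.
pose I := fine (\int[mu]_y `|(riesz_integrand alpha f x y)%:E|)%E.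
have [m mI] := sum_harmonic_unbounded (I / c + \sum_(k < k0) (k.+1%:R)^-1).
have IE : (\int[mu]_y `|(riesz_integrand alpha f x y)%:E| = I%:E)%E.
  by rewrite fineK// ge0_fin_numE//; apply: integral_ge0 => y _; exact: abse_ge0.
have := int_ge m; rewrite IE lee_fin leNgt => /negP; apply.
rewrite -ltr_pdivrMl// mulrC.
have split_sum : \sum_(k < m) (k.+1%:R)^-1 <=
    \sum_(k < m | (k0 <= k)%N) (k.+1%:R)^-1 + \sum_(k < k0) (k.+1%:R)^-1 :> R.
  rewrite (bigID (fun k : 'I_m => (k0 <= k)%N))/= lerD2l.
  have [mk|km] := leqP m k0.
    rewrite -(subnKC mk) big_split_ord/=; apply: ler_wpDr; first by apply: sumr_ge0.
    by rewrite [leLHS]big_mkcond/=; apply: ler_sum => i _; case: ifP.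
  rewrite (big_ord_widen_cond m xpredT (fun k => (k.+1%:R)^-1)) ?(ltnW km)//=.
  by apply: ler_eq; apply: eq_bigl => i; rewrite -ltnNge.
by move: mI split_sum; move: (\sum_(_ < m | _) _) (\sum_(_ < m) _) (\sum_(_ < k0) _) => z1 z2 z3; lra.
Qed.

(** Otherwise the exceptional null set would contain the unit ball. The inequality says [sigma > 0],
    which makes large shells decay. *)
Lemma riesz_well_defined_lt : @riesz_well_defined R n alpha p q -> alpha < n%:R / p.
Proof.
move=> hwd; rewrite ltNge; apply/negP => pa.
have [N [mN N0 /= fN]] := hwd f f_morrey.
have : (mu (eball (0 : V) 1) <= mu N)%E.
  apply: le_measure; rewrite ?inE; [exact: measurable_eball|exact: mN|].
  by move=> x _; apply: fN => /= /(f_diverges pa).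
rewrite N0; apply/negP; rewrite -ltNge.
apply: lt_le_trans (lebesgue_eball_ge (0 : V) ltr01 n_gt0).
by rewrite lte_fin exprn_gt0// divr_gt0// ltr0n.
Qed.

End diverging_riesz_integral.


(** * Compactness of the commutator *)

Lemma dyadic_ratio_powR (R : realType) (delta e : R) j : 0 < e ->
  (((2 `^ (- (delta / (2 * e)))) ^+ j) `^ e) ^+ 2 = (2 `^ (- delta)) ^+ j.
Proof.
move=> e0; have P (x : R) k : (2 `^ x) ^+ k = 2 `^ (x * k%:R).
  by rewrite powRrM powR_mulrn// powR_ge0.
rewrite P -powRrM P P; congr (_ `^ _).
by field; rewrite lt0r_neq0.
Qed.

Section commutator_compactness.
Context (R : realType) (n : nat) (alpha p q : R) (b : 'rV[R]_n -> R).
Local Notation V := 'rV[R]_n.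
Local Notation mu := (lebesgue_Rn R n).
Hypothesis halpha : 0 < alpha < n%:R.
Hypothesis hq : 1 < q.
Hypothesis hqp : q <= p.
Hypothesis hwd : @riesz_well_defined R n alpha p q.
Context (Mb Lb Rb : R).
Hypothesis b_cont : continuous b.
Hypothesis b_bnd : forall x, `|b x| <= Mb.
Hypothesis b_lip : forall x y, `|b x - b y| <= Lb * enorm (x - y).
Hypothesis Lb_ge0 : 0 <= Lb.
Hypothesis b_supp : forall x, Rb <= enorm x -> b x = 0.
Hypothesis Rb_gt0 : 0 < Rb.

Local Notation d := (n%:R - n%:R * q / p).
Local Notation d1 := (n%:R - n%:R / p).
Local Notation sigma := (n%:R / p - alpha).
Local Notation T := (commutator alpha b).
Local Notation piece := (commutator_piece alpha b).

Let n_gt0 : (0 < n)%N.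
Proof. by have /andP[a0 an] := halpha; rewrite -(ltr0n R); exact: lt_trans an. Qed.

Let q_gt0 : 0 < q. Proof. by have := hq; lra. Qed.
Let p_gt0 : 0 < p. Proof. exact: lt_le_trans hqp. Qed.

Let sigma_gt0 : 0 < sigma.
Proof. by rewrite subr_gt0; exact: (riesz_well_defined_lt n_gt0 halpha hq hqp hwd). Qed.

Let KA (A : R) := A `^ q * 2 `^ d.

Let morrey_fin (f : V -> R) : morrey p q f -> exists2 A : R, 0 <= A & (morrey_norm p q f <= A%:E)%E.
Proof.
move=> [_]; have : (0 <= morrey_norm p q f)%E by exact: morrey_norm_ge0.
case: (morrey_norm p q f) => [A| |]// A0 _.
by exists A.
Qed.

Let growth (f : V -> R) A : 0 <= A -> (morrey_norm p q f <= A%:E)%E ->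
  ball_growth q d (KA A) f.
Proof. exact: (morrey_norm_growth n_gt0 q_gt0 hqp). Qed.

Lemma commutator_sums_to f : morrey p q f -> sums_to (piece f) (T f).
Proof.
move=> Xf; have [A A0 fA] := morrey_fin Xf; have [mf _] := Xf.
apply: filterS (hwd Xf) => x ifx.
exact: (commutator_piece_sum_cvg halpha hq hqp b_cont b_bnd b_lip Lb_ge0 mf (growth A0 fA) ifx).
Qed.

Lemma measurable_commutator_morrey f : morrey p q f ->
  measRn (T f).
Proof.
move=> [mf _]; apply: measurable_commutator; last exact: mf.
exact: continuous_measurable_Rn.
Qed.

Let sup_bound A := piece_sup_bound n alpha p Mb Lb (KA A).
Let radius (j : nat) : R := Rb + 2 * 2 ^+ j.

Lemma commutator_piece_lip f A : morrey p q f -> 0 <= A ->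
  (morrey_norm p q f <= A%:E)%E ->
  equilipschitz (sup_bound A) (sup_bound A) radius (piece f).
Proof.
move=> [mf _] A0 fA.
exact: (commutator_piece_equilipschitz halpha hq hqp b_cont b_bnd b_lip Lb_ge0 b_supp mf
  (growth A0 fA)).
Qed.

Let unit_pieces : set (nat * V -> R) :=
  [set G | exists f, [/\ morrey p q f, (morrey_norm p q f <= 1)%E & G = piece f]].

Let unit_pieces_lip : unit_pieces `<=` equilipschitz (sup_bound 1) (sup_bound 1) radius.
Proof. by move=> _ [f [Xf f1 ->]]; exact: commutator_piece_lip. Qed.

Let unit_sums (h : V -> R) :
  (exists f, [/\ morrey p q f, (morrey_norm p q f <= 1)%E & h = T f]) ->
  exists2 G, unit_pieces G & sums_to G h.
Proof.
by move=> [f [Xf f1 ->]]; exists (piece f); [exists f|exact: commutator_sums_to].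
Qed.

(** Here [sigma = beta - gamma]. Small shells decay at rate [1 - gamma - sigma = 1 - beta] in the
    Hölder seminorm, and at rate [1 - sigma], which is no smaller, in the sup norm; large shells
    decay at rate [sigma]. Both CMO targets are covered, as [gamma = 0] is allowed. *)
Lemma commutator_compact_CMO beta gamma : 0 < beta < 1 ->
  gamma = alpha + beta - n%:R / p -> 0 <= gamma < 1 ->
  maps_compactly (morrey p q) (morrey_norm p q) (CMO gamma) (BMO_norm gamma) T.
Proof.
move=> /andP[b0 b1] gE hg; have /andP[g0 g1] := hg; have s0 := sigma_gt0.
pose delta := minr (1 - beta) sigma.
have de0 : 0 < delta by rewrite lt_min s0 subr_gt0 b1.
have ds : delta <= sigma by rewrite ge_min lexx orbT.
have db : delta <= 1 - beta by rewrite ge_min lexx.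
pose theta : R := 2 `^ (- delta).
have th01 : 0 < theta < 1 by exact: powR2_ratio.
pose B A := 4 * piece_const n p Mb Lb (KA A).
have decay f A : morrey p q f -> 0 <= A -> (morrey_norm p q f <= A%:E)%E ->
    holder_decay gamma theta (B A) (piece f).
  move=> [mf _] A0 fA; have fg := growth A0 fA.
  split => [j x|j x y].
    apply: (le_trans (commutator_piece_sup halpha hq hqp b_cont b_bnd b_lip Lb_ge0 mf fg j x de0 ds _)).
      by move: db; rewrite gE in g0 *; lra.
    apply: ler_wpM2r; first by apply: exprn_ge0; exact: powR_ge0.
    by apply: ler_wpM2r; [exact: (piece_const_ge0 b_bnd Lb_ge0 fg)|rewrite ler_nat].
  apply: (commutator_piece_holder halpha hq hqp b_cont b_bnd b_lip Lb_ge0 mf fg j x y de0 hg ds).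
  by move: db; rewrite gE; lra.
split.
  move=> f Xf; have [A A0 fA] := morrey_fin Xf.
  exact: (sums_to_CMO n_gt0 hg th01 (commutator_piece_lip Xf A0 fA) (decay f A Xf A0 fA)
    (measurable_commutator_morrey Xf) (commutator_sums_to Xf)).
apply: (cmo_precompact n_gt0 hg th01 unit_pieces_lip _ unit_sums).
by move=> _ [f [Xf f1 ->]]; exact: decay.
Qed.

(** The relation between [s] and [p] says [sigma = n / s]. Together with [t / s = q / p] it yields
    [sigma t = n q / p], and source and target have the same growth exponent [d]. *)
Lemma commutator_compact_morrey s t : s^-1 = p^-1 - alpha / n%:R ->
  1 < t -> t <= s -> t / s = q / p ->
  maps_compactly (morrey p q) (morrey_norm p q) (morrey s t) (morrey_norm s t) T.
Proof.
move=> sE t1 ts tsE; have t0 : 0 < t by lra.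
have s0 : 0 < s by exact: lt_le_trans ts.
have /andP[a0 an] := halpha.
have nR0 : 0 < n%:R :> R by rewrite ltr0n.
have nsE : sigma = n%:R / s by rewrite sE; field; rewrite !lt0r_neq0.
have hst : sigma * t = n%:R * q / p.
  by rewrite nsE -!mulrA -tsE; congr (_ * _); rewrite mulrC.
have ndE : n%:R - n%:R * t / s = d by rewrite -!mulrA tsE.
have ps : p <= s.
  rewrite -lef_pV2 ?posrE// sE lerBlDr lerDl divr_ge0//; exact: ltW.
have hqt : q <= t.
  have -> : t = q / p * s by rewrite -tsE divfK// lt0r_neq0.
  rewrite -mulrA ler_peMr ?(ltW q_gt0)// mulrC ler_pdivlMr// mul1r//.
have p1 : 1 < p by exact: lt_le_trans hqp.
have d10 : 0 < d1.
  by rewrite subr_gt0 ltr_pdivrMr// ltr_pMr.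
(* The three rates are [t] for small shells, [sigma t] for large shells within radius [Rb], and
   [d1 t] for large shells outside it. *)
pose delta := minr t (minr (sigma * t) (d1 * t)).
have de0 : 0 < delta.
  by rewrite !lt_min t0 !mulr_gt0.
have dt : delta <= t by rewrite ge_min lexx.
have ds : delta <= sigma * t by rewrite !ge_min lexx !orbT.
have dd : delta <= d1 * t by rewrite !ge_min lexx !orbT.
(* Chosen so that the square of [omega^(j (t + 1))] is [2^(- delta j)]: half of the decay pays for
   summation, the other half controls tails. *)
pose omega : R := 2 `^ (- (delta / (2 * (t + 1)))).
have t10 : 0 < t + 1 by lra.
have om01 : 0 < omega < 1 by apply: powR2_ratio; rewrite divr_gt0// mulr_gt0.
have omE j : ((omega ^+ j) `^ (t + 1)) ^+ 2 = (2 `^ (- delta)) ^+ j.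
  exact: dyadic_ratio_powR.
pose C A := 2 `^ t * (small_shell_const n p q Mb Lb (KA A) t + large_shell_const n p q Mb Lb Rb (KA A) t).
have pgrowth f A : morrey p q f -> 0 <= A -> (morrey_norm p q f <= A%:E)%E ->
    forall j, ball_growth t (n%:R - n%:R * t / s) (C A * ((omega ^+ j) `^ (t + 1)) ^+ 2)
      (fun x => piece f (j, x)).
  move=> [mf _] A0 fA j; rewrite omE ndE.
  exact: (commutator_piece_growth halpha hq hqp b_cont b_bnd b_lip Lb_ge0 b_supp Rb_gt0
    mf (growth A0 fA) hqt hst j (ltW de0) dt ds dd).
split.
  move=> f Xf; have [A A0 fA] := morrey_fin Xf.
  have G2 := pgrowth f A Xf A0 fA.
  have C0 : 0 <= C A by have := ball_growth_ge0 (G2 0); rewrite expr0 powR1 expr1n mulr1.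
  have G1 j : ball_growth t (n%:R - n%:R * t / s) (C A * (omega ^+ j) `^ (t + 1))
      (fun x => piece f (j, x)).
    apply: ball_growth_le (G2 j); apply: ler_wpM2l => //.
    rewrite expr2; apply: ler_piMr; first exact: powR_ge0.
    have /andP[om0 om1] := om01.
    rewrite -[leRHS](one_powR (t + 1)); apply: powR_le_pos; [exact: ltW|by apply: exprn_ge0; exact: ltW|].
    by apply: exprn_ile1; exact: ltW.
  have mG j := equilipschitz_measurable j (commutator_piece_lip Xf A0 fA).
  have mT := measurable_commutator_morrey Xf.
  apply: (ball_growth_morrey n_gt0 t1 ts mT).
  exact: (sums_to_growth om01 t0 mG G1 mT (commutator_sums_to Xf)).
apply: (morrey_precompact n_gt0 t1 ts unit_pieces_lip om01 _ unit_sums).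
by move=> _ [f [Xf f1 ->]]; exact: pgrowth.
Qed.

End commutator_compactness.

Theorem propositionA4 (R : realType) (n : nat) (alpha beta p q : R)
    (b : 'rV[R]_n -> R)
    (halpha : 0 < alpha < n%:R) (hbeta : 0 < beta < 1)
    (halphabeta : alpha + beta < n%:R)
    (hq : 1 < q) (hqp : q <= p)
    (hb : smooth_compact_support b)
    (hwd : @riesz_well_defined R n alpha p q) :
  [/\ n%:R / p = alpha + beta ->
        maps_compactly (morrey p q) (morrey_norm p q)
          (CMO 0) (BMO_norm 0) (commutator alpha b),
      forall gamma : R, gamma = alpha + beta - n%:R / p -> 0 < gamma < 1 ->
        maps_compactly (morrey p q) (morrey_norm p q)
          (CMO gamma) (BMO_norm gamma) (commutator alpha b) &
      forall s t : R, alpha + beta < n%:R / p ->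
        s^-1 = p^-1 - alpha / n%:R -> 1 < t -> t <= s -> t / s = q / p ->
        maps_compactly (morrey p q) (morrey_norm p q)
          (morrey s t) (morrey_norm s t) (commutator alpha b)].
Proof.
have [Mb Mb0 b_bnd] := test_function_bounded hb.
have [Lb Lb0 b_lip] := test_function_lipschitz hb.
have [Rb Rb0 b_supp] := test_function_support hb.
have b_cont := smooth_continuous hb.
split.
- move=> np; apply: (commutator_compact_CMO halpha hq hqp hwd b_cont b_bnd b_lip (ltW Lb0) b_supp hbeta).
    by rewrite np subrr.
  by rewrite lexx ltr01.
- move=> gamma gE /andP[g0 g1].
  apply: (commutator_compact_CMO halpha hq hqp hwd b_cont b_bnd b_lip (ltW Lb0) b_supp hbeta gE).
  by rewrite (ltW g0).
- move=> s t _ sE t1 ts tsE.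
  exact: (commutator_compact_morrey halpha hq hqp hwd b_cont b_bnd b_lip (ltW Lb0) b_supp Rb0 sE t1 ts tsE).
Qed.
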